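(* Let $X := \phi^{-1}(\eta) \subseteq \mathbb{A}_\kappa^{\ell_1+\cdots+\ell_m+m+2}$ be the fiber, over a closed point $\eta$ of $S=\operatorname{Spec}(K[\mathbf{c}^{\pm 1}])$, of the spectrum of the star cluster algebra with principal coefficients whose quiver has $m$ rays of lengths $\ell_1,\ldots,\ell_m$ (all notation as defined in the context). The singularities of $X$ have the following classification: (1) either $X$ has an isolated singularity locally at which $X$ is isomorphic to a hypersurface singularity of type $A_1$; (2) or $\operatorname{Sing}(X) \cong \bigcup_{i=1}^s C_i$ has $s$ disjoint components (where $C_i$ is not necessarily irreducible) and, for each $i \in \{1,\ldots,s\}$, $X$ is locally at $C_i$ isomorphic to a cylinder over an intersection of compatible $A_1$-hypersurface singularities; (3) or $X$ is regular.
   Context: **The star cluster algebra.** Let $K$ be a field of any characteristic, $m\geq 1$, and $\ell_1,\ldots,\ell_m$ positive integers. The star-shaped quiver $\mathcal{Q}_\star$ has vertices $0$ and $i^{(\alpha)}$ ($1\le\alpha\le m$, $1\le i\le \ell_\alpha$), all mutable, and arrows $1^{(\alpha)}\to 0$ and $(i+1)^{(\alpha)}\to i^{(\alpha)}$ for $1\le i<\ell_\alpha$. The quiver $\mathcal{Q}_\star^{\mathrm{prin}}$ is obtained by adding, for each mutable vertex $k$, a frozen vertex $k_c$ and one arrow $k_c\to k$. The cluster algebra with principal coefficients $\mathcal{A}_\star^{\mathrm{prin}} := \mathcal{A}(\mathcal{Q}_\star^{\mathrm{prin}})$ (over $K$, coefficient variables invertible) is, since the quiver is acyclic, $$\mathcal{A}_\star^{\mathrm{prin}}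 \cong K_{\mathbf c}[\mathbf x,\mathbf y,u,v]/\langle g, f_i^{(\alpha)} \mid 1\le\alpha\le m,\ 1\le i\le\ell_\alpha\rangle,$$ where $\mathbf c=(c_0, c_i^{(\alpha)})$, $\mathbf x=(x_i^{(\alpha)})$, $\mathbf y=(y_i^{(\alpha)})$ ($1\le\alpha\le m$, $1\le i\le \ell_\alpha$), $u$, $v$ are independent variables, $K_{\mathbf c}:=K[\mathbf c^{\pm1}]$, $g = uv-c_0\prod_{\alpha=1}^m x_1^{(\alpha)}-1$, $f_i^{(\alpha)}=x_i^{(\alpha)}y_i^{(\alpha)}-x_{i-1}^{(\alpha)}-c_i^{(\alpha)}x_{i+1}^{(\alpha)}$ for $i<\ell_\alpha$, $f_{\ell_\alpha}^{(\alpha)}=x_{\ell_\alpha}^{(\alpha)}y_{\ell_\alpha}^{(\alpha)}-x_{\ell_\alpha-1}^{(\alpha)}-c_{\ell_\alpha}^{(\alpha)}$, with the convention $x_0^{(\alpha)}:=u$. **The fiber $X$.** Let $\phi\colon\operatorname{Spec}(\mathcal{A}_\star^{\mathrm{prin}})\to S:=\operatorname{Spec}(K_{\mathbf c})$ be the structure morphism, $\eta\in S$ a closed point, $\kappa=\kappa(\eta)$ the residue field of $\mathcal{O}_{S,\eta}$, and $X:=\phi^{-1}(\eta)$. It is embedded as $$X=V(F_1,\ldots,F_m,G)\subseteq \mathbb{A}_\kappa^{\ell_1+\cdots+\ell_m+m+2}$$ with coordinates $z_1^{(\alpha)},\ldots,z_{\ell_\alpha+1}^{(\alpha)}$ ($1\le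 \alpha\le m$), $u$, $w$, where $$F_\alpha = P_{\ell_\alpha+1}(z_1^{(\alpha)},\ldots,z_{\ell_\alpha+1}^{(\alpha)})-\lambda_\alpha u,\qquad G = uw-\prod_{\alpha=1}^m P_{\ell_\alpha}(z_1^{(\alpha)},\ldots,z_{\ell_\alpha}^{(\alpha)})-\mu.$$ Here $P_n$ are the continuant polynomials: $P_0=1$, $P_1(z_1)=z_1$, $P_n(z_1,\ldots,z_n)=z_nP_{n-1}(z_1,\ldots,z_{n-1})-P_{n-2}(z_1,\ldots,z_{n-2})$ for $n\ge2$; and $\lambda_\alpha,\mu\in\kappa^\times$ are the images in $\kappa$ of $(\rho_1^{(\alpha)})^{-1}$ and $c_0^{-1}\big(\prod_{\alpha=1}^m\rho_2^{(\alpha)}\big)^{-1}$, where $\rho_{\ell_\alpha+1}^{(\alpha)}:=1$, $\rho_{\ell_\alpha}^{(\alpha)}:=c_{\ell_\alpha}^{(\alpha)}$, $\rho_i^{(\alpha)}:=c_i^{(\alpha)}\rho_{i+2}^{(\alpha)}$ for $i<\ell_\alpha$. **Singularity types.** $\operatorname{Sing}(X)$ is the locus of points at which $X$ is not regular. A hypersurface singularity of dimension $n$ is *of type $A_1$* if it is an isolated singularity at which the variety is locally given by $x_0^2+x_1x_2+\cdots+x_{n-1}x_n=0$ (if $n$ is even), resp. $x_0x_1+\cdots+x_{n-1}x_n=0$ (if $n$ is odd), after possibly passing to the completion at the singular point. An *intersection of ($n\ge2$) compatible $A_1$-hypersurface singularities* (centered at $V(\mathbf t^{(a)}\mid a\in\{1,\ldots,n\})$)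 is a singularity of the form $$\mathcal{X}^{(n)}=V(g_a(\mathbf t^{(a)})-g_b(\mathbf t^{(b)})\mid a,b\in\{1,\ldots,n\})\subset\mathbb{A}_\kappa^{2(q_1+\cdots+q_n)},$$ where $q_a\ge1$, $\mathbf t^{(a)}=(t_1^{(a)},\ldots,t_{2q_a}^{(a)})$ and $g_a(\mathbf t^{(a)})=\sum_{i=1}^{q_a}t_{2i-1}^{(a)}t_{2i}^{(a)}$. A singularity $Z\subset\mathbb{A}_\kappa^N$ that is locally isomorphic to $Y\times\mathbb{A}_\kappa^{N-M}$ for a singularity $Y\subset\mathbb{A}_\kappa^M$ is called a *cylinder over $Y$*. *)

(* Defs.v *)
From HB Require Import structures.
From mathcomp Require Import all_boot all_algebra.
From mathcomp Require Import boolp classical_sets.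
From mathcomp Require Import mpoly ring zify.

Set Implicit Arguments.
Unset Strict Implicit.
Unset Printing Implicit Defensive.

Import GRing.Theory.
Local Open Scope ring_scope.
Local Open Scope classical_set_scope.
Local Open Scope quotient_scope.

(* Rings are [comPzRingType]s: quotients and localizations may be zero. *)

Record ideal (R : comPzRingType) := Ideal {
  ideal_set :> R -> Prop;
  ideal0 : ideal_set 0;
  idealD : forall a b, ideal_set a -> ideal_set b -> ideal_set (a + b);
  idealM : forall a b, ideal_set b -> ideal_set (a * b) }.

Section IdealGeneration.
Variable R : comPzRingType.
Implicit Types (E : set R) (I : ideal R).

Definition gen_set E : set R := [set x | forall I, E `<=` ideal_set I -> I x].

Fact gen_set0 E : gen_set E 0. Proof. by move=> I _; apply: ideal0. Qed.
Fact gen_setD E a b : gen_set E a -> gen_set E b -> gen_set E (a + b).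
Proof. by move=> Ea Eb I EI; apply: idealD; [apply: Ea|apply: Eb]. Qed.
Fact gen_setM E a b : gen_set E b -> gen_set E (a * b).
Proof. by move=> Eb I EI; apply: idealM; apply: Eb. Qed.

Definition ideal_gen E : ideal R :=
  Ideal (@gen_set0 E) (@gen_setD E) (@gen_setM E).

Fixpoint ideal_pow I (k : nat) : ideal R :=
  if k is k'.+1
  then ideal_gen [set x | exists a b, [/\ I a, ideal_pow I k' b & x = a * b]]
  else ideal_gen setT.

End IdealGeneration.

Section QuotientRing.
Variables (R : comPzRingType) (I : ideal R).

Definition ideal_pred : {pred R} := fun x => `[< I x >].

Lemma ideal_predE x : (x \in ideal_pred) = `[< I x >]. Proof. by []. Qed.

Fact ideal_pred_zmod : zmod_closed ideal_pred.
Proof.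
split=> [|x y]; rewrite !ideal_predE; first by apply/asboolP/ideal0.
move=> /asboolP Ix /asboolP Iy; apply/asboolP/idealD => //.
by rewrite -mulN1r; apply: idealM.
Qed.
HB.instance Definition _ := GRing.isZmodClosed.Build R ideal_pred ideal_pred_zmod.

Definition quot : Type := Quotient.quot (ideal_pred : zmodClosed R).
HB.instance Definition _ := GRing.Zmodule.on quot.

Definition qclass (x : R) : quot := \pi_(Quotient.quot (ideal_pred : zmodClosed R)) x.

Lemma qclassP (x : quot) : exists a, x = qclass a.
Proof. by exists (repr x); rewrite /qclass reprK. Qed.

Lemma qclass_eq a b : qclass a = qclass b <-> I (a - b).
Proof.
rewrite /qclass; split=> [/eqP|Iab]; last apply/eqP.
  by rewrite piE Quotient.equivE => /asboolP.
by rewrite piE Quotient.equivE; apply/asboolP.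
Qed.

Fact qclassB : zmod_morphism qclass.
Proof. exact: pi_is_zmod_morphism. Qed.
HB.instance Definition _ := GRing.isZmodMorphism.Build R quot qclass qclassB.

Definition qmul (x y : quot) : quot :=
  qclass (repr (x : Quotient.quot _) * repr (y : Quotient.quot _)).

Lemma qclass_mul a b : qmul (qclass a) (qclass b) = qclass (a * b).
Proof.
have idx x : I (repr (qclass x : Quotient.quot _) - x).
  by apply/qclass_eq; rewrite /qclass reprK.
rewrite /qmul; apply/qclass_eq.
move: (idx a) (idx b); set a' := repr _; set b' := repr _ => Ia Ib.
have -> : a' * b' - a * b = b' * (a' - a) + a * (b' - b) by ring.
by apply: idealD; apply: idealM.
Qed.

Fact qmulA : associative qmul.
Proof.
move=> x y z; have [[a ->] [b ->] [c ->]] := And3 (qclassP x) (qclassP y) (qclassP z).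
by rewrite !qclass_mul mulrA.
Qed.
Fact qmulC : commutative qmul.
Proof.
move=> x y; have [[a ->] [b ->]] := conj (qclassP x) (qclassP y).
by rewrite !qclass_mul mulrC.
Qed.
Fact qmul1 : left_id (qclass 1) qmul.
Proof. by move=> x; have [a ->] := qclassP x; rewrite qclass_mul mul1r. Qed.
Fact qmulD : left_distributive qmul +%R.
Proof.
move=> x y z; have [[a ->] [b ->] [c ->]] := And3 (qclassP x) (qclassP y) (qclassP z).
by rewrite -raddfD !qclass_mul -raddfD mulrDl.
Qed.
HB.instance Definition _ :=
  GRing.Zmodule_isComPzRing.Build quot qmulA qmulC qmul1 qmulD.

Fact qclass_monoid : monoid_morphism qclass.
Proof. by split=> // a b; rewrite -qclass_mul. Qed.
HB.instance Definition _ := GRing.isMonoidMorphism.Build R quot qclass qclass_monoid.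

End QuotientRing.

Record mulset (R : comPzRingType) := Mulset {
  mulset_set :> R -> Prop;
  mulset1 : mulset_set 1;
  mulsetM : forall a b, mulset_set a -> mulset_set b -> mulset_set (a * b) }.

Section Localization.
Variables (R : comPzRingType) (S : mulset R).

Definition denom : Type := {s : R | `[< S s >]}.
HB.instance Definition _ := Choice.on denom.

Definition dval (s : denom) : R := sval s.
Definition mkdenom (s : R) (Ss : S s) : denom := exist _ s (introT (asboolP (S s)) Ss).

Definition loc_equiv (x y : R * denom) : bool :=
  `[< exists2 r, S r & r * (x.1 * dval y.2) = r * (y.1 * dval x.2) >].

Lemma denomP (s : denom) : S (dval s). Proof. by apply/asboolP/(svalP s). Qed.

Fact loc_equiv_class : equiv_class_of loc_equiv.
Proof.
split.
- by move=> x; apply/asboolP; exists 1 => //; apply: mulset1.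
- by move=> x y; apply: asbool_equiv_eq; split=> -[r Sr e]; exists r.
move=> [b t] [a s] [c u] /= /asboolP[r Sr /= e] /asboolP[r' Sr' /= e'].
apply/asboolP; exists (r * r' * dval t) => /=.
  by apply: mulsetM (denomP t); apply: mulsetM.
have -> : r * r' * dval t * (a * dval u) = r * (a * dval t) * (r' * dval u) by ring.
have -> : r * r' * dval t * (c * dval s) = r * dval s * (r' * (c * dval t)) by ring.
by rewrite e -e'; ring.
Qed.

Canonical loc_equiv_rel := EquivRelPack loc_equiv_class.
Canonical loc_enc_rel := defaultEncModRel loc_equiv.

Definition loc : Type := {eq_quot loc_equiv}.
HB.instance Definition _ := Choice.on loc.

Definition mkfrac (a : R) (s : denom) : loc := \pi_({eq_quot loc_equiv}) (a, s).

Lemma fracP (x : loc) : exists a s, x = mkfrac a s.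
Proof.
exists (repr (x : {eq_quot loc_equiv})).1, (repr (x : {eq_quot loc_equiv})).2.
by rewrite /mkfrac -surjective_pairing reprK.
Qed.

Lemma frac_eq a s b t :
  mkfrac a s = mkfrac b t <-> exists2 r, S r & r * (a * dval t) = r * (b * dval s).
Proof.
rewrite /mkfrac; split=> [/eqP|e]; last apply/eqP.
  by rewrite piE => /asboolP.
by rewrite piE; apply/asboolP.
Qed.

Definition den1 : denom := mkdenom (mulset1 S).
Definition denM (s t : denom) : denom := mkdenom (mulsetM (denomP s) (denomP t)).

Lemma dvalE : (dval den1 = 1) * (forall s t, dval (denM s t) = dval s * dval t)
  * (forall s (Ss : S s), dval (mkdenom Ss) = s).
Proof. by []. Qed.

Definition lnum (x : loc) : R := (repr (x : {eq_quot loc_equiv})).1.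
Definition lden (x : loc) : denom := (repr (x : {eq_quot loc_equiv})).2.

Lemma frac_repr (x : loc) : mkfrac (lnum x) (lden x) = x.
Proof. by rewrite /mkfrac /lnum /lden -surjective_pairing reprK. Qed.

Definition ladd (x y : loc) : loc :=
  mkfrac (lnum x * dval (lden y) + lnum y * dval (lden x)) (denM (lden x) (lden y)).
Definition lopp (x : loc) : loc := mkfrac (- lnum x) (lden x).
Definition lmul (x y : loc) : loc :=
  mkfrac (lnum x * lnum y) (denM (lden x) (lden y)).

Lemma frac_add a s b t :
  ladd (mkfrac a s) (mkfrac b t) = mkfrac (a * dval t + b * dval s) (denM s t).
Proof.
have /frac_eq[r Sr e] := frac_repr (mkfrac a s).
have /frac_eq[r' Sr' e'] := frac_repr (mkfrac b t).
apply/frac_eq; exists (r * r'); first exact: mulsetM.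
rewrite !dvalE; move: e e'; move: (lnum (mkfrac a s)) (lden (mkfrac a s)) (lnum (mkfrac b t)) (lden (mkfrac b t)).
move=> a' s' b' t' e e'.
transitivity (r * (a' * dval s) * (r' * dval t * dval t') +
              r' * (b' * dval t) * (r * dval s * dval s')); first by ring.
by rewrite e e'; ring.
Qed.

Lemma frac_opp a s : lopp (mkfrac a s) = mkfrac (- a) s.
Proof.
have /frac_eq[r Sr e] := frac_repr (mkfrac a s).
by apply/frac_eq; exists r => //; rewrite !mulNr !mulrN e.
Qed.

Lemma frac_mul a s b t : lmul (mkfrac a s) (mkfrac b t) = mkfrac (a * b) (denM s t).
Proof.
have /frac_eq[r Sr e] := frac_repr (mkfrac a s).
have /frac_eq[r' Sr' e'] := frac_repr (mkfrac b t).
apply/frac_eq; exists (r * r'); first exact: mulsetM.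
rewrite !dvalE; move: e e'; move: (lnum (mkfrac a s)) (lden (mkfrac a s)) (lnum (mkfrac b t)) (lden (mkfrac b t)).
move=> a' s' b' t' e e'.
transitivity (r * (a' * dval s) * (r' * (b' * dval t))); first by ring.
by rewrite e e'; ring.
Qed.

Lemma frac_eqW a s b t : a * dval t = b * dval s -> mkfrac a s = mkfrac b t.
Proof. by move=> e; apply/frac_eq; exists 1; [exact: mulset1|rewrite e]. Qed.

Fact laddA : associative ladd.
Proof.
move=> x y z; have [a [s ->]] := fracP x; have [b [t ->]] := fracP y.
have [c [u ->]] := fracP z; rewrite !frac_add; apply: frac_eqW; rewrite ?dvalE; ring.
Qed.
Fact laddC : commutative ladd.
Proof.
move=> x y; have [a [s ->]] := fracP x; have [b [t ->]] := fracP y.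
by rewrite !frac_add; apply: frac_eqW; rewrite ?dvalE; ring.
Qed.
Fact ladd0 : left_id (mkfrac 0 den1) ladd.
Proof.
by move=> x; have [a [s ->]] := fracP x; rewrite frac_add; apply: frac_eqW; rewrite ?dvalE; ring.
Qed.
Fact laddN : left_inverse (mkfrac 0 den1) lopp ladd.
Proof.
move=> x; have [a [s ->]] := fracP x; rewrite frac_opp frac_add.
by apply: frac_eqW; rewrite ?dvalE; ring.
Qed.
HB.instance Definition _ := GRing.isZmodule.Build loc laddA laddC ladd0 laddN.

Fact lmulA : associative lmul.
Proof.
move=> x y z; have [a [s ->]] := fracP x; have [b [t ->]] := fracP y.
have [c [u ->]] := fracP z; rewrite !frac_mul; apply: frac_eqW; rewrite ?dvalE; ring.
Qed.
Fact lmulC : commutative lmul.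
Proof.
move=> x y; have [a [s ->]] := fracP x; have [b [t ->]] := fracP y.
by rewrite !frac_mul; apply: frac_eqW; rewrite ?dvalE; ring.
Qed.
Fact lmul1 : left_id (mkfrac 1 den1) lmul.
Proof.
by move=> x; have [a [s ->]] := fracP x; rewrite frac_mul; apply: frac_eqW; rewrite ?dvalE; ring.
Qed.
Fact lmulD : left_distributive lmul +%R.
Proof.
move=> x y z; have [a [s ->]] := fracP x; have [b [t ->]] := fracP y.
have [c [u ->]] := fracP z.
by rewrite /GRing.add /= !(frac_mul, frac_add); apply: frac_eqW; rewrite ?dvalE; ring.
Qed.
HB.instance Definition _ :=
  GRing.Zmodule_isComPzRing.Build loc lmulA lmulC lmul1 lmulD.

Lemma fracD a s b t :
  mkfrac a s + mkfrac b t = mkfrac (a * dval t + b * dval s) (denM s t).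
Proof. exact: frac_add. Qed.
Lemma fracN a s : - mkfrac a s = mkfrac (- a) s. Proof. exact: frac_opp. Qed.
Lemma fracM a s b t : mkfrac a s * mkfrac b t = mkfrac (a * b) (denM s t).
Proof. exact: frac_mul. Qed.

Definition to_loc (a : R) : loc := mkfrac a den1.

Fact to_locB : zmod_morphism to_loc.
Proof. by move=> a b; rewrite /to_loc fracN fracD; apply: frac_eqW; rewrite ?dvalE; ring. Qed.
HB.instance Definition _ := GRing.isZmodMorphism.Build R loc to_loc to_locB.
Fact to_loc_monoid : monoid_morphism to_loc.
Proof. by split=> // a b; rewrite /to_loc fracM; apply: frac_eqW; rewrite ?dvalE; ring. Qed.
HB.instance Definition _ := GRing.isMonoidMorphism.Build R loc to_loc to_loc_monoid.

End Localization.

Record spec (R : comPzRingType) := Point {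
  point_ideal :> ideal R;
  point1 : ~ point_ideal 1;
  pointM : forall a b, point_ideal (a * b) -> point_ideal a \/ point_ideal b }.

Section Spectrum.
Variable R : comPzRingType.
Implicit Types (x : spec R) (U Z : set (spec R)).

Definition zclosed Z := exists I : ideal R, Z = [set x | ideal_set I `<=` x].
Definition zopen U := zclosed (~` U).
Definition zconnected Z := forall Z1 Z2, zclosed Z1 -> zclosed Z2 ->
  Z `<=` Z1 `|` Z2 -> Z `&` Z1 `&` Z2 = set0 -> Z `<=` Z1 \/ Z `<=` Z2.

Fact point_compl1 x : ~ x 1. Proof. exact: point1. Qed.
Fact point_complM x a b : ~ x a -> ~ x b -> ~ x (a * b).
Proof. by move=> xa xb /pointM[]. Qed.
Definition point_compl x : mulset R :=
  @Mulset _ (fun a => ~ x a) (@point_compl1 x) (@point_complM x).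

Definition loc_at x : comPzRingType := loc (point_compl x).

Definition max_set x : set (loc_at x) := [set y | exists2 a, x a & exists s, y = mkfrac a s].
Arguments max_set : clear implicits.

Lemma max_setP x a s : max_set x (mkfrac a s) -> x a.
Proof.
move=> [b xb [t /frac_eq[r xr e]]].
have : x (r * (b * dval s)) by apply: idealM; rewrite mulrC; apply: idealM.
by rewrite -e => /pointM[//|/pointM[//|xt]]; case: (denomP t xt).
Qed.

Fact max_set0 x : max_set x 0.
Proof. by exists 0; [apply: ideal0|exists (den1 _)]. Qed.
Fact max_setD x y z : max_set x y -> max_set x z -> max_set x (y + z).
Proof.
move=> [a xa [s ->]] [b xb [t ->]].
exists (a * dval t + b * dval s); last by exists (denM s t); rewrite fracD.
by apply: idealD; rewrite mulrC; apply: idealM.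
Qed.
Fact max_setM x y z : max_set x z -> max_set x (y * z).
Proof.
have [b [t ->]] := fracP y; move=> [a xa [s ->]].
by exists (b * a); [apply: idealM|exists (denM t s); rewrite fracM].
Qed.
Definition max_ideal x : ideal (loc_at x) :=
  Ideal (@max_set0 x) (@max_setD x) (@max_setM x).

Definition residue x : Type := quot (max_ideal x).
HB.instance Definition _ x := GRing.ComPzRing.on (residue x).

Fact residue_nz x : (1 : residue x) != 0.
Proof.
apply/eqP=> e; have /qclass_eq : qclass (max_ideal x) 1 = qclass (max_ideal x) 0.
  by rewrite rmorph1 rmorph0.
by rewrite subr0 => /max_setP /point1.
Qed.
HB.instance Definition _ x := GRing.PzSemiRing_isNonZero.Build (residue x) (@residue_nz x).

Fact residue_inv x (y : residue x) :
  exists z : residue x, (y != 0 -> z * y = 1) /\ (y = 0 -> z = 0).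
Proof.
have [->|y0] := eqVneq y 0; first by exists 0.
have [a' ea] := qclassP y; have [a [s es]] := fracP a'.
have xa : ~ x a.
  move=> xa; move/eqP: y0; apply; rewrite ea -(rmorph0 (qclass (max_ideal x))); apply/qclass_eq.
  by rewrite subr0; exists a => //; exists s.
exists (qclass _ (mkfrac (dval s) (@mkdenom _ (point_compl x) a xa))).
split=> [_|/eqP]; last by rewrite (negPf y0).
rewrite ea es -rmorphM fracM -(rmorph1 (qclass (max_ideal x))).
congr (qclass (max_ideal x) _).
by apply: frac_eqW; rewrite !dvalE; ring.
Qed.
Definition rinv x (y : residue x) : residue x := projT1 (cid (residue_inv y)).
Fact rinvV x (y : residue x) : y != 0 -> rinv y * y = 1.
Proof. by move=> y0; rewrite /rinv; case: cid => z /= [/(_ y0)]. Qed.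
Fact rinv0 x : rinv (0 : residue x) = 0.
Proof. by rewrite /rinv; case: cid => z /= [_ /(_ erefl)]. Qed.
HB.instance Definition _ x := GRing.ComNzRing_isField.Build (residue x) (@rinvV x) (@rinv0 x).

Definition residue_field x : fieldType := residue x.

Definition to_residue x : R -> residue_field x := qclass (max_ideal x) \o to_loc (point_compl x).
HB.instance Definition _ x := GRing.RMorphism.on (@to_residue x).

Definition prime_chain (n : nat) := exists c : nat -> spec R,
  forall i, (i < n)%N -> ideal_set (c i) `<` ideal_set (c i.+1).
Definition krull_dim (n : nat) :=
  prime_chain n /\ forall k, prime_chain k -> (k <= n)%N.

End Spectrum.

(* All the local rings considered below are Noetherian, being localizations of
   finitely generated algebras over a field. *)
Definition regular_at (R : comPzRingType) (x : spec R) := exists d,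
  krull_dim (loc_at x) d /\
  exists e : 'I_d -> loc_at x, ideal_set (max_ideal x) = ideal_gen (range e).

Definition sing (R : comPzRingType) : set (spec R) := [set x | ~ regular_at x].
Arguments sing : clear implicits.

Section Completion.
Variables (R : comPzRingType) (I : ideal R).

(* The inverse limit of the [R / I ^ k]: [r] represents both [a k.+1] and its
   image in [R / I ^ k]. *)
Definition coherent (a : forall k, quot (ideal_pow I k)) := forall k, exists r,
  a k.+1 = qclass (ideal_pow I k.+1) r /\ a k = qclass (ideal_pow I k) r.

Record completion := Completion {
  compl_val : forall k, quot (ideal_pow I k);
  compl_coherent : coherent compl_val }.

HB.instance Definition _ := gen_eqMixin completion.
HB.instance Definition _ := gen_choiceMixin completion.

Lemma compl_eq (a b : completion) : (forall k, compl_val a k = compl_val b k) -> a = b.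
Proof.
case: a b => [a ca] [b cb] /= eab; have {}eab : a = b by apply: functional_extensionality_dep.
by subst b; congr Completion; apply: Prop_irrelevance.
Qed.

Fact const_coherent (r : R) : coherent (fun k => qclass (ideal_pow I k) r).
Proof. by move=> k; exists r. Qed.
Definition to_compl (r : R) := Completion (const_coherent r).

Fact cadd_coherent (a b : completion) : coherent (fun k => compl_val a k + compl_val b k).
Proof.
move=> k; have [r [-> ->]] := compl_coherent a k.
by have [s [-> ->]] := compl_coherent b k; exists (r + s); rewrite !rmorphD.
Qed.
Definition cadd a b := Completion (cadd_coherent a b).

Fact copp_coherent (a : completion) : coherent (fun k => - compl_val a k).
Proof.
by move=> k; have [r [-> ->]] := compl_coherent a k; exists (- r); rewrite !rmorphN.
Qed.
Definition copp a := Completion (copp_coherent a).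

Fact cmul_coherent (a b : completion) : coherent (fun k => compl_val a k * compl_val b k).
Proof.
move=> k; have [r [-> ->]] := compl_coherent a k.
by have [s [-> ->]] := compl_coherent b k; exists (r * s); rewrite !rmorphM.
Qed.
Definition cmul a b := Completion (cmul_coherent a b).

Fact caddA : associative cadd. Proof. by move=> a b c; apply: compl_eq => k /=; rewrite addrA. Qed.
Fact caddC : commutative cadd. Proof. by move=> a b; apply: compl_eq => k /=; rewrite addrC. Qed.
Fact cadd0 : left_id (to_compl 0) cadd.
Proof. by move=> a; apply: compl_eq => k /=; rewrite rmorph0 add0r. Qed.
Fact caddN : left_inverse (to_compl 0) copp cadd.
Proof. by move=> a; apply: compl_eq => k /=; rewrite rmorph0 addNr. Qed.
HB.instance Definition _ := GRing.isZmodule.Build completion caddA caddC cadd0 caddN.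

Fact cmulA : associative cmul. Proof. by move=> a b c; apply: compl_eq => k /=; rewrite mulrA. Qed.
Fact cmulC : commutative cmul. Proof. by move=> a b; apply: compl_eq => k /=; rewrite mulrC. Qed.
Fact cmul1 : left_id (to_compl 1) cmul.
Proof. by move=> a; apply: compl_eq => k /=; rewrite rmorph1 mul1r. Qed.
Fact cmulD : left_distributive cmul +%R.
Proof. by move=> a b c; apply: compl_eq => k /=; rewrite mulrDl. Qed.
HB.instance Definition _ := GRing.Zmodule_isComPzRing.Build completion cmulA cmulC cmul1 cmulD.

Fact to_complB : zmod_morphism to_compl.
Proof. by move=> a b; apply: compl_eq => k /=; rewrite rmorphB. Qed.
HB.instance Definition _ := GRing.isZmodMorphism.Build R completion to_compl to_complB.
Fact to_compl_monoid : monoid_morphism to_compl.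
Proof. by split=> // a b; apply: compl_eq => k /=; rewrite rmorphM. Qed.
HB.instance Definition _ := GRing.isMonoidMorphism.Build R completion to_compl to_compl_monoid.

End Completion.

(* [comAlgType k] would require a nonzero ring. *)
Record algebra (k : fieldType) := Algebra {
  alg_ring :> comPzRingType;
  alg_in : {rmorphism k -> alg_ring} }.

Definition alg_iso (k : fieldType) (A B : algebra k) :=
  exists h : {rmorphism A -> B}, bijective h /\ forall c, h (alg_in A c) = alg_in B c.

Section LocalAlgebra.
Variables (k : fieldType) (A : algebra k) (x : spec A).

Definition stalk : algebra k :=
  Algebra (to_loc (point_compl x) \o alg_in A : {rmorphism k -> loc_at x}).
Definition completed_stalk : algebra k :=
  Algebra (@to_compl (loc_at x) (max_ideal x) \o alg_in stalk
           : {rmorphism k -> completion (max_ideal x)}).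

End LocalAlgebra.

Section AffineScheme.
Variables (k : fieldType) (T : finType).

Definition pvar (t : T) : {mpoly k[#|T|]} := 'X_(enum_rank t).

Variable E : set {mpoly k[#|T|]}.
Definition affine : algebra k :=
  Algebra (qclass (ideal_gen E) \o @mpolyC #|T| k : {rmorphism k -> quot (ideal_gen E)}).
Definition affine_coord (t : T) : affine := qclass (ideal_gen E) (pvar t).

End AffineScheme.

Section SingularityTypes.
Variable k : fieldType.

Definition quadric (n : nat) : {mpoly k[#|'I_n.+1|]} :=
  let X i := pvar k (inord i : 'I_n.+1) in
  if odd n then \sum_(i < n.+1./2) X i.*2 * X i.*2.+1
  else X 0%N ^+ 2 + \sum_(i < n./2) X i.*2.+1 * X i.*2.+2.

Definition hyperquadric (n : nat) : algebra k := affine [set quadric n].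

Definition isolated_singularity (A : algebra k) (x : spec A) :=
  exists U, [/\ zopen U, U x & sing A `&` U = [set x]].

(* The local equation is understood after completion: the completed local ring is
   compared, over [k], with that of the hyperquadric at the origin [o]. *)
Definition A1_singularity (A : algebra k) (x : spec A) :=
  isolated_singularity x /\
  exists n (o : spec (hyperquadric n)),
    (forall i, o (affine_coord _ i)) /\
    alg_iso (completed_stalk x) (completed_stalk o).

Section Intersection.
Variables (n : nat) (q : 'I_n -> nat) (d : nat).

(* [inl (a, (i, false))] and [inl (a, (i, true))] index t_(2i-1)^(a) and
   t_(2i)^(a); the last [d] coordinates are those of the cylinder. *)
Definition cyl_var : finType := ({a : 'I_n & 'I_(q a) * bool} + 'I_d)%type.
Definition tvar (a : 'I_n) (i : 'I_(q a)) (b : bool) : cyl_var :=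
  inl (@Tagged _ a (fun a => 'I_(q a) * bool)%type (i, b)).

Definition gform (a : 'I_n) : {mpoly k[#|cyl_var|]} :=
  \sum_(i < q a) pvar k (tvar i false) * pvar k (tvar i true).

Definition A1_intersection_cylinder : algebra k :=
  affine [set p | exists a b, p = gform a - gform b].

Definition central (y : spec A1_intersection_cylinder) :=
  forall a (i : 'I_(q a)) b, y (affine_coord _ (tvar i b)).

End Intersection.

(* For schemes of finite type over [k], isomorphic local rings amount to isomorphic
   open neighborhoods of the two points. *)
Definition locally_iso (A B : algebra k) (x : spec A) (y : spec B) :=
  alg_iso (stalk x) (stalk y).

(* A single cylinder serves the whole of [C]. Some point of [C] must correspond to
   a point over the center V(t^(a) | a): otherwise a larger [n] could be had from a
   configuration seen only away from its center. *)
Definition locally_A1_cylinder (A : algebra k) (C : set (spec A)) :=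
  exists n (q : 'I_n -> nat) d,
    [/\ (2 <= n)%N, (forall a, (1 <= q a)%N),
        (forall x, C x -> exists y : spec (A1_intersection_cylinder q d), locally_iso x y) &
        (exists x, C x /\ exists y : spec (A1_intersection_cylinder q d),
           central y /\ locally_iso x y)].

End SingularityTypes.

Section Continuants.
Variable R : pzRingType.

Fixpoint continuant (z : nat -> R) (n : nat) : R :=
  match n with
  | 0 => 1
  | 1 => z 1%N
  | (n'.+1 as p).+1 => z p.+1 * continuant z p - continuant z n'
  end.

(* [rho_down c l j] is rho_(l + 1 - j). *)
Fixpoint rho_down (c : nat -> R) (l j : nat) : R :=
  match j with
  | 0 => 1
  | 1 => c l
  | j'.+2 => c (l - j'.+1)%N * rho_down c l j'
  end.
Definition rho (c : nat -> R) (l i : nat) : R := rho_down c l (l.+1 - i).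

End Continuants.

Section Star.
Variables (K : fieldType) (m : nat) (l : 'I_m -> nat).

(* [None] is the vertex 0, [Some (a, i)] the vertex (i+1)^(a). *)
Definition vertex : finType := option {a : 'I_m & 'I_(l a)}.

Definition cpoly : comPzRingType := {mpoly K[#|vertex|]}.

Definition monomial_set : set cpoly := [set p | exists e, p = 'X_[e]].
Fact monomial1 : monomial_set 1. Proof. by exists 0%MM; rewrite mpolyX0. Qed.
Fact monomialM p q : monomial_set p -> monomial_set q -> monomial_set (p * q).
Proof. by move=> [e ->] [f ->]; exists (e + f)%MM; rewrite mpolyXD. Qed.
Definition monomials : mulset cpoly := @Mulset _ monomial_set monomial1 monomialM.

(* K[c^(+-1)], as the polynomial ring localized at its monomials. *)
Definition Kc : comPzRingType := loc monomials.
Definition cgen (v : vertex) : Kc := to_loc monomials (pvar K v).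

Section Fiber.
Variable eta : spec Kc.
Local Notation kappa := (residue_field eta).

(* c_i^(a); the value outside [1 <= i <= l a] is never used. *)
Definition cray (a : 'I_m) (i : nat) : Kc :=
  if insub i.-1 is Some j then cgen (Some (@Tagged _ a (fun a => 'I_(l a)) j)) else 1.

Definition lambda (a : 'I_m) : kappa :=
  (to_residue eta (rho (cray a) (l a) 1))^-1.
Definition mu : kappa :=
  (to_residue eta (cgen None))^-1 *
  (to_residue eta (\prod_a rho (cray a) (l a) 2))^-1.

(* [inl (a, i)] indexes z_(i+1)^(a); [inr true] indexes u and [inr false] w. *)
Definition Xvar : finType := ({a : 'I_m & 'I_(l a).+1} + bool)%type.

Definition Xz (a : 'I_m) (i : nat) : {mpoly kappa[#|Xvar|]} :=
  pvar kappa (inl (@Tagged _ a (fun a => 'I_(l a).+1) (inord i.-1)) : Xvar).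
Definition Xu : {mpoly kappa[#|Xvar|]} := pvar kappa (inr true : Xvar).
Definition Xw : {mpoly kappa[#|Xvar|]} := pvar kappa (inr false : Xvar).

Definition eqF (a : 'I_m) := continuant (Xz a) (l a).+1 - lambda a *: Xu.
Definition eqG := Xu * Xw - \prod_a continuant (Xz a) (l a) - mu%:MP.

(* V(F_1, ..., F_m, G); [star_fiber_embedding] below identifies it with the fiber
   of the spectrum of the star cluster algebra. *)
Definition fiber : algebra kappa := affine (range eqF `|` [set eqG]).

End Fiber.
End Star.

(* Finitely many disjoint nonempty closed connected sets covering [Z]: these are the
   connected components of [Z]. *)
Definition components (R : comPzRingType) (Z : set (spec R)) s (C : 'I_s -> set (spec R)) :=
  [/\ forall i, [/\ C i !=set0, zclosed (C i) & zconnected (C i)],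
      forall i j, i != j -> C i `&` C j = set0 &
      Z = \bigcup_i C i].

Section StarFiber.
Variables (K : fieldType) (m : nat) (l : 'I_m -> nat) (eta : spec (Kc K l)).
Local Notation kappa := (residue_field eta).

(* [inl (a, (i, true))] and [inl (a, (i, false))] index x_(i+1)^(a) and
   y_(i+1)^(a); [inr true] indexes u and [inr false] indexes v. *)
Definition star_var : finType := ({a : 'I_m & 'I_(l a) * bool} + bool)%type.
Definition svar (a : 'I_m) (i : 'I_(l a)) (b : bool) : star_var :=
  inl (@Tagged _ a (fun a => 'I_(l a) * bool)%type (i, b)).

Definition su : {mpoly kappa[#|star_var|]} := pvar kappa (inr true : star_var).
Definition sv : {mpoly kappa[#|star_var|]} := pvar kappa (inr false : star_var).

(* x_0 = u, and x_(l a + 1) = 1 makes the equation f_(l a) an instance of f_i. *)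
Definition sx (a : 'I_m) (i : nat) : {mpoly kappa[#|star_var|]} :=
  if i is i'.+1 then
    if insub i' is Some j then pvar kappa (svar (j : 'I_(l a)) true) else 1
  else su.
Definition sy (a : 'I_m) (i : nat) : {mpoly kappa[#|star_var|]} :=
  if insub i.-1 is Some j then pvar kappa (svar (j : 'I_(l a)) false) else 1.

Definition star_f (a : 'I_m) (i : nat) :=
  sx a i * sy a i - sx a i.-1 - to_residue eta (cray K l a i) *: sx a i.+1.
Definition star_g :=
  su * sv - to_residue eta (cgen K None) *: (\prod_a sx a 1) - 1.

Definition star_eqs : set {mpoly kappa[#|star_var|]} :=
  [set p | exists a i, (1 <= i <= l a)%N /\ p = star_f a i] `|` [set star_g].

(* The fiber at [eta] of the spectrum of the star cluster algebra with principal
   coefficients: the base change of its presentation to the residue field. *)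
Definition star_fiber : algebra kappa := affine star_eqs.

End StarFiber.

Section Comap.
Variables (R S : comPzRingType) (f : {rmorphism R -> S}) (J : ideal S).
Definition comap_set : set R := [set x | J (f x)].
Fact comap0 : comap_set 0. Proof. by rewrite /comap_set /= rmorph0; apply: ideal0. Qed.
Fact comapD a b : comap_set a -> comap_set b -> comap_set (a + b).
Proof. by rewrite /comap_set /= rmorphD; apply: idealD. Qed.
Fact comapM a b : comap_set b -> comap_set (a * b).
Proof. by rewrite /comap_set /= rmorphM; apply: idealM. Qed.
Definition comap : ideal R := Ideal comap0 comapD comapM.


Definition qmap (I : ideal R) & ideal_set I `<=` comap := fun x : quot I =>
  qclass J (f (projT1 (cid (qclassP x)))).

Variables (I : ideal R) (IJ : ideal_set I `<=` comap).

Lemma qmapE a : qmap IJ (qclass I a) = qclass J (f a).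
Proof.
rewrite /qmap; case: cid => b /= /qclass_eq Iab; apply/qclass_eq.
rewrite -rmorphB; have -> : b - a = -1 * (a - b) by ring.
by have := IJ (idealM (-1) Iab).
Qed.

Fact qmapB : zmod_morphism (qmap IJ).
Proof.
move=> x y; have [a ->] := qclassP x; have [b ->] := qclassP y.
by rewrite -rmorphB !qmapE !rmorphB.
Qed.
HB.instance Definition _ := GRing.isZmodMorphism.Build _ _ (qmap IJ) qmapB.
Fact qmap_monoid : monoid_morphism (qmap IJ).
Proof.
split=> [|x y]; first by rewrite -(rmorph1 (qclass I)) qmapE !rmorph1.
have [a ->] := qclassP x; have [b ->] := qclassP y.
by rewrite -rmorphM !qmapE !rmorphM.
Qed.
HB.instance Definition _ := GRing.isMonoidMorphism.Build _ _ (qmap IJ) qmap_monoid.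
End Comap.

Section AffineIso.
Variables (k : fieldType).

Definition subst (T T' : finType) (phi : T -> {mpoly k[#|T'|]}) :
    {mpoly k[#|T|]} -> {mpoly k[#|T'|]} :=
  comp_mpoly [tuple phi (enum_val i) | i < #|T|].
HB.instance Definition _ T T' phi := GRing.RMorphism.on (@subst T T' phi).

Lemma substX T T' phi t : @subst T T' phi (pvar k t) = phi t.
Proof. by rewrite /subst /pvar comp_mpolyXU -tnth_nth tnth_mktuple enum_rankK. Qed.
Lemma substC T T' phi c : @subst T T' phi c%:MP = c%:MP.
Proof. by rewrite /subst comp_mpolyC. Qed.

Lemma poly_morph_eq (T : finType) (S : comPzRingType) (f g : {rmorphism {mpoly k[#|T|]} -> S}) :
  (forall c, f c%:MP = g c%:MP) -> (forall t, f (pvar k t) = g (pvar k t)) -> f =1 g.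
Proof.
move=> fgC fgX p; rewrite (mpolyE p) !rmorph_sum; apply: eq_bigr => e _.
rewrite -mul_mpolyC !rmorphM fgC mpolyXE_id !rmorph_prod; congr (_ * _).
apply: eq_bigr => i _; rewrite !rmorphXn; congr (_ ^+ _).
by have := fgX (enum_val i); rewrite /pvar enum_valK.
Qed.

Lemma affine_iso (T T' : finType) (E : set {mpoly k[#|T|]}) (E' : set {mpoly k[#|T'|]})
    (phi : T -> {mpoly k[#|T'|]}) (psi : T' -> {mpoly k[#|T|]}) :
  (forall p, E p -> ideal_gen E' (subst phi p)) ->
  (forall p, E' p -> ideal_gen E (subst psi p)) ->
  (forall t, ideal_gen E (subst psi (phi t) - pvar k t)) ->
  (forall t, ideal_gen E' (subst phi (psi t) - pvar k t)) ->
  alg_iso (affine E) (affine E').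
Proof.
move=> EE' E'E psiK phiK.
have sub : ideal_set (ideal_gen E) `<=` comap (subst phi) (ideal_gen E').
  by move=> p; apply; apply: EE'.
have sub' : ideal_set (ideal_gen E') `<=` comap (subst psi) (ideal_gen E).
  by move=> p; apply; apply: E'E.
have psiphi p : qclass (ideal_gen E) (subst psi (subst phi p)) = qclass (ideal_gen E) p.
  apply: (@poly_morph_eq T _ (qclass (ideal_gen E) \o (subst psi \o subst phi)) (qclass (ideal_gen E))).
    by move=> c; rewrite /= !substC.
  by move=> t; rewrite /= substX; apply/qclass_eq.
have phipsi p : qclass (ideal_gen E') (subst phi (subst psi p)) = qclass (ideal_gen E') p.
  apply: (@poly_morph_eq T' _ (qclass (ideal_gen E') \o (subst phi \o subst psi)) (qclass (ideal_gen E'))).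
    by move=> c; rewrite /= !substC.
  by move=> t; rewrite /= substX; apply/qclass_eq.
exists (qmap sub : {rmorphism quot (ideal_gen E) -> quot (ideal_gen E')}).
split; last by move=> c; rewrite /= qmapE; congr (qclass _ _); exact: substC.
exists (qmap sub') => x; have [p ->] := qclassP x.
  by rewrite /= !qmapE; exact: psiphi.
by rewrite /= !qmapE; exact: phipsi.
Qed.
End AffineIso.

Module FiberEmbedding.

Fact step_eq (R : comPzRingType) (r2 y A g r3 B x0 x1 x2 : R) :
  r2 * (y * A) - g * (r3 * B) - x0 =
  y * (r2 * A - x1) - g * (r3 * B - x2) + (x1 * y - x0 - g * x2).
Proof. ring. Qed.

Fact G_eq (R : comPzRingType) (u v c g r Q X : R) : c * (g * r) = 1 ->
  u * (c * v) - Q - c = c * (u * v - g * X - 1 - g * (r * Q - X)).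
Proof.
move=> e; transitivity (u * (c * v) - c * (g * r) * Q - c); last by ring.
by rewrite e mul1r.
Qed.

Section Proof.
Variables (K : fieldType) (m : nat) (l : 'I_m -> nat) (eta : spec (Kc K l)).
Local Notation kappa := (residue_field eta).
Let r a i : kappa := to_residue eta (rho (cray K l a) (l a) i).
Let g0 : kappa := to_residue eta (cgen K None).

Lemma cgen_neq0 v : to_residue eta (cgen K v) != 0.
Proof.
have Sv : monomials K l (pvar K v) by exists U_(enum_rank v)%MM.
have e : cgen K v * mkfrac 1 (mkdenom Sv) = 1.
  by rewrite fracM; apply: frac_eqW; rewrite !dvalE; ring.
apply/eqP => e0; have /eqP := rmorphM (to_residue eta) (cgen K v) (mkfrac 1 (mkdenom Sv)).
by rewrite e /= e0 mul0r rmorph1 oner_eq0.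
Qed.

Lemma cray_neq0 a i : to_residue eta (cray K l a i) != 0.
Proof. by rewrite /cray; case: insubP => [j _ _|_]; rewrite ?cgen_neq0 // rmorph1 oner_eq0. Qed.

Lemma r_rec a i : (0 < i <= l a)%N -> r a i = to_residue eta (cray K l a i) * r a i.+2.
Proof.
case/andP=> i0 il; rewrite -rmorphM /r; congr (to_residue eta _); rewrite /rho.
have [->|ne] := eqVneq i (l a).
  have -> : ((l a).+1 - l a = 1)%N by lia.
  have -> : ((l a).+1 - (l a).+2 = 0)%N by lia.
  by rewrite /= mulr1.
have -> : ((l a).+1 - i = (l a - i.+1).+2)%N by lia.
have -> : ((l a).+1 - i.+2 = l a - i.+1)%N by lia.
by rewrite [LHS]/=; congr (cray K l a _ * _); lia.
Qed.

Lemma r_neq0 a i : (0 < i)%N -> r a i != 0.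
Proof.
have [n] := ubnP ((l a).+1 - i)%N; elim: n i => // n IHn i le i0.
have [il|li] := leqP i (l a); last first.
  have e : ((l a).+1 - i = 0)%N by lia.
  by rewrite /r /rho e rmorph1 oner_eq0.
by rewrite r_rec ?i0 // mulf_neq0 ?cray_neq0 //; apply: IHn => //; lia.
Qed.

Lemma r_last a i : (l a < i)%N -> r a i = 1.
Proof.
move=> li; have e : ((l a).+1 - i = 0)%N by lia.
by rewrite /r /rho e rmorph1.
Qed.

Definition phi (t : Xvar l) : {mpoly kappa[#|star_var l|]} :=
  match t with
  | inl (existT a i) =>
      if i == 0%N :> nat then sx eta a (l a)
      else let j := (l a - i).+1 in (r a j.+1 / r a j) *: sy eta a j
  | inr true => su eta
  | inr false => (g0 * \prod_a r a 2)^-1 *: sv eta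
  end.

Definition psi (t : star_var l) : {mpoly kappa[#|Xvar l|]} :=
  match t with
  | inl (existT a (j, true)) => r a j.+2 *: continuant (Xz eta a) (l a - j)
  | inl (existT a (j, false)) => (r a j.+1 / r a j.+2) *: Xz eta a (l a - j).+1
  | inr true => Xu eta
  | inr false => (g0 * \prod_a r a 2) *: Xw eta
  end.

Lemma substZ (T T' : finType) (f : T -> {mpoly kappa[#|T'|]}) c p :
  subst f (c *: p) = c *: @subst kappa T T' f p.
Proof. exact: linearZ. Qed.

Lemma substM (T T' : finType) (f : T -> {mpoly kappa[#|T'|]}) p q :
  subst f (p * q) = @subst kappa T T' f p * subst f q.
Proof. exact: rmorphM. Qed.
Lemma substB (T T' : finType) (f : T -> {mpoly kappa[#|T'|]}) p q :
  subst f (p - q) = @subst kappa T T' f p - subst f q.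
Proof. exact: rmorphB. Qed.
Lemma subst1 (T T' : finType) (f : T -> {mpoly kappa[#|T'|]}) :
  @subst kappa T T' f 1 = 1.
Proof. exact: rmorph1. Qed.
Lemma subst_prod (T T' : finType) (f : T -> {mpoly kappa[#|T'|]}) (F : 'I_m -> _) :
  @subst kappa T T' f (\prod_a F a) = \prod_a subst f (F a).
Proof. exact: rmorph_prod. Qed.

Lemma phi_z a k : (0 < k <= (l a).+1)%N -> subst phi (Xz eta a k) =
  if k == 1%N then sx eta a (l a)
  else let j := (l a - k.-1).+1 in (r a j.+1 / r a j) *: sy eta a j.
Proof.
case: k => // k /= lek; rewrite /Xz substX /= inordK //.
Qed.

Lemma phi_u : subst phi (Xu eta) = (su eta). Proof. by rewrite substX. Qed.
Lemma phi_w : subst phi (Xw eta) = (g0 * \prod_a r a 2)^-1 *: (sv eta).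
Proof. by rewrite substX. Qed.
Lemma psi_u : subst psi (su eta) = Xu eta. Proof. by rewrite substX. Qed.
Lemma psi_v : subst psi (sv eta) = (g0 * \prod_a r a 2) *: Xw eta.
Proof. by rewrite substX. Qed.

Lemma psi_x a i : (0 < i <= (l a).+1)%N ->
  subst psi (sx eta a i) = r a i.+1 *: continuant (Xz eta a) ((l a).+1 - i).
Proof.
case: i => // i /= lei; rewrite /sx; case: insubP => [j _ <-|].
  by rewrite substX /= subSS.
rewrite -leqNgt => le; have -> : i = l a by lia.
by rewrite rmorph1 subnn r_last // scale1r.
Qed.

Lemma psi_y a i : (0 < i <= l a)%N ->
  subst psi (sy eta a i) = (r a i / r a i.+1) *: Xz eta a ((l a).+1 - i).+1.
Proof.
case: i => // i /= lei; rewrite /sy /=; case: insubP => [j _ <-|].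
  by rewrite substX /= subSS.
by rewrite lei.
Qed.

Let P a := continuant (Xz eta a).
Let IX := ideal_gen (range (eqF eta) `|` [set eqG eta]).
Let IS := ideal_gen (@star_eqs K m l eta).

Lemma IX_gen p : (range (eqF eta) `|` [set eqG eta]) p -> IX p.
Proof. by move=> Ep J; apply. Qed.
Lemma IS_gen p : @star_eqs K m l eta p -> IS p.
Proof. by move=> Ep J; apply. Qed.

Lemma idealZ (T : finType) (J : ideal {mpoly kappa[#|T|]}) c p : J p -> J (c *: p).
Proof. by move=> Jp; rewrite -mul_mpolyC; apply: idealM. Qed.

Lemma idealB (R : comPzRingType) (J : ideal R) a b : J a -> J b -> J (a - b).
Proof. by move=> Ja Jb; rewrite -mulN1r; apply: idealD => //; apply: idealM. Qed.

Lemma PSS a n : P a n.+2 = Xz eta a n.+2 * P a n.+1 - P a n.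
Proof. by []. Qed.

(* x_i = rho_(i+1) P_(l+1-i) on the fiber. *)
Lemma phi_P a n : (n <= (l a).+1)%N ->
  IS (r a ((l a).+1 - n).+1 *: subst phi (P a n) - sx eta a ((l a).+1 - n)).
Proof.
suff H k : (k <= l a)%N ->
    IS (r a ((l a).+1 - k).+1 *: subst phi (P a k) - sx eta a ((l a).+1 - k)) /\
    IS (r a ((l a).+1 - k.+1).+1 *: subst phi (P a k.+1) - sx eta a ((l a).+1 - k.+1)).
  by case: n => [|n] le; [case: (H 0%N isT) | case: (H n le)].
elim: k => [|k IHk] lek.
  have sx1 : sx eta a (l a).+1 = 1 by rewrite /sx; case: insubP => // j; rewrite ltnn.
  rewrite subn0 sx1 r_last ?scale1r ?rmorph1 ?subrr //; split; first exact: ideal0.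
  rewrite subn1 /= r_last ?scale1r // phi_z //= subrr; exact: (ideal0 IS).
have [IH1 IH2] := IHk (ltnW lek); split=> //.
rewrite PSS substB substM phi_z // eqSS [_ == _]/= [k.+2.-1]/=.
move: IH1 IH2; set A := subst phi (P a k.+1); set B := subst phi (P a k).
have [j ej] : exists j, (l a - k = j.+1)%N by exists (l a - k.+1)%N; lia.
have -> : ((l a).+1 - k = j.+2)%N by lia.
have -> : ((l a).+1 - k.+1 = j.+1)%N by lia.
have -> : ((l a).+1 - k.+2 = j)%N by lia.
have -> : ((l a - k.+1).+1 = j.+1)%N by lia.
move=> IH1 IH2.
have jl : (0 < j.+1 <= l a)%N by lia.
have Jf : IS (star_f eta a j.+1) by apply: IS_gen; left; exists a, j.+1.
have -> : r a j.+1 *: ((r a j.+2 / r a j.+1) *: sy eta a j.+1 * A - B) - sx eta a j =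
    sy eta a j.+1 * (r a j.+2 *: A - sx eta a j.+1)
    - to_residue eta (cray K l a j.+1) *: (r a j.+3 *: B - sx eta a j.+2) + star_f eta a j.+1.
  rewrite scalerBr -scalerAl scalerA mulrCA mulfV ?r_neq0 // mulr1.
  rewrite [in r a j.+1 *: B]r_rec // -scalerA /star_f -!mul_mpolyC; exact: step_eq.
by apply: idealD Jf; apply: idealB; [apply: idealM | apply: idealZ].
Qed.

Lemma phi_F a : IS (subst phi (eqF eta a)).
Proof.
have := phi_P (leqnn (l a).+1); rewrite subnn => H.
rewrite /eqF substB substZ phi_u.
have -> : subst phi (continuant (Xz eta a) (l a).+1) - lambda eta a *: (su eta) =
   (r a 1)^-1 *: (r a 1 *: subst phi (P a (l a).+1) - (su eta)).
  by rewrite scalerBr scalerA mulVf ?r_neq0 // scale1r.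
exact: idealZ.
Qed.

Let cc : kappa := g0 * \prod_a r a 2.

Lemma cc_neq0 : cc != 0.
Proof.
rewrite mulf_neq0 ?cgen_neq0 //; apply/prodf_neq0 => a _; exact: r_neq0.
Qed.

Lemma muE : mu eta = cc^-1.
Proof. by rewrite /mu rmorph_prod /cc invfM. Qed.

Lemma psi_f a i : (0 < i <= l a)%N -> IX (subst psi (star_f eta a i)).
Proof.
case: i => // j jl.
have [n en] : exists n, (l a - j = n.+1)%N by exists (l a - j.+1)%N; lia.
rewrite /star_f !substB substZ substM psi_y // (@psi_x a j.+1) ?(@psi_x a j.+2); try lia.
have -> : ((l a).+1 - j.+1 = n.+1)%N by lia.
have -> : ((l a).+1 - j.+2 = n)%N by lia.
have -> : r a j.+2 *: continuant (Xz eta a) n.+1 * ((r a j.+1 / r a j.+2) *: Xz eta a n.+2)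
     - subst psi (sx eta a j.+1.-1)
     - to_residue eta (cray K l a j.+1) *: (r a j.+3 *: continuant (Xz eta a) n) =
   r a j.+1 *: P a n.+2 - subst psi (sx eta a j).
  rewrite scalerA -r_rec // PSS scalerBr -scalerAl -scalerAr scalerA.
  by rewrite mulrCA mulfV ?r_neq0 // mulr1 (mulrC (Xz _ _ _)) addrAC.
case: j jl en => [|j] jl en; last first.
  rewrite psi_x; last lia.
  have -> : ((l a).+1 - j.+1 = n.+2)%N by lia.
  by rewrite subrr; exact: (ideal0 IX).
rewrite psi_u; have -> : n.+2 = (l a).+1 by lia.
have -> : r a 1 *: P a (l a).+1 - Xu eta = r a 1 *: eqF eta a.
  by rewrite /eqF scalerBr scalerA mulfV ?r_neq0 // scale1r.
by apply: idealZ; apply: IX_gen; left; exists a.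
Qed.

Lemma psi_g : IX (subst psi (star_g eta)).
Proof.
rewrite /star_g !substB substM substZ subst1 psi_u psi_v subst_prod.
have -> : \prod_a subst psi (sx eta a 1) = (\prod_a r a 2) *: \prod_a P a (l a).
  rewrite -scaler_prod; apply: eq_bigr => a _.
  by rewrite psi_x ?subSS ?subn0.
have -> : Xu eta * (cc *: Xw eta) - g0 *: ((\prod_a r a 2) *: \prod_a P a (l a)) - 1 =
    cc *: eqG eta.
  rewrite /eqG !scalerBr -scalerAr scalerA; congr (_ - _ - _).
  by rewrite muE -mul_mpolyC -mpolyCM mulfV ?cc_neq0.
by apply: idealZ; apply: IX_gen; right.
Qed.

Lemma phi_G : IS (subst phi (eqG eta)).
Proof.
rewrite /eqG !substB substM substC phi_u phi_w subst_prod.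
have -> : (su eta) * (cc^-1 *: (sv eta)) - \prod_a subst phi (P a (l a)) - (mu eta)%:MP =
    cc^-1 *: (star_g eta - g0 *: (\prod_a (r a 2 *: subst phi (P a (l a))) - \prod_a sx eta a 1)).
  rewrite scaler_prod /star_g muE -!mul_mpolyC; apply: G_eq.
  by rewrite -!mpolyCM mulVf ?cc_neq0.
apply: idealZ; apply: idealB; first by apply: IS_gen; right.
apply: idealZ; apply/qclass_eq; rewrite !rmorph_prod; apply: eq_bigr => a _.
have := phi_P (leqnSn (l a)); rewrite subSn // subnn.
by move=> H; apply/qclass_eq.
Qed.

Theorem star_fiber_embedding : (forall a, (1 <= l a)%N) ->
  alg_iso (star_fiber eta) (fiber eta).
Proof.
move=> l_gt0.
apply: (affine_iso (phi := psi) (psi := phi)).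
- by move=> p [[a [i [il ->]]]|->]; [exact: psi_f | exact: psi_g].
- by move=> p [[a _ <-]|->]; [exact: phi_F | exact: phi_G].
- case=> [[a [j [|]]]|[|]].
  + have jl := ltn_ord j; rewrite [psi _]/= substZ.
    have le : (l a - j <= (l a).+1)%N by lia.
    have := phi_P le; have -> : ((l a).+1 - (l a - j) = j.+1)%N by lia.
    have -> // : sx eta a j.+1 = pvar kappa (svar j true).
    by rewrite /sx; case: insubP => [i _ /val_inj -> //|]; rewrite jl.
  + have jl := ltn_ord j; rewrite [psi _]/= substZ phi_z; last lia.
    have -> : ((l a - j).+1 == 1)%N = false by apply/eqP; lia.
    rewrite [X in _ *: X]/=; have -> : (l a - (l a - j) = j)%N by lia.
    rewrite scalerA; have -> : r a j.+1 / r a j.+2 * (r a j.+2 / r a j.+1) = 1.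
      by rewrite mulrA divfK ?r_neq0 // mulfV ?r_neq0.
    rewrite scale1r; have -> : sy eta a j.+1 = pvar kappa (svar j false).
      by rewrite /sy; case: insubP => [i _ /val_inj -> //|]; rewrite jl.
    by rewrite subrr; exact: (ideal0 IS).
  + by rewrite [psi _]/= phi_u subrr; exact: (ideal0 IS).
  + rewrite [psi _]/= substZ phi_w scalerA mulfV ?cc_neq0 // scale1r subrr.
    exact: (ideal0 IS).
case=> [[a i]|[|]].
- have il := ltn_ord i; rewrite [phi _]/=; case: eqP => i0.
    rewrite psi_x ?l_gt0 //; last by lia.
    rewrite subSn // subnn r_last // scale1r /= /Xz /=.
    have -> : inord 0 = i by apply/val_inj; rewrite /= inordK // i0.
    by rewrite subrr; exact: (ideal0 IX).
  rewrite substZ psi_y; last by lia.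
  have -> : ((l a).+1 - (l a - i).+1 = i)%N by lia.
  rewrite scalerA mulrA divfK ?r_neq0 // mulfV ?r_neq0 // scale1r /Xz /=.
  have -> : inord i = i by apply/val_inj; rewrite /= inordK.
  by rewrite subrr; exact: (ideal0 IX).
- by rewrite [phi _]/= psi_u subrr; exact: (ideal0 IX).
rewrite [phi _]/= substZ psi_v scalerA mulVf ?cc_neq0 // scale1r subrr.
exact: (ideal0 IX).
Qed.

End Proof.
End FiberEmbedding.

(* Main.v *)
(* Fix a point of X, with local ring S. If u is a unit, F_a = 0 can be solved for one coordinate
   of ray a unless all partial derivatives of P_(l_a + 1) vanish at the point; then l_a is odd, all
   the z^(a) vanish, and u takes the value +-1 / lambda_a. With at most one such critical ray the
   point is regular: the other rays are solved, w is eliminated by G and u by the remaining F_a.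
   With at least two, eliminating w leaves the equations P_(l_a + 1) / lambda_a - u_0 = u - u_0,
   and in suitable coordinates the left sides for the critical rays are the quadratic forms g_a,
   which gives a cylinder over compatible A_1 singularities. If u is not a unit, all P_(l_a) are
   units and each last z^(a) is eliminated, so X is the hypersurface G = 0; it is singular only
   where w and all the z^(a) vanish and all l_a are even, and there it is a quadric. This origin
   lies on X only if prod (-1)^(l_a / 2) = - mu, and since then no l_a is odd, it is the only
   singular point.
   The component of Sing(X) for a critical value u_0 is the union of the loci where two of its rays
   vanish. It is connected because any point of it can be moved, one ray at a time and along affine
   lines of the hypersurface P_(l_a + 1) = lambda_a u_0, to a fixed point where all its rays vanish.
   Regularity and singularity are read off a presentation: every prime p of a polynomial ring
   k[x_1, ..., x_n] carries a chain of primes 0 = c_0 < ... < c_N = p, each locally generated over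
   the previous one by one element, with n - N algebraically independent residues; hence every
   localization is regular, and a quotient by a nonzero ideal inside p^2 is not. *)

From HB Require Import structures.
Require Import Defs.
From mathcomp Require Import all_boot all_algebra.
From mathcomp Require Import boolp classical_sets.
From mathcomp Require Import mpoly ssrcomplements ring zify.

Set Implicit Arguments.
Unset Strict Implicit.
Unset Printing Implicit Defensive.

Import GRing.Theory.
Local Open Scope ring_scope.
Local Open Scope classical_set_scope.

(** All coordinate changes are exact and take place in the local rings themselves. Instead of a
    Morse lemma, the identity (-1)^q P_(2q) = 1 + sum_j (-1)^(j+1) z_(2j+2) P_(2j+1) already writes
    an even continuant as a constant plus q products; near z = 0 the z_(2j+2) and P_(2j+1) are new
    coordinates, because the P_(2j) are units there. No 2 is inverted, so every characteristic is
    covered. For G = 0 the product over the rays telescopes in the same way, each summand absorbing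
    the product of the earlier rays, which is a unit. Such changes are verified on points: a local
    ring is recognized by solving its equations in any ring with a local homomorphism to it
    ([chart]), so that denominators that are units in the target are units in the source. One
    cylinder has to serve a whole component, including points where only some of its rays are
    critical. A non-critical ray must then also be brought to the form g_a = u - u_0, away from the
    center of g_a; one invertible t is enough for this ([free_block]). *)

Lemma rmorphP (A B : comPzRingType) (f : A -> B) :
  zmod_morphism f -> monoid_morphism f -> exists h : {rmorphism A -> B}, h =1 f.
Proof.
move=> fB fM; pose fb := GRing.isZmodMorphism.Build A B f fB.
pose fm := GRing.isMonoidMorphism.Build A B f fM.
pose h : {rmorphism A -> B} := HB.pack f fb fm.
by exists h.
Qed.

(** * Local rings and localizations *)

Definition is_unit (R : comPzRingType) (a : R) := exists b, a * b = 1.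

Lemma is_unit1 (R : comPzRingType) : is_unit (1 : R).
Proof. by exists 1; rewrite mulr1. Qed.

Lemma is_unitM (R : comPzRingType) (a b : R) : is_unit a -> is_unit b -> is_unit (a * b).
Proof. by move=> [a' ea] [b' eb]; exists (a' * b'); rewrite mulrACA ea eb mulr1. Qed.

Lemma is_unit_mulP (R : comPzRingType) (a b : R) : is_unit (a * b) -> is_unit a /\ is_unit b.
Proof.
move=> [c e]; split; [exists (b * c)|exists (a * c)]; first by rewrite mulrA.
by rewrite mulrA (mulrC b).
Qed.

Lemma is_unitN (R : comPzRingType) (a : R) : is_unit a -> is_unit (- a).
Proof. by move=> [a' ea]; exists (- a'); rewrite mulrNN. Qed.

Lemma is_unit_prod (R : comPzRingType) (I : Type) (r : seq I) (P : pred I) (F : I -> R) :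
  (forall i, P i -> is_unit (F i)) -> is_unit (\prod_(i <- r | P i) F i).
Proof. by move=> Fu; elim/big_ind: _ => //; [exact: is_unit1|exact: is_unitM]. Qed.

Lemma is_unit_rmorph (R S : comPzRingType) (f : {rmorphism R -> S}) a : is_unit a -> is_unit (f a).
Proof. by move=> [b e]; exists (f b); rewrite -rmorphM e rmorph1. Qed.

Lemma unit_mulI (R : comPzRingType) (a : R) : is_unit a -> injective ( *%R a).
Proof.
move=> [b e] x y exy; have E z : b * (a * z) = z by rewrite mulrA (mulrC b) e mul1r.
by rewrite -[x]E exy E.
Qed.

Lemma field_unit (k : fieldType) (a : k) : a != 0 -> is_unit a.
Proof. by move=> a0; exists a^-1; rewrite mulfV. Qed.

(** Total, with the default 0 at non-units, so that solutions of equations can be written as terms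
    before the coefficient is known to be invertible. *)
Definition cinv (R : comPzRingType) (a : R) : R :=
  if pselect (is_unit a) is left u then projT1 (cid u) else 0.

Lemma cinvP (R : comPzRingType) (a : R) : is_unit a -> a * cinv a = 1.
Proof. by rewrite /cinv; case: pselect => // u _; case: cid. Qed.

Lemma cinv_eq (R : comPzRingType) (a b : R) : a * b = 1 -> cinv a = b.
Proof.
move=> e; have u : is_unit a by exists b.
by apply: (unit_mulI u); rewrite e cinvP.
Qed.

Lemma rmorph_cinv (R S : comPzRingType) (f : {rmorphism R -> S}) a :
  is_unit a -> f (cinv a) = cinv (f a).
Proof. by move=> u; apply/esym/cinv_eq; rewrite -rmorphM cinvP // rmorph1. Qed.

Definition is_local (R : comPzRingType) := ~ is_unit (0 : R) /\
  forall a b : R, ~ is_unit a -> ~ is_unit b -> ~ is_unit (a + b).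

Definition local_hom (R S : comPzRingType) (f : R -> S) := forall a, is_unit (f a) -> is_unit a.

Section NonunitPoint.
Variables (R : comPzRingType) (Rloc : is_local R).

Fact nonunit0 : ~ is_unit (0 : R). Proof. by case: Rloc. Qed.
Fact nonunitD (a b : R) : ~ is_unit a -> ~ is_unit b -> ~ is_unit (a + b).
Proof. by case: Rloc => _; apply. Qed.
Fact nonunitM (a b : R) : ~ is_unit b -> ~ is_unit (a * b).
Proof. by move=> ub /is_unit_mulP[]. Qed.
Definition nonunits : ideal R :=
  @Ideal R (fun a => ~ is_unit a) nonunit0 nonunitD nonunitM.
Fact nonunits1 : ~ nonunits 1. Proof. by apply; exact: is_unit1. Qed.
Fact nonunits_prime a b : nonunits (a * b) -> nonunits a \/ nonunits b.
Proof.
move=> uab; apply: contrapT => /not_orP[/contrapT ua /contrapT ub].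
by apply: uab; exact: is_unitM.
Qed.
Definition closed_point : spec R := Point nonunits1 nonunits_prime.

End NonunitPoint.

Section PointComap.
Variables (A R : comPzRingType) (f : {rmorphism A -> R}) (q : spec R).
Fact pcomap1 : ~ comap f q 1.
Proof. by rewrite /= /comap_set /= rmorph1; exact: point1. Qed.
Fact pcomapM a b : comap f q (a * b) -> comap f q a \/ comap f q b.
Proof. by rewrite /= /comap_set /= rmorphM; exact: pointM. Qed.
Definition pcomap : spec A := Point pcomap1 pcomapM.
Lemma pcomapE a : pcomap a = q (f a). Proof. by []. Qed.
End PointComap.

Lemma spec_eq (R : comPzRingType) (x y : spec R) : (forall a, x a <-> y a) -> x = y.
Proof.
case: x y => [[I I0 ID IM] I1 IP] [[J J0 JD JM] J1 JP] /= e.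
have {}e : I = J by apply/funext => a; apply/propext/e.
by subst J; rewrite (Prop_irrelevance I0 J0) (Prop_irrelevance ID JD) (Prop_irrelevance IM JM) in I1 IP J1 JP *;
  rewrite (Prop_irrelevance I1 J1) (Prop_irrelevance IP JP).
Qed.

Section LocalRings.
Variables (A : comPzRingType) (x : spec A).

Lemma max_setE (r : loc_at x) : max_ideal x r <-> ~ is_unit r.
Proof.
have [a [s ->]] := fracP r; split.
  move=> /max_setP xa [r']; have [b [t ->]] := fracP r'.
  rewrite fracM => /frac_eq[w xw]; rewrite !dvalE mulr1 mul1r => e.
  have : x (w * (dval s * dval t)) by rewrite -e; apply: idealM; rewrite mulrC; apply: idealM.
  by case/pointM => [//|/pointM[xs|xt]]; [case: (denomP s xs)|case: (denomP t xt)].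
move=> nu; have [xa|xa] := pselect (x a); first by exists a => //; exists s.
case: nu; exists (mkfrac (dval s) (@mkdenom _ (point_compl x) a xa)).
by rewrite fracM; apply: frac_eqW; rewrite !dvalE; ring.
Qed.

End LocalRings.

(** [pi] exhibits [R] as the localization of [A / J] at [p]. This is a characterization, not a
    construction, so that one local ring can carry several presentations. *)
Record isloc (A R : comPzRingType) (p : spec A) (J : ideal A) (pi : {rmorphism A -> R}) : Prop :=
  IsLoc {
  isloc_unit : forall s, ~ p s -> is_unit (pi s);
  isloc_frac : forall r, exists a s, ~ p s /\ pi s * r = pi a;
  isloc_ker : forall a, pi a = 0 <-> exists2 s, ~ p s & J (s * a);
  isloc_sub : forall a, J a -> p a }.

Section IsLocTheory.
Variables (A R : comPzRingType) (p : spec A) (J : ideal A) (pi : {rmorphism A -> R}).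
Hypothesis piP : isloc p J pi.

Lemma isloc_unitE a : is_unit (pi a) <-> ~ p a.
Proof.
split; last exact: (isloc_unit piP).
move=> [r er] pa; have [b [t [pt e]]] := isloc_frac piP r.
have /(isloc_ker piP)[s ps Js] : pi (a * b - t) = 0.
  by rewrite rmorphB rmorphM -e mulrCA er mulr1 subrr.
have /pointM[//|pabt] := isloc_sub piP Js.
case: pt; have -> : t = b * a + (-1) * (a * b - t) by ring.
by apply: idealD; apply: idealM.
Qed.

Lemma isloc_local : is_local R.
Proof.
have nuE r : ~ is_unit r <-> exists a s, [/\ p a, ~ p s & pi s * r = pi a].
  split=> [nu|[a [s [pa ps e]]] ur]; last first.
    by have /isloc_unitE : is_unit (pi a) by rewrite -e; apply: is_unitM => //; exact: (isloc_unit piP).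
  have [a [s [ps e]]] := isloc_frac piP r; exists a, s; split=> //.
  apply: contra_notP nu => pa; have : is_unit (pi s * r) by rewrite e; exact: (isloc_unit piP).
  by case/is_unit_mulP.
split.
  by apply/nuE; exists 0, 1; split; [exact: ideal0|exact: point1|rewrite mulr0 rmorph0].
move=> a b /nuE[c [s [pc ps e]]] /nuE[d [t [pd pt e']]]; apply/nuE.
exists (t * c + s * d), (s * t); split; first by apply: idealD; apply: idealM.
  by case/pointM.
by rewrite rmorphD !rmorphM -e -e'; ring.
Qed.

Lemma isloc_lift (R' : comPzRingType) (g : {rmorphism A -> R'}) :
  (forall a, J a -> g a = 0) -> (forall s, ~ p s -> is_unit (g s)) ->
  exists h : {rmorphism R -> R'}, forall a, h (pi a) = g a.
Proof.
move=> gJ gu.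
(* The value at [r] is characterized by all fractions representing [r] at once; additivity and
   multiplicativity then hold for any choice of them. *)
have ex r : exists r', forall a s, ~ p s -> pi s * r = pi a -> g s * r' = g a.
  have [a [s [ps e]]] := isloc_frac piP r; exists (g a * cinv (g s)) => b t pt e'.
  have /(isloc_ker piP)[w pw Jw] : pi (b * s - t * a) = 0.
    by rewrite rmorphB !rmorphM -e -e'; ring.
  have := gJ _ Jw; rewrite rmorphM => e0.
  have {e0} e0 : g (b * s - t * a) = 0 by apply: (unit_mulI (gu _ pw)); rewrite e0 mulr0.
  apply: (unit_mulI (gu _ ps)); rewrite [LHS](_ : _ = (g s * cinv (g s)) * (g t * g a)); last by ring.
  rewrite (cinvP (gu _ ps)) mul1r (mulrC (g s)) -!rmorphM; apply/esym/eqP.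
  by rewrite -subr_eq0 -rmorphB e0.
pose h r := projT1 (cid (ex r)).
have hP r a s : ~ p s -> pi s * r = pi a -> g s * h r = g a.
  by rewrite /h; case: cid => r' /= H ps e; exact: H.
have psM s t : ~ p s -> ~ p t -> ~ p (s * t) by move=> ps pt /pointM[].
have hpi a : h (pi a) = g a.
  by rewrite -(@hP (pi a) a 1) ?rmorph1 ?mul1r //; exact: point1.
have hB : zmod_morphism h.
  move=> r r'; have [a [s [ps e]]] := isloc_frac piP r.
  have [a' [s' [ps' e']]] := isloc_frac piP r'.
  have pss := psM _ _ ps ps'; apply: (unit_mulI (gu _ pss)).
  rewrite (@hP _ (s' * a - s * a')) //; last by rewrite !(rmorphB, rmorphM) -e -e'; ring.
  rewrite !(rmorphB, rmorphM) -(hP _ _ _ ps e) -(hP _ _ _ ps' e'); ring.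
have hM : monoid_morphism h.
  split=> [|r r']; first by rewrite -(rmorph1 pi) hpi rmorph1.
  have [a [s [ps e]]] := isloc_frac piP r.
  have [a' [s' [ps' e']]] := isloc_frac piP r'.
  have pss := psM _ _ ps ps'; apply: (unit_mulI (gu _ pss)).
  rewrite (@hP _ (a * a')) //; last by rewrite !rmorphM -e -e'; ring.
  rewrite !rmorphM -(hP _ _ _ ps e) -(hP _ _ _ ps' e'); ring.
by have [f fh] := rmorphP hB hM; exists f => a; rewrite fh hpi.
Qed.

Lemma isloc_eq (R' : comPzRingType) (f g : {rmorphism R -> R'}) :
  (forall a, f (pi a) = g (pi a)) -> f =1 g.
Proof.
move=> fg r; have [a [s [ps e]]] := isloc_frac piP r.
have us : is_unit (f (pi s)) by apply: is_unit_rmorph; exact: (isloc_unit piP).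
by apply: (unit_mulI us); rewrite -rmorphM e !fg -e rmorphM.
Qed.

End IsLocTheory.

Lemma isloc_iso (A R R' : comPzRingType) (p : spec A) (J : ideal A)
    (pi : {rmorphism A -> R}) (pi' : {rmorphism A -> R'}) :
  isloc p J pi -> isloc p J pi' ->
  exists h : {rmorphism R -> R'}, bijective h /\ forall a, h (pi a) = pi' a.
Proof.
move=> P P'.
have z a : J a -> pi a = 0.
  by move=> Ja; apply/(isloc_ker P); exists 1; rewrite ?mul1r //; exact: point1.
have z' a : J a -> pi' a = 0.
  by move=> Ja; apply/(isloc_ker P'); exists 1; rewrite ?mul1r //; exact: point1.
have [h hP] := isloc_lift P z' (isloc_unit P').
have [h' hP'] := isloc_lift P' z (isloc_unit P).
exists h; split=> //; exists h' => r.
  by apply: (isloc_eq P (f := h' \o h : {rmorphism R -> R}) (g := idfun)) => a /=; rewrite hP hP'.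
by apply: (isloc_eq P' (f := h \o h' : {rmorphism R' -> R'}) (g := idfun)) => a /=; rewrite hP' hP.
Qed.

Lemma isloc_quot (A : comPzRingType) (J : ideal A) (x : spec (quot J)) :
  isloc (pcomap (qclass J) x) J (to_loc (point_compl x) \o qclass J).
Proof.
have us (s : quot J) : ~ x s -> is_unit (to_loc (point_compl x) s).
  move=> xs; exists (mkfrac 1 (@mkdenom _ (point_compl x) s xs)).
  by rewrite /to_loc fracM; apply: frac_eqW; rewrite !dvalE; ring.
split=> [s|r|a|a Ja]; first exact: us.
- have [a' [s' ->]] := fracP r; have [a ea] := qclassP a'; have [s es] := qclassP (dval s').
  exists a, s; split; first by move=> xs; apply: (denomP s'); rewrite es.
  by rewrite /= -[qclass J s]es -ea /to_loc fracM; apply: frac_eqW; rewrite !dvalE; ring.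
- split=> [|[s xs Js]].
    rewrite /= /to_loc -[0]/(mkfrac 0 (den1 _)) => /frac_eq[r' xr].
    rewrite !dvalE !mulr1 mulr0; have [r er] := qclassP r'.
    rewrite er in xr *; rewrite -rmorphM -(rmorph0 (qclass J)) => /qclass_eq; rewrite subr0.
    by exists r.
  have e : qclass J (s * a) = 0 by rewrite -(rmorph0 (qclass J)); apply/qclass_eq; rewrite subr0.
  apply: (unit_mulI (us _ xs)); rewrite mulr0 -[RHS](rmorph0 (to_loc (point_compl x))) -e.
  by rewrite /= !rmorphM.
have e : qclass J a = 0 by rewrite -(rmorph0 (qclass J)); apply/qclass_eq; rewrite subr0.
by rewrite pcomapE /= e; exact: ideal0.
Qed.

(** * Local charts of affine varieties *)

Section Eval.
Variables (k : fieldType) (S : algebra k) (n : nat) (h : 'I_n -> S).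

Definition mnm_eval (m : 'X_{1..n}) : S := \prod_(i < n) h i ^+ m i.
Definition mpoly_eval (p : {mpoly k[n]}) : S :=
  \sum_(m <- msupp p) alg_in S p@_m * mnm_eval m.

(** Summing over all monomials of bounded degree gives [p], [q] and [p - q] a common index set. *)
Lemma mpoly_evalE p i : (msize p <= i)%N ->
  mpoly_eval p = \sum_(m : 'X_{1..n < i}) alg_in S p@_m * mnm_eval m.
Proof.
move=> le_pi; set I : subFinType _ := 'X_{1..n < i}.
rewrite /mpoly_eval (big_mksub I) ?msupp_uniq //=; first last.
  by move=> x /msize_mdeg_lt /leq_trans; apply.
by rewrite big_rmcond //= => j /memN_msupp_eq0 ->; rewrite rmorph0 mul0r.
Qed.

Fact mpoly_eval_zmod : zmod_morphism mpoly_eval.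
Proof.
move=> p q; pose i := maxn (maxn (msize p) (msize q)) (msize (p - q)).
have [ip iq ipq] : [/\ msize p <= i, msize q <= i & msize (p - q) <= i]%N.
  by rewrite /i; split; rewrite !leq_max leqnn ?orbT.
rewrite !(@mpoly_evalE _ i) // -sumrB; apply: eq_bigr => m _.
by rewrite mcoeffB rmorphB mulrBl.
Qed.
HB.instance Definition _ :=
  GRing.isZmodMorphism.Build {mpoly k[n]} S mpoly_eval mpoly_eval_zmod.

Lemma mnm_evalD m1 m2 : mnm_eval (m1 + m2)%MM = mnm_eval m1 * mnm_eval m2.
Proof. by rewrite -big_split; apply: eq_bigr => i _; rewrite mnmDE exprD. Qed.

Lemma mpoly_evalX m : mpoly_eval 'X_[m] = mnm_eval m.
Proof. by rewrite /mpoly_eval msuppX big_seq1 mcoeffX eqxx rmorph1 mul1r. Qed.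

Lemma mpoly_evalZ c p : mpoly_eval (c *: p) = alg_in S c * mpoly_eval p.
Proof.
pose i := maxn (msize p) (msize (c *: p)).
rewrite !(@mpoly_evalE _ i) ?leq_max ?leqnn ?orbT // mulr_sumr.
by apply: eq_bigr => m _; rewrite mcoeffZ rmorphM mulrA.
Qed.

Lemma mpoly_evalC c : mpoly_eval c%:MP = alg_in S c.
Proof.
rewrite -[c%:MP]mulr1 mul_mpolyC mpoly_evalZ -mpolyX0 mpoly_evalX /mnm_eval big1 ?mulr1 // => i _.
by rewrite mnm0E expr0.
Qed.

Fact mpoly_eval_monoid : monoid_morphism mpoly_eval.
Proof.
split=> [|p q]; first by rewrite -(mpolyC1 n k) mpoly_evalC rmorph1.
have sumE r : mpoly_eval r = \sum_(m <- msupp r) mpoly_eval (r@_m *: 'X_[m]).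
  by rewrite {1}(mpolyE r) raddf_sum.
rewrite (sumE p) (sumE q) {1}(mpolyE p) {1}(mpolyE q) mulr_suml raddf_sum mulr_suml.
apply: eq_bigr => m _; rewrite !mulr_sumr raddf_sum; apply: eq_bigr => m' _.
rewrite -!mul_mpolyC mulrACA -mpolyXD -mpolyCM !mul_mpolyC /= !mpoly_evalZ.
by rewrite !mpoly_evalX mnm_evalD rmorphM mulrACA.
Qed.
HB.instance Definition _ :=
  GRing.isMonoidMorphism.Build {mpoly k[n]} S mpoly_eval mpoly_eval_monoid.

Lemma mpoly_evalXi i : mpoly_eval 'X_i = h i.
Proof.
rewrite mpoly_evalX /mnm_eval (bigD1 i) //= big1 ?mulr1 ?mnm1E ?eqxx ?expr1 // => j ji.
by rewrite mnm1E eq_sym (negPf ji) expr0.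
Qed.

End Eval.

Definition ev (k : fieldType) (S : algebra k) (T : finType) (v : T -> S) :
  {mpoly k[#|T|]} -> S := mpoly_eval (fun i => v (enum_val i)).
Arguments ev {k} S {T} v.
HB.instance Definition _ (k : fieldType) (S : algebra k) (T : finType) (v : T -> S) :=
  GRing.RMorphism.on (ev S v).

Definition alg_hom (k : fieldType) (A B : algebra k) (h : A -> B) :=
  forall c, h (alg_in A c) = alg_in B c.

Section EvTheory.
Variables (k : fieldType) (T : finType).

Lemma ev_pvar (S : algebra k) (v : T -> S) t : ev S v (pvar k t) = v t.
Proof. by rewrite /ev /pvar mpoly_evalXi enum_rankK. Qed.

Lemma evC (S : algebra k) (v : T -> S) c : ev S v c%:MP = alg_in S c.
Proof. exact: mpoly_evalC. Qed.

Lemma evZ (S : algebra k) (v : T -> S) c p : ev S v (c *: p) = alg_in S c * ev S v p.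
Proof. by rewrite -mul_mpolyC rmorphM /= evC. Qed.

Lemma ev_eq (S : algebra k) (v w : T -> S) : v =1 w -> ev S v =1 ev S w.
Proof.
by move=> vw; apply: (poly_morph_eq (f := ev S v) (g := ev S w)) => [c|t] /=; rewrite ?evC // !ev_pvar vw.
Qed.

Lemma ev_unique (S : algebra k) (v : T -> S) (f : {rmorphism {mpoly k[#|T|]} -> S}) :
  (forall c, f c%:MP = alg_in S c) -> (forall t, f (pvar k t) = v t) -> f =1 ev S v.
Proof.
by move=> fC fX; apply: (poly_morph_eq (g := ev S v)) => [c|t] /=; rewrite ?fC ?fX ?evC ?ev_pvar.
Qed.

Lemma rmorph_ev (S S' : algebra k) (v : T -> S) (f : {rmorphism S -> S'}) :
  alg_hom f -> forall p, f (ev S v p) = ev S' (f \o v) p.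
Proof.
move=> fk; apply: (@ev_unique _ _ (f \o ev S v : {rmorphism _ -> _})) => [c|t] /=.
  by rewrite evC fk.
by rewrite ev_pvar.
Qed.

End EvTheory.

Lemma ideal_gen_ker (A R : comPzRingType) (f : {rmorphism A -> R}) (E : set A) :
  (forall p, E p -> f p = 0) -> forall p, ideal_gen E p -> f p = 0.
Proof.
move=> fE p.
pose Z := @Ideal R (fun a => a = 0) erefl (fun a b ea eb => etrans (f_equal2 +%R ea eb) (addr0 0))
  (fun a b eb => etrans (f_equal ( *%R a) eb) (mulr0 a)).
by move/(_ (comap f Z)); apply=> q Eq; exact: fE.
Qed.

Lemma quot_lift (A R : comPzRingType) (J : ideal A) (g : {rmorphism A -> R}) :
  (forall a, J a -> g a = 0) -> exists h : {rmorphism quot J -> R}, forall a, h (qclass J a) = g a.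
Proof.
move=> gJ; pose h (x : quot J) := g (projT1 (cid (qclassP x))).
have hE a : h (qclass J a) = g a.
  rewrite /h; case: cid => b /= /qclass_eq Jab; apply/esym/eqP.
  by rewrite -subr_eq0 -rmorphB gJ.
have hB : zmod_morphism h.
  move=> x y; have [a ->] := qclassP x; have [b ->] := qclassP y.
  by rewrite -rmorphB !hE rmorphB.
have hM : monoid_morphism h.
  split=> [|x y]; first by rewrite -(rmorph1 (qclass J)) hE rmorph1.
  have [a ->] := qclassP x; have [b ->] := qclassP y.
  by rewrite -rmorphM !hE rmorphM.
by have [f fh] := rmorphP hB hM; exists f => a; rewrite fh hE.
Qed.

Section Chart.
Variables (k : fieldType) (S : algebra k).

(** Every presented local ring is a stalk: [y] is the image of the closed point of [S] under the map
    that [v] induces on spectra. *)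
Lemma isloc_point (T : finType) (v : T -> S) (E : set {mpoly k[#|T|]}) p :
  isloc p (ideal_gen E) (ev S v) ->
  exists y : spec (affine E), (forall a, y (qclass (ideal_gen E) a) <-> p a) /\
    alg_iso S (stalk y).
Proof.
move=> P; have Sloc := isloc_local P.
have J0 a : ideal_gen E a -> ev S v a = 0.
  by move=> Ja; apply/(isloc_ker P); exists 1; rewrite ?mul1r //; exact: point1.
have [g gE] := quot_lift J0.
pose y : spec (affine E) := pcomap g (closed_point Sloc).
have yE a : y (qclass (ideal_gen E) a) <-> p a.
  rewrite pcomapE /= gE; split=> [nu|pa /(isloc_unitE P)//].
  by apply: contrapT => npa; apply/nu/(isloc_unit P).
exists y; split=> //.
have ep : pcomap (qclass (ideal_gen E)) y = p by apply: spec_eq => a; exact: yE.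
have := isloc_quot y; rewrite ep => P'; have [h [hb hE]] := isloc_iso P P'.
by exists h; split=> // c; by have := hE c%:MP; rewrite /= evC.
Qed.

(** Change of presentation. Elements [v'] of [S] that satisfy E' present [S] as a local ring of
    V(E') if every solution [tau] of E' lying over [v'] along a local homomorphism comes from a
    solution [zeta] of E lying over [v], and [tau] can be read off from [zeta] by the formulas that
    define [v'] from [v]. *)
Lemma chart (T : finType) (v : T -> S) (E : set {mpoly k[#|T|]}) p
    (P : isloc p (ideal_gen E) (ev S v)) (T' : finType) (E' : set {mpoly k[#|T'|]})
    (v' : T' -> S) :
  (forall q, E' q -> ev S v' q = 0) ->
  (forall (R : algebra k) (h : {rmorphism R -> S}) (tau : T' -> R),
     alg_hom h -> local_hom h -> (forall q, E' q -> ev R tau q = 0) ->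
     (forall t, h (tau t) = v' t) ->
     exists zeta : T -> R, [/\ forall q, E q -> ev R zeta q = 0,
       forall t, h (zeta t) = v t &
       forall f : {rmorphism S -> R}, alg_hom f -> (forall t, f (v t) = zeta t) ->
         forall t, f (v' t) = tau t]) ->
  isloc (pcomap (ev S v') (closed_point (isloc_local P))) (ideal_gen E') (ev S v').
Proof.
move=> E'0 H; set Sloc := isloc_local P; set p' := pcomap _ _.
have J0 : forall a, ideal_gen E' a -> ev S v' a = 0 := ideal_gen_ker E'0.
have [g gE] := quot_lift J0.
pose y : spec (affine E') := pcomap g (closed_point Sloc).
have ep : pcomap (qclass (ideal_gen E')) y = p'.
  by apply: spec_eq => a; rewrite !pcomapE /= gE.
have := isloc_quot y; rewrite ep.
set pi : {rmorphism {mpoly k[#|T'|]} -> loc_at y} := (_ \o _) => P'.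
have p'E a : ~ p' a -> is_unit (ev S v' a) by move/contrapT.
have [h hE0] := isloc_lift P' J0 p'E.
have hE a : h (pi a) = ev S v' a := hE0 a.
pose R := stalk y; pose tau t : R := pi (pvar k t).
have tauE : pi =1 ev R tau by apply: (@ev_unique _ _ R).
have hk : @alg_hom k R S h by move=> c; rewrite -(evC tau) -tauE hE evC.
have hl : local_hom h.
  move=> r; have [a [s [ps e]]] := isloc_frac P' r => ur.
  suff : is_unit (pi s * r) by case/is_unit_mulP.
  rewrite e; apply: (isloc_unit P') => /=; apply.
  by rewrite -hE -e rmorphM hE; apply: is_unitM => //; exact: p'E.
have E'R q : E' q -> ev R tau q = 0.
  move=> Eq; rewrite -tauE /= (_ : qclass _ q = 0) ?rmorph0 //.
  by rewrite -(rmorph0 (qclass (ideal_gen E'))); apply/qclass_eq; rewrite subr0 => I; apply.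
have htau t : h (tau t) = v' t by rewrite hE ev_pvar.
have [zeta [zE hz Hf]] := H R h tau hk hl E'R htau.
have zJ := ideal_gen_ker zE.
have zu s : ~ p s -> is_unit (ev R zeta s).
  move=> ps; apply: hl; rewrite (rmorph_ev _ hk) (@ev_eq _ _ S _ v) //.
  exact: (isloc_unit P).
have [f fE0] := isloc_lift P zJ zu.
have fE a : f (ev S v a) = ev R zeta a := fE0 a.
have fk : @alg_hom k S R f by move=> c; rewrite -(evC v) fE evC.
have fv t : f (v t) = zeta t by rewrite -(ev_pvar (S := S) v) fE ev_pvar.
have fv' a : f (ev S v' a) = pi a.
  by rewrite (rmorph_ev _ fk) tauE; apply: ev_eq => t /=; exact: Hf.
have hf r : h (f r) = r.
  apply: (isloc_eq P (f := h \o f : {rmorphism S -> S}) (g := idfun)) => a /=.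
  by rewrite fE (rmorph_ev _ hk); exact: ev_eq.
split=> // [r|a|a Ja].
- have [a [s [ps e]]] := isloc_frac P' (f r); exists a, s; split=> //.
  by rewrite /= -[r in LHS]hf -!hE -rmorphM e.
- by rewrite -(isloc_ker P' a); split=> e;
    [rewrite -fv' (e : ev S v' a = 0) rmorph0|rewrite /= -hE e rmorph0].
by rewrite /= /comap_set /= (J0 _ Ja); exact: nonunit0.
Qed.

End Chart.

Lemma isloc_ext (A R : comPzRingType) (p : spec A) (J : ideal A) (f g : {rmorphism A -> R}) :
  isloc p J f -> f =1 g -> isloc p J g.
Proof.
case=> P1 P2 P3 P4 fg; split=> // [s /P1|r|a]; rewrite -?fg //.
by have [a [s [ps e]]] := P2 r; exists a, s; rewrite -!fg.
Qed.

Lemma stalk_isloc (k : fieldType) (T : finType) (E : set {mpoly k[#|T|]}) (x : spec (affine E)) :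
  isloc (pcomap (qclass (ideal_gen E)) x) (ideal_gen E)
    (ev (stalk x) (fun t => to_loc (point_compl x) (affine_coord E t))).
Proof.
have := isloc_quot x; set pi : {rmorphism _ -> _} := (_ \o _).
set v := (X in ev _ X).
have e : pi =1 ev (stalk x) v by apply: (@ev_unique _ _ (stalk x)).
by move/isloc_ext; apply.
Qed.

Section RegularLocal.

Definition regular_local (R : comPzRingType) := exists d, krull_dim R d /\
  exists e : 'I_d -> R, forall r, ~ is_unit r <-> exists c : 'I_d -> R, r = \sum_i c i * e i.

Lemma ideal_gen_range (R : comPzRingType) (d : nat) (e : 'I_d -> R) r :
  ideal_gen (range e) r <-> exists c : 'I_d -> R, r = \sum_i c i * e i.
Proof.
split; last first.
  move=> [c ->] J eJ; elim/big_ind: _ => [|a b|i _]; [exact: ideal0|exact: idealD|].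
  by apply: idealM; apply: eJ; exists i.
pose L := fun r : R => exists c : 'I_d -> R, r = \sum_i c i * e i.
have L0 : L 0 by exists (fun=> 0); rewrite big1 // => i _; rewrite mul0r.
have LD a b : L a -> L b -> L (a + b).
  move=> [c ->] [c' ->]; exists (fun i => c i + c' i); rewrite -big_split.
  by apply: eq_bigr => i _; rewrite mulrDl.
have LM a b : L b -> L (a * b).
  move=> [c ->]; exists (fun i => a * c i); rewrite mulr_sumr.
  by apply: eq_bigr => i _; rewrite mulrA.
move/(_ (Ideal L0 LD LM)); apply=> _ [i _ <-].
exists (fun j => (j == i)%:R); rewrite (bigD1 i) //= eqxx mul1r big1 ?addr0 // => j /negPf->.
by rewrite mul0r.
Qed.

Lemma regular_atE (R : comPzRingType) (x : spec R) : regular_at x <-> regular_local (loc_at x).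
Proof.
split=> -[d [kd [e eE]]]; exists d; split=> //; exists e.
  by move=> r; rewrite -ideal_gen_range -eE -max_setE.
apply/funext => r; apply/propext; rewrite ideal_gen_range -eE; exact: max_setE.
Qed.

End RegularLocal.

(** * Regularity criteria *)

Section AlgIndep.
Variables (k : fieldType) (D : nat).

Fixpoint coefs (M : nat) : vectType k :=
  if M is M'.+1 then {ffun 'I_D -> coefs M'} : vectType k else k^o : vectType k.

Lemma dim_coefs M : dim (coefs M) = (D ^ M)%N.
Proof.
elim: M => [|M IHM] //=; rewrite expnS -IHM.
by rewrite -[dim _]/(#|'I_D| * dim (coefs M))%N card_ord.
Qed.

Variables (A : comPzRingType) (iota : {rmorphism k -> A}).

(* Elements of [coefs M] are the polynomials of degree < D in each of M variables. *)
Fixpoint comb (g : nat -> A) (M : nat) : coefs M -> A :=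
  match M with
  | 0 => fun c : k^o => iota c
  | M'.+1 => fun c : {ffun 'I_D -> coefs M'} => \sum_(i < D) g M' ^+ i * comb g (c i)
  end.

Lemma combB g M : {morph @comb g M : c d / c - d}.
Proof.
elim: M => [|M IHM] c d /=; first exact: rmorphB.
by rewrite -sumrB; apply: eq_bigr => i _; rewrite !ffunE IHM mulrBr.
Qed.

Lemma combZ g M a c : @comb g M (a *: c) = iota a * comb g c.
Proof.
elim: M c => [|M IHM] c /=; first by rewrite -rmorphM.
by rewrite mulr_sumr; apply: eq_bigr => i _; rewrite !ffunE IHM mulrCA.
Qed.

Lemma comb0 g M : @comb g M 0 = 0.
Proof. by rewrite -[0 in LHS](scale0r (0 : coefs M)) combZ rmorph0 mul0r. Qed.

Lemma eq_comb g h M : (forall i, (i < M)%N -> g i = h i) -> @comb g M =1 @comb h M.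
Proof.
elim: M => [|M IHM] gh c //=; apply: eq_bigr => i _.
by rewrite gh // IHM // => j jM; apply: gh; lia.
Qed.

End AlgIndep.
Arguments comb {k D A} iota g M.

Lemma rmorph_comb (k : fieldType) D (A B : comPzRingType) (f : {rmorphism A -> B})
    (iota : {rmorphism k -> A}) g M (c : coefs k D M) :
  f (comb iota g M c) = comb (f \o iota) (f \o g) M c.
Proof.
elim: M c => [|M IHM] c //=; rewrite rmorph_sum; apply: eq_bigr => i _.
by rewrite rmorphM rmorphXn IHM.
Qed.

Section Indep.
Variables (k : fieldType) (A : comPzRingType) (iota : {rmorphism k -> A}).

(** Independence of the residues modulo [q], stated inside [A]: for a prime [q] it witnesses
    transcendence degree at least [M] of the residue field. *)
Definition alg_indep (q : A -> Prop) (M : nat) (g : nat -> A) :=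
  forall D (c : coefs k D M), q (comb iota g M c) -> c = 0.

Lemma alg_indepW (q q' : A -> Prop) M g :
  (forall a, q' a -> q a) -> alg_indep q M g -> alg_indep q' M g.
Proof. by move=> qq' H D c /qq' /H. Qed.

(** A strict step down in a chain of primes raises the transcendence degree: append some [f] in [q']
    outside [q]. In a relation modulo [q], cancel the lowest power of [f] and reduce modulo [q'];
    only the lowest coefficient survives, and it must vanish. *)
Lemma alg_indep_cons (q q' : spec A) M g : alg_indep q' M g ->
  (forall a, q a -> q' a) -> (exists2 f, q' f & ~ q f) ->
  exists h, alg_indep q M.+1 h.
Proof.
move=> gq' qq' [f q'f qf]; pose h i := if i == M then f else g i; exists h => D c.
have hg : forall i, (i < M)%N -> g i = h i by move=> i iM; rewrite /h ltn_eqF.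
have nqX j : ~ q (f ^+ j).
  by elim: j => [|j IHj]; [exact: point1|rewrite exprS => /pointM[]].
rewrite /= {1}/h eqxx => qs.
suff c0 : forall i : 'I_D, c i = 0 by apply/ffunP => i; rewrite c0 ffunE.
suff H n : (n <= D)%N -> forall i : 'I_D, (i < n)%N -> c i = 0.
  by move=> i; apply: (H D) => //.
elim: n => [//|n IHn] nD i; rewrite ltnS leq_eqVlt => /orP[/eqP ei|]; last exact: IHn (ltnW nD) i.
have cz (j : 'I_D) : (j < n)%N -> c j = 0 by apply: IHn; lia.
have : q (f ^+ n * \sum_(j < D | (n <= j)%N) f ^+ (j - n) * comb iota h M (c j)).
  have <- : \sum_(j < D) f ^+ j * comb iota h M (c j) =
      f ^+ n * \sum_(j < D | (n <= j)%N) f ^+ (j - n) * comb iota h M (c j).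
    rewrite (bigID (fun j : 'I_D => (n <= j)%N)) /= [X in _ + X]big1 ?addr0 => [|j]; last first.
      by rewrite -ltnNge => /cz ->; rewrite comb0 mulr0.
    by rewrite mulr_sumr; apply: eq_bigr => j nj; rewrite mulrA -exprD subnKC.
  exact: qs.
case/pointM => [/nqX//|/qq']; rewrite (bigD1 i) -?ei //= subnn expr0 mul1r => q's.
apply: gq'; rewrite (eq_comb iota hg).
set s := \sum_(j | _) _ in q's.
have q's' : q' s.
  apply: (big_ind q') => [|a b|j]; [exact: ideal0|exact: idealD|].
  move=> /andP[ij jni].
  have : (i < j)%N by rewrite ltn_neqAle ij andbT eq_sym.
  rewrite -subn_gt0; case: (j - i)%N => // u _.
  by rewrite exprS -mulrA mulrC; apply: idealM.
have -> : comb iota h M (c i) = (comb iota h M (c i) + s) + (-1) * s by ring.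
by apply: idealD => //; apply: idealM.
Qed.

End Indep.

Section Counting.
Variables (k : fieldType) (n : nat).
Local Notation A := {mpoly k[n]}.
Local Notation iota := (@mpolyC n k : {rmorphism k -> {mpoly k[n]}}).

(** Only the shape of the bound matters: it is affine in [D] for fixed [M] and [e]. *)
Lemma msize_comb D e M (g : nat -> A) (c : coefs k D M) :
  (forall i, (i < M)%N -> (msize (g i) <= e)%N) ->
  (msize (comb iota g M c) <= M * (3 + D * e.+1) + 1)%N.
Proof.
elim: M c => [|M IHM] c ge /=.
  by rewrite msizeC; case: (_ == _); lia.
apply: leq_trans (msize_sum _ _ _) _; apply/bigmax_leqP => i _.
apply: leq_trans (msizeM_le _ _) _.
have IH : (msize (comb iota g M (c i)) <= M * (3 + D * e.+1) + 1)%N.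
  by apply: IHM => j jM; apply: ge; lia.
have He : (msize (g M ^+ i) <= 1 + i * e.+1)%N.
  elim: (i : nat) => [|j IHj]; first by rewrite expr0 msize1.
  rewrite exprS; apply: leq_trans (msizeM_le _ _) _.
  by have := ge M (ltnSn M); lia.
have : (i * e.+1 <= D * e.+1)%N by rewrite leq_mul2r ltnW ?orbT.
rewrite mulSn => H; apply: leq_ltn_trans (leq_add He IH) _; move: H.
by move: (M * _)%N => w; move: (i * _)%N (D * _)%N => u v; lia.
Qed.

(** Dimension count: if M > n, the space of combinations, of dimension D^M, would embed into
    polynomials with all exponents below D b, a space of dimension D^n b^n, which is smaller once D
    > b^n. *)
Lemma alg_indep_card (q : A -> Prop) M g : q 0 -> alg_indep iota q M g -> (M <= n)%N.
Proof.
move=> q0 gi; rewrite leqNgt; apply/negP => nM.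
pose e := (\max_(i < M) msize (g i))%N.
have ge i : (i < M)%N -> (msize (g i) <= e)%N.
  by move=> iM; rewrite (leq_bigmax (Ordinal iM)).
(* As D is at least 1, the bound of [msize_comb] is at most D b, so every exponent occurring in a
   combination is below [L]. *)
pose b := (M * (3 + e.+1) + 1)%N; pose D := (b ^ n).+1; pose L := (D * b)%N.
pose V : vectType k := {ffun {ffun 'I_n -> 'I_L} -> k^o}.
pose Phi (c : coefs k D M) : V :=
  [ffun al : {ffun 'I_n -> 'I_L} => (comb iota g M c)@_[multinom al i : nat | i < n] : k^o].
have PhiL : linear Phi.
  move=> a c d; apply/ffunP => al; rewrite !ffunE.
  have -> : comb iota g M (a *: c + d) = a *: comb iota g M c + comb iota g M d.
    have -> : a *: c + d = a *: c - (- 1) *: d by rewrite scaleN1r opprK.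
    by rewrite combB !combZ /= rmorphN1 mulN1r opprK mul_mpolyC.
  by rewrite mcoeffD mcoeffZ.
pose PhiH := GRing.isLinear.Build _ _ _ _ Phi PhiL.
pose PhiLL : {linear coefs k D M -> V} := HB.pack Phi PhiH.
have PhiI : lker (linfun PhiLL) == 0%VS.
  apply/lker0P => c d; rewrite !lfunE /= => ecd.
  apply/eqP; rewrite -subr_eq0; apply/eqP; apply: (gi D).
  rewrite combB; have -> // : comb iota g M c - comb iota g M d = 0.
  apply/mpolyP => al; rewrite mcoeff0 mcoeffB.
  have small (c' : coefs k D M) (i : 'I_n) : (L <= al i)%N -> (comb iota g M c')@_al = 0.
    move=> Lal; apply: memN_msupp_eq0; apply/negP => /msize_mdeg_lt.
    have : (al i <= mdeg al)%N by rewrite mdegE (bigD1 i) //= leq_addr.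
    have := msize_comb c' ge; move: Lal; rewrite /L /b.
    have : (0 < D)%N by []. by nia.
  have [/existsP[i Li]|] := boolP [exists i, (L <= al i)%N]; first by rewrite !(small _ i) // subrr.
  rewrite negb_exists => /forallP alL.
  have alL' i : (al i < L)%N by rewrite ltnNge.
  move/ffunP/(_ [ffun i => Ordinal (alL' i)]): ecd; rewrite !ffunE.
  have -> : [multinom [ffun i => Ordinal (alL' i)] i : nat | i < n] = al.
    by apply/mnmP => i; rewrite mnmE ffunE.
  by move=> ->; rewrite subrr.
have := limg_dim_eq (f := linfun PhiLL) (U := fullv).
rewrite (eqP PhiI) capv0 => /(_ erefl) ed.
have : (\dim (limg (linfun PhiLL)) <= \dim {:V})%N by apply/dimvS/subvf.
rewrite ed !dimvf dim_coefs -[dim V]/(#|{ffun 'I_n -> 'I_L}| * 1)%N muln1 card_ffun !card_ord.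
apply/negP; rewrite -ltnNge /L expnMn.
have : (D ^ n.+1 <= D ^ M)%N by apply: leq_pexp2l.
apply: leq_trans; rewrite expnSr ltn_pmul2l ?expn_gt0 //.
Qed.

End Counting.

Lemma to_residue_eq0 (R : comPzRingType) (x : spec R) a : to_residue x a = 0 <-> x a.
Proof.
rewrite /to_residue /= -(rmorph0 (qclass (max_ideal x))); split.
  by move/qclass_eq; rewrite subr0 => /max_setP.
by move=> xa; apply/qclass_eq; rewrite subr0; exists a => //; exists (den1 _).
Qed.

(** * Flags of primes and the cotangent space *)

Section Flag.
Variable A : comPzRingType.

(* A maximal chain 0 = c 0 < ... < c N = p of primes such that, locally at p,
   c (i + 1) is generated by c i and f i. *)
Record flag (p : spec A) (N : nat) (f : nat -> A) (c : nat -> spec A) : Prop := Flag {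
  flag0 : forall a, c 0%N a -> a = 0;
  flagN : c N = p;
  flag_sub : forall i a, (i < N)%N -> c i a -> c i.+1 a;
  flag_in : forall i, (i < N)%N -> c i.+1 (f i);
  flag_notin : forall i, (i < N)%N -> ~ c i (f i);
  flag_gen : forall i a, (i < N)%N -> c i.+1 a ->
    exists s b, ~ p s /\ c i (s * a - b * f i) }.

Variables (p : spec A) (N : nat) (f : nat -> A) (c : nat -> spec A).
Hypothesis F : flag p N f c.

Lemma flag_mono i j a : (i <= j <= N)%N -> c i a -> c j a.
Proof.
elim: j => [|j IHj]; first by case: i.
case/andP; rewrite leq_eqVlt => /orP[/eqP->//|ij] jN ca.
by apply: (flag_sub F) => //; apply: IHj => //; lia.
Qed.

Lemma flag_subp i a : (i <= N)%N -> c i a -> p a.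
Proof. by move=> iN ca; rewrite -(flagN F); apply: flag_mono ca; lia. Qed.

Lemma flag_span i a : (i <= N)%N -> c i a ->
  exists s (b : nat -> A), ~ p s /\ s * a = \sum_(j < i) b j * f j.
Proof.
elim: i a => [|i IHi] a iN ca.
  by exists 1, (fun=> 0); rewrite (flag0 F ca) big_ord0 mulr0; split=> //; exact: point1.
have [s [b [ps cs]]] := flag_gen F iN ca.
have [t [b' [pt e]]] := IHi _ (ltnW iN) cs.
exists (t * s), (fun j => if j == i then t * b else b' j); split; first by case/pointM.
rewrite big_ord_recr /= eqxx; under eq_bigr => j _ do rewrite ltn_eqF //.
by rewrite -e; ring.
Qed.

(** The last coefficient of a relation lies in the previous prime, which does not contain the last
    [f]; up to a denominator it is a combination of the earlier [f j]. Substituting this gives a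
    shorter relation. *)
Lemma flag_syzygy i (h : nat -> A) : (i <= N)%N -> \sum_(j < i) h j * f j = 0 ->
  forall j, (j < i)%N -> c i (h j).
Proof.
elim: i h => [//|i IHi] h iN; rewrite big_ord_recr /= => e0.
have ci (b : nat -> A) : c i (\sum_(j < i) b j * f j).
  apply: (big_ind (c i)) => [|a b'|j _]; [exact: ideal0|exact: idealD|].
  apply: idealM; apply: (@flag_mono j.+1); last by apply: (flag_in F); have := ltn_ord j; lia.
  by have := ltn_ord j; lia.
have ch : c i (h i).
  have : c i (h i * f i).
    have -> : h i * f i = (-1) * \sum_(j < i) h j * f j by rewrite mulN1r; apply/eqP;
      rewrite -addr_eq0 addrC e0.
    exact: idealM.
  by case/pointM => // /(flag_notin F iN).
have [s [b [ps e]]] := flag_span (ltnW iN) ch.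
move=> j; rewrite ltnS leq_eqVlt => /orP[/eqP->|ji]; first exact: (flag_sub F).
have H : \sum_(j < i) (s * h j + b j * f i) * f j = 0.
  transitivity (s * (\sum_(j < i) h j * f j) + (\sum_(j < i) b j * f j) * f i).
    by rewrite mulr_sumr mulr_suml -big_split; apply: eq_bigr => l _ /=; ring.
  by rewrite -e -[RHS](mulr0 s) -[in RHS]e0; ring.
have /(flag_sub F iN) := IHi (fun j => s * h j + b j * f i) (ltnW iN) H j ji.
move=> cj; have : c i.+1 (s * h j).
  have -> : s * h j = (s * h j + b j * f i) + (- b j) * f i by ring.
  by apply: idealD => //; apply: idealM; exact: (flag_in F).
by case/pointM => // /(flag_subp iN).
Qed.

Definition square (q : A -> Prop) : set A :=
  [set a | exists n (u v : 'I_n -> A), [/\ forall i, q (u i), forall i, q (v i) &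
     a = \sum_i u i * v i]].

(** The [f j] are linearly independent in p / p^2, locally at [p]: a combination in p^2 can be
    rewritten with coefficients in [p], and [flag_syzygy] compares the two expressions. *)
Lemma flag_free (h : nat -> A) s : ~ p s -> square p (s * \sum_(j < N) h j * f j) ->
  forall j, (j < N)%N -> p (h j).
Proof.
move=> ps [n [u [v [pu pv e]]]] j jN.
have [t [b [pt eb]]] : exists t (b : nat -> A), [/\ ~ p t, forall j, p (b j) &
    t * \sum_i u i * v i = \sum_(j < N) b j * f j].
  elim: n u v pu pv {e} => [|n IHn] u v pu pv.
    exists 1, (fun=> 0); split; [exact: point1|by move=> *; exact: ideal0|].
    by rewrite big_ord0 mulr0 big1 // => i _; rewrite mul0r.
  have [t [b [pt pb e]]] := IHn (u \o lift ord0) (v \o lift ord0)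
    (fun i => pu _) (fun i => pv _).
  have [t' [b' [pt' e']]] : exists t' (b' : nat -> A), ~ p t' /\ t' * v ord0 = \sum_(j < N) b' j * f j.
    by apply: flag_span => //; rewrite (flagN F).
  exists (t * t'), (fun j => t' * b j + t * (u ord0 * b' j)); split.
  - by case/pointM.
  - move=> i; apply: idealD; first exact: idealM.
    by rewrite mulrCA (mulrC (u _)); apply: idealM.
  rewrite big_ord_recl /=.
  transitivity (t' * (t * \sum_(i < n) u (lift ord0 i) * v (lift ord0 i))
      + t * (u ord0 * (t' * v ord0))); first by ring.
  rewrite e e' !mulr_sumr -big_split; apply: eq_bigr => i _ /=; ring.
move=> e2; have H : \sum_(j < N) (t * s * h j - b j) * f j = 0.
  transitivity (t * (s * \sum_(j < N) h j * f j) - \sum_(j < N) b j * f j).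
    by rewrite !mulr_sumr -sumrB; apply: eq_bigr => i _; ring.
  by rewrite e e2 subrr.
have := @flag_syzygy N (fun j => t * s * h j - b j) (leqnn N) H j jN.
rewrite (flagN F) => pd.
have : p (t * s * h j).
  rewrite (_ : t * s * h j = (t * s * h j - b j) + b j); last by ring.
  exact: idealD.
by case/pointM => // /pointM[].
Qed.

End Flag.

Section Good.
Variables (k : fieldType).

(** [N] stands for the height of [p] and [r] for the transcendence degree of its residue field; N +
    r = n is the dimension formula. *)
Definition has_params (A : comPzRingType) (iota : {rmorphism k -> A}) (n : nat) (p : spec A)
    (N : nat) (f : nat -> A) (c : nat -> spec A) := 
  flag p N f c /\ exists r g, (N + r = n)%N /\ alg_indep iota p r g.

Definition good (A : comPzRingType) (iota : {rmorphism k -> A}) (n : nat) :=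
  forall p, exists N f c, has_params iota n p N f c.

Lemma good_iso (A B : comPzRingType) (iota : {rmorphism k -> A}) (iota' : {rmorphism k -> B})
    (phi : {rmorphism A -> B}) (psi : {rmorphism B -> A}) n :
  cancel phi psi -> cancel psi phi -> (forall c, phi (iota c) = iota' c) ->
  good iota' n -> good iota n.
Proof.
move=> phiK psiK phik G p.
have [N [f [c [F [r [g [Nr gi]]]]]]] := G (pcomap psi p).
exists N, (psi \o f), (fun i => pcomap phi (c i)); split; last first.
  exists r, (psi \o g); split=> // D d; rewrite /= => pd; apply: gi.
  rewrite pcomapE rmorph_comb; have <- // : comb iota (psi \o g) r d = comb (psi \o iota') (psi \o g) r d.
  elim: (r) d {pd} => [|M IHM] d /=; first by rewrite -phik phiK.
  by apply: eq_bigr => i _; rewrite IHM.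
case: F => F0 FN Fs Fi Fn Fg; split.
- by move=> a; rewrite pcomapE => /F0 e; rewrite -(phiK a) e rmorph0.
- by apply: spec_eq => a; rewrite pcomapE FN pcomapE phiK.
- by move=> i a iN; rewrite !pcomapE; exact: Fs.
- by move=> i iN; rewrite !pcomapE /= psiK; exact: Fi.
- by move=> i iN; rewrite !pcomapE /= psiK; exact: Fn.
move=> i a iN; rewrite pcomapE => /(Fg _ _ iN)[s [b [ps cs]]].
exists (psi s), (psi b); split; first exact: ps.
by rewrite pcomapE !(rmorphB, rmorphM) /= !psiK.
Qed.

End Good.

Section ZeroPoint.
Variable R : idomainType.
Fact zero_idealD (a b : R) : a = 0 -> b = 0 -> a + b = 0.
Proof. by move=> -> ->; rewrite addr0. Qed.
Fact zero_idealM (a b : R) : b = 0 -> a * b = 0.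
Proof. by move=> ->; rewrite mulr0. Qed.
Definition zero_ideal : ideal R := @Ideal R (fun a => a = 0) erefl zero_idealD zero_idealM.
Fact zero_point1 : ~ zero_ideal 1.
Proof. by move/eqP; rewrite oner_eq0. Qed.
Fact zero_pointM a b : zero_ideal (a * b) -> zero_ideal a \/ zero_ideal b.
Proof. by move/eqP; rewrite mulf_eq0 => /orP[] /eqP; [left|right]. Qed.
Definition zero_point : spec R := Point zero_point1 zero_pointM.
End ZeroPoint.

(** * Primes of a polynomial extension *)

Section PolynomialExtension.
Variables (A : idomainType).

(** The extension of [q] to polynomials, taken as the kernel of reduction to polynomials over the
    residue field, which makes it prime at once. *)
Definition ext_point (q : spec A) : spec {poly A} :=
  pcomap (map_poly (to_residue q)) (zero_point {poly (residue_field q)}).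

Lemma ext_pointE q (F : {poly A}) : ext_point q F <-> forall i, q F`_i.
Proof.
rewrite pcomapE; split=> [/= e i|qF].
  by apply/to_residue_eq0; rewrite -coef_map /= e coef0.
by apply/polyP => i; rewrite coef_map coef0 /=; apply/to_residue_eq0.
Qed.

Lemma ext_pointC q (a : A) : ext_point q a%:P <-> q a.
Proof.
rewrite ext_pointE; split=> [/(_ 0%N)|qa i]; rewrite coefC //.
by case: (i == 0%N) => //; exact: ideal0.
Qed.

Lemma ext_point_sub (q : spec A) (P : spec {poly A}) : (forall a, q a -> P a%:P) ->
  forall F, ext_point q F -> P F.
Proof.
move=> qP F /ext_pointE qF; rewrite -(coefK F) poly_def.
apply: (big_ind P) => [|a b|i _]; [exact: ideal0|exact: idealD|].
by rewrite -mul_polyC mulrC; apply: idealM; apply: qP.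
Qed.

Lemma ext_gen (p q q' : spec A) (f : A) :
  (forall a, q' a -> exists s b, ~ p s /\ q (s * a - b * f)) ->
  forall F, ext_point q' F -> exists s b, ~ p s /\ ext_point q (s%:P * F - b * f%:P).
Proof.
move=> H F; elim/poly_ind: F => [_|F a IHF /ext_pointE qF].
  by exists 1, 0; split; [exact: point1|rewrite mulr0 mul0r subr0; exact: ideal0].
have [s [b [ps /ext_pointE qs]]] : exists s b, ~ p s /\ ext_point q (s%:P * F - b * f%:P).
  by apply: IHF; apply/ext_pointE => i; have := qF i.+1; rewrite coefD coefMX coefC addr0.
have [t [b' [pt qt]]] : exists s b, ~ p s /\ q (s * a - b * f).
  by apply: H; have := qF 0%N; rewrite coefD coefMX coefC add0r.
exists (s * t), (t%:P * b * 'X + (s * b')%:P); split; first by case/pointM.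
have -> : (s * t)%:P * (F * 'X + a%:P) - (t%:P * b * 'X + (s * b')%:P) * f%:P =
    t%:P * ((s%:P * F - b * f%:P) * 'X) + s%:P * (t * a - b' * f)%:P.
  by rewrite !(polyCM, polyCB); ring.
apply: idealD; apply: idealM.
  by apply/ext_pointE => -[|i]; rewrite coefMX //=; exact: ideal0.
by apply/ext_pointC.
Qed.

(* F is of minimal size in P outside the extension of q; pseudo-division by F gives s and b. *)
Lemma ext_point_next (P : spec {poly A}) : let q := pcomap polyC P in
  P = ext_point q \/ exists F, [/\ P F, ~ ext_point q F &
    forall G, P G -> exists s b, ~ P s /\ ext_point q (s * G - b * F)].
Proof.
move=> q; have qP : forall F, ext_point q F -> P F by apply: ext_point_sub.
have [H|H] := pselect (forall F, P F -> ext_point q F).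
  by left; apply: spec_eq => F; split; [exact: H|exact: qP].
right; pose bad n := `[< exists F, [/\ P F, ~ ext_point q F & size F = n] >].
have exb : exists n, bad n.
  apply: contrapT => nb; apply: H => F PF; apply: contrapT => nF.
  by apply: nb; exists (size F); apply/asboolP; exists F.
case: (ex_minnP exb) => n /asboolP[F [PF nF sF]] minF.
have small G : P G -> (size G < n)%N -> ext_point q G.
  move=> PG sG; apply: contrapT => nG.
  have : bad (size G) by apply/asboolP; exists G.
  by move/minF; rewrite leqNgt sG.
have F0 : F != 0 by apply: contra_notN nF => /eqP ->; exact: ideal0.
(* Otherwise removing the leading term leaves a smaller element of [P], which lies in the extension
   of [q], and then so does [F]. *)
have ql : ~ q (lead_coef F).
  move=> qlF; apply: nF; set d := (size F).-1; have extl : ext_point q ((lead_coef F)%:P * 'X^d).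
    by rewrite mulrC; apply: idealM; apply/ext_pointC.
  have -> : F = (F - (lead_coef F)%:P * 'X^d) + (lead_coef F)%:P * 'X^d by ring.
  apply: idealD => //; apply: small; first by rewrite -mulN1r; apply: idealD => //; apply: idealM; exact: qP.
  rewrite -sF -(prednK (_ : 0 < size F)%N) ?size_poly_gt0 // ltnS.
  apply/leq_sizeP => j; rewrite leq_eqVlt => /orP[/eqP <-|lj].
    by rewrite coefB coefCM coefXn eqxx mulr1 subrr.
  rewrite coefB coefCM coefXn gtn_eqF // mulr0 subr0 nth_default //.
  by rewrite -(prednK (_ : 0 < size F)%N) ?size_poly_gt0.
exists F; split=> // G PG.
pose s := lead_coef F ^+ scalp G F.
exists s%:P, (G %/ F)%R; split.
  have qs i : ~ q (lead_coef F ^+ i).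
    by elim: i => [|i IHi]; [exact: point1|rewrite exprS => /pointM[]].
  exact: qs.
have er : s%:P * G - G %/ F * F = G %% F.
  by rewrite mul_polyC (Pdiv.Idomain.divp_eq G F) addrC addKr.
rewrite er; apply: small; last by rewrite -sF ltn_modp.
by rewrite -er -mulNr; apply: idealD; apply: idealM.
Qed.

Variables (k : fieldType) (iota : {rmorphism k -> A}).
Let iotaX : {rmorphism k -> {poly A}} := polyC \o iota.

Lemma comb_polyC D M g (c : coefs k D M) : comb iotaX (polyC \o g) M c = (comb iota g M c)%:P.
Proof. by rewrite (rmorph_comb polyC). Qed.

Lemma ext_alg_indep (q : spec A) M g : alg_indep iota q M g ->
  alg_indep iotaX (ext_point q) M.+1 (fun i => if i == M then 'X else (g i)%:P).
Proof.
move=> gi D c /=; rewrite eqxx => qs; apply/ffunP => i; rewrite ffunE; apply: gi.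
have := (ext_pointE _ _).1 qs i; rewrite coef_sum (bigD1 i) //=.
have E (j : 'I_D) : comb iotaX (fun i => if i == M then 'X else (g i)%:P) M (c j) = (comb iota g M (c j))%:P.
  by rewrite -comb_polyC; apply: eq_comb => l lM; rewrite ltn_eqF.
rewrite E coefXnM ltnn subnn coefC eqxx big1 ?addr0 // => j ji.
rewrite E coefXnM coefC; case: ltnP => // ij; rewrite subn_eq0 leqNgt.
by rewrite ltn_neqAle ij andbT val_eqE ji.
Qed.

(** A prime over [q] is either the extension of [q], and the variable is one more independent
    residue, or it lies one step above the extension, and the flag grows by one. Either way N + r
    increases by one. *)
Lemma good_poly n : good iota n -> good iotaX n.+1.
Proof.
move=> G P; have [N [f [c [F [r [g [Nr gi]]]]]]] := G (pcomap polyC P).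
set q := pcomap polyC P in F gi.
have qP : forall F, ext_point q F -> P F by apply: ext_point_sub.
have ext_flag i : (i < N)%N -> forall H, ext_point (c i.+1) H ->
    exists s b, ~ P s /\ ext_point (c i) (s * H - b * (f i)%:P).
  move=> iN H cH; have [|s [b [qs cs]]] := ext_gen (p := q) (q := c i) (f := f i) _ cH.
    by move=> a; apply: (flag_gen F).
  by exists s%:P, b.
have ext_sub i H : (i < N)%N -> ext_point (c i) H -> ext_point (c i.+1) H.
  by move=> iN /ext_pointE cH; apply/ext_pointE => j; exact: (flag_sub F).
have ext0 H : ext_point (c 0%N) H -> H = 0.
  by move/ext_pointE => cH; apply/polyP => i; rewrite coef0; apply: (flag0 F).
have [eP|[H [PH nH genH]]] := ext_point_next P; rewrite -/q in eP || rewrite -/q in nH genH.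
  exists N, (polyC \o f), (fun i => ext_point (c i)); split; last first.
    exists r.+1, (fun i => if i == r then 'X else (g i)%:P); split; first by rewrite addnS Nr.
    by rewrite eP; exact: ext_alg_indep.
  split=> //.
  - by rewrite (flagN F) -eP.
  - by move=> i iN; apply/ext_pointC; exact: (flag_in F).
  - by move=> i iN /ext_pointC; exact: (flag_notin F).
  by move=> i a iN; apply: ext_flag.
exists N.+1, (fun i => if i == N then H else (f i)%:P),
  (fun i => if i == N.+1 then P else ext_point (c i)); split; last first.
  exists r, (polyC \o g); split; first by rewrite addSn Nr.
  by move=> D d; rewrite comb_polyC => /gi.
have cN : c N = q := flagN F.
split=> [a|||i|i|i]; rewrite ?eqxx //.
- by move/ext0.
- move=> i a; rewrite ltnS leq_eqVlt eqSS => /orP[/eqP->|iN].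
    by rewrite eqxx ltn_eqF // cN; exact: qP.
  by rewrite !ltn_eqF //; [exact: ext_sub|lia].
- rewrite ltnS leq_eqVlt eqSS => /orP[/eqP->|iN]; first by rewrite eqxx.
  by rewrite ltn_eqF //; apply/ext_pointC; exact: (flag_in F).
- rewrite ltnS leq_eqVlt => /orP[/eqP->|iN]; first by rewrite eqxx ltn_eqF // cN.
  by rewrite !ltn_eqF //; [move/ext_pointC; exact: (flag_notin F)|lia].
move=> a; rewrite ltnS leq_eqVlt eqSS => /orP[/eqP->|iN].
  by rewrite eqxx ltn_eqF // cN; exact: genH.
by rewrite !ltn_eqF //; [exact: ext_flag|lia].
Qed.

End PolynomialExtension.

Section MpolyGood.
Variable k : fieldType.

Definition mmulti_hom n : {rmorphism {poly {mpoly k[n]}} -> {mpoly k[n.+1]}} :=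
  horner_eval ('X_ord_max) \o map_poly (@mwiden n k).

Lemma mpoly_morph_eq n (S : comPzRingType) (f g : {rmorphism {mpoly k[n]} -> S}) :
  (forall c, f c%:MP = g c%:MP) -> (forall i, f 'X_i = g 'X_i) -> f =1 g.
Proof.
move=> fgC fgX p; rewrite (mpolyE p) !rmorph_sum; apply: eq_bigr => e _.
rewrite -mul_mpolyC !rmorphM fgC mpolyXE_id !rmorph_prod; congr (_ * _).
by apply: eq_bigr => i _; rewrite !rmorphXn fgX.
Qed.

Lemma mpoly_good n : good (@mpolyC n k : {rmorphism k -> {mpoly k[n]}}) n.
Proof.
elim: n => [|n IHn].
  move=> p; exists 0%N, (fun=> 0), (fun=> p); split; last first.
    exists 0%N, (fun=> 0); split=> // D c /= pc.
    apply: contrapT => /eqP /field_unit [b e]; apply: (point1 (s := p)).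
    have -> : 1 = b%:MP * (c%:MP : {mpoly k[0]}) by rewrite -mpolyCM mulrC e mpolyC1.
    exact: idealM.
  split=> // a pa; apply/eqP; apply: contraT => a0.
  have a00 : a@_0 != 0 by apply: contraNneq a0 => e; rewrite (nvar0_mpolyC a) e mpolyC0.
  have e : (a@_0)^-1%:MP * (a@_0)%:MP = 1 :> {mpoly k[0]} by rewrite -mpolyCM mulVf // mpolyC1.
  by case: (point1 (s := p)); rewrite -e -nvar0_mpolyC; exact: idealM.
have muniX (i : 'I_n) : @muni n k 'X_(widen_ord (leqnSn n) i) = ('X_i)%:P.
  rewrite muniE msuppX big_seq1 mcoeffX eqxx scale1r.
  rewrite mnm1E (_ : _ == _ = false) ?expr0; last first.
    by apply/eqP => /(f_equal val) /= ei; have := ltn_ord i; rewrite ei ltnn.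
  rewrite alg_polyC; congr (_%:P); congr ('X_[_]); apply/mnmP => j.
  by rewrite mnmE !mnm1E -!val_eqE.
have muniM : @muni n k 'X_ord_max = 'X.
  rewrite muniE msuppX big_seq1 mcoeffX eqxx scale1r mnm1E eqxx expr1.
  rewrite (_ : [multinom _ | _ < _] = 0%MM) ?mpolyX0 ?scale1r //.
  apply/mnmP => j; rewrite mnmE mnm0E mnm1E; apply/eqP; rewrite eqb0 -val_eqE /=.
  by have := ltn_ord j; lia.
apply: (good_iso (phi := @muni n k) (psi := mmulti_hom n) _ _ _ (good_poly IHn)).
- apply: (mpoly_morph_eq (f := mmulti_hom n \o @muni n k : {rmorphism _ -> _}) (g := idfun)) => [c|i] /=.
    by rewrite muniC map_polyC /= /horner_eval hornerC mwidenC.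
  have [j ->|->] := unliftP ord_max i.
    have -> : lift ord_max j = widen_ord (leqnSn n) j.
      by apply: val_inj; rewrite /= /bump leqNgt ltn_ord.
    by rewrite muniX map_polyC /= /horner_eval hornerC mwidenX mnmwiden1.
  by rewrite muniM map_polyX /horner_eval hornerX.
- have mwE : @muni n k \o @mwiden n k =1 polyC.
    apply: (mpoly_morph_eq (f := @muni n k \o @mwiden n k : {rmorphism _ -> _}) (g := polyC : {rmorphism _ -> _})) => [c|i] /=.
      by rewrite mwidenC muniC.
    by rewrite mwidenX mnmwiden1 muniX.
  elim/poly_ind => [|F a IHF]; first by rewrite !rmorph0.
  by rewrite rmorphD rmorphM rmorphD rmorphM IHF /= map_polyX map_polyC /= /horner_eval
    hornerX hornerC muniM (mwE a : muni (mwiden a) = _).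
by move=> c; exact: muniC.
Qed.

End MpolyGood.

Section IsLocPrimes.
Variables (A R : comPzRingType) (p : spec A) (J : ideal A) (pi : {rmorphism A -> R}).
Hypothesis P : isloc p J pi.

Lemma spec_unit (q : spec R) a : is_unit a -> ~ q a.
Proof. by move=> [b e] qa; apply: (point1 (s := q)); rewrite -e mulrC; apply: idealM. Qed.

Lemma isloc_comap_sub (q : spec R) a : q (pi a) -> p a.
Proof. by move=> qa; apply: contrapT => /(isloc_unit P) u; exact: (spec_unit u qa). Qed.

Lemma isloc_mem (q : spec R) r a s : ~ p s -> pi s * r = pi a -> q r <-> q (pi a).
Proof.
move=> ps <-; split=> [qr|]; first exact: idealM.
by case/pointM => // qs; case: (spec_unit (isloc_unit P ps) qs).
Qed.

Lemma isloc_prime (q : spec A) : (forall a, J a -> q a) -> (forall a, q a -> p a) ->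
  exists Q : spec R, pcomap pi Q = q.
Proof.
move=> Jq qp.
have J0 a : J a -> to_residue q a = 0 by move/Jq/to_residue_eq0.
have pu s : ~ p s -> is_unit (to_residue q s).
  by move=> ps; apply: field_unit; apply/eqP => /to_residue_eq0 /qp.
have [h hE] := isloc_lift P J0 pu.
exists (pcomap h (zero_point (residue_field q))); apply: spec_eq => a.
split=> [e|/to_residue_eq0 e]; first by apply/to_residue_eq0; rewrite -hE.
by rewrite -hE in e.
Qed.

Lemma isloc_denom (N : nat) (h : 'I_N -> R) :
  exists s (b : 'I_N -> A), ~ p s /\ forall i, pi s * h i = pi (b i).
Proof.
have /choice[ab abP] i := isloc_frac P (h i); have {abP}/choice[s sP] := abP.
exists (\prod_i s i), (fun i => (\prod_(j | j != i) s j) * ab i); split.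
  by elim/big_ind: _ => [|a b pa pb /pointM[]//|i _]; [exact: point1|by case: (sP i)].
move=> i; rewrite (bigD1 i) //= !rmorphM; have [_ <-] := sP i; ring.
Qed.

End IsLocPrimes.

(** * Regularity and singularity read off a presentation *)

Section RegularityCriteria.
Variables (k : fieldType) (n : nat) (R : comPzRingType).
Local Notation A := {mpoly k[n]}.
Variables (p : spec A) (J : ideal A) (pi : {rmorphism A -> R}).
Hypothesis P : isloc p J pi.
Local Notation iota := (@mpolyC n k : {rmorphism k -> {mpoly k[n]}}).

(** Starting from the r independent residues at [p], each of the [m] steps down adds one by
    [alg_indep_cons]; hence m + r is at most n = N + r. *)
Lemma chain_bound N f c (c' : nat -> spec A) m : has_params iota n p N f c ->
  (forall i, (i < m)%N -> ideal_set (c' i) `<` ideal_set (c' i.+1)) -> (forall a, c' m a -> p a) ->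
  (m <= N)%N.
Proof.
move=> [_ [r [g [eN gi]]]] cc cm; suff : (m + r <= n)%N by rewrite -eN leq_add2r.
have H j : (j <= m)%N -> exists h, alg_indep iota (c' (m - j)%N) (j + r) h.
  elim: j => [_|j IHj jm]; first by exists g; rewrite subn0 add0n; apply: alg_indepW gi.
  have [h hi] := IHj (ltnW jm); rewrite addSn; apply: alg_indep_cons hi _ _;
    have := cc (m - j.+1)%N; rewrite subnSK // => /(_ (leq_subr _ _)) [sub nsub]; first exact: sub.
  apply: contrapT => H; apply: nsub => a ca; apply: contrapT => na.
  by apply: H; exists a.
have [h hi] := H m (leqnn m).
by apply: alg_indep_card hi; exact: ideal0.
Qed.

Lemma chain_comap (c : nat -> spec R) i : ideal_set (c i) `<` ideal_set (c i.+1) ->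
  ideal_set (pcomap pi (c i)) `<` ideal_set (pcomap pi (c i.+1)).
Proof.
move=> [sub nsub]; split=> [a|H]; first exact: sub.
apply: nsub => r cr; have [a [s [ps e]]] := isloc_frac P r.
by apply/(isloc_mem P (c i) ps e)/H/(isloc_mem P (c i.+1) ps e).
Qed.

Lemma regular_isloc : (forall a, J a -> a = 0) -> regular_local R.
Proof.
move=> J0; have [N [f [c G]]] := mpoly_good p; have [F _] := G.
have pf (i : 'I_N) : p (f i).
  by apply: (flag_subp F (i := i.+1)) => //; apply: (flag_in F).
exists N; split; last first.
  exists (fun i => pi (f i)) => r; split=> [nu|[b ->]]; last first.
    pose cp := closed_point (isloc_local P).
    apply: (big_ind cp) => [|a b'|i _]; [exact: ideal0|exact: idealD|].
    by apply: idealM; move/(isloc_unitE P); apply.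
  have [a [s [ps e]]] := isloc_frac P r.
  have pa : p a.
    apply: contra_notP nu => /(isloc_unit P); rewrite -e.
    by case/is_unit_mulP.
  have [t [b [pt eb]]] : exists t (b : nat -> A), ~ p t /\ t * a = \sum_(j < N) b j * f j.
    by apply: (flag_span F) => //; rewrite (flagN F).
  have pu : is_unit (pi (s * t)) by apply: (isloc_unit P) => /pointM[].
  exists (fun i => cinv (pi (s * t)) * pi (b i)).
  apply: (unit_mulI pu); rewrite mulr_sumr.
  under eq_bigr => i _ do rewrite -!mulrA mulrA (cinvP pu) mul1r -rmorphM.
  by rewrite -rmorph_sum -eb !rmorphM -e; ring.
have Jc q a : J a -> ideal_set q a by move/J0 ->; exact: ideal0.
split; last first.
  move=> m [c' cc]; apply: (chain_bound (c' := fun i => pcomap pi (c' i)) G).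
    by move=> i im; apply/chain_comap/cc.
  by move=> a; exact: isloc_comap_sub P _ _.
(* The minimum makes the chain constant beyond [N], so that all its terms lie below [p]. *)
have /choice[Q QE] i : exists Q : spec R, pcomap pi Q = c (minn i N).
  apply: (isloc_prime P) => [a|a]; first exact: Jc.
  by apply: (flag_subp F); rewrite geq_minr.
exists Q => i iN; split.
  move=> r Qr; have [a [s [ps e]]] := isloc_frac P r.
  apply/(isloc_mem P (Q i.+1) ps e); rewrite -pcomapE QE (minn_idPl iN).
  apply: (flag_sub F) => //; rewrite -[i](minn_idPl (ltnW iN)) -QE pcomapE.
  by apply/(isloc_mem P (Q i) ps e).
move=> H; apply: (flag_notin F iN); rewrite -[i in c i](minn_idPl (ltnW iN)) -QE.
by apply/H; rewrite -pcomapE QE (minn_idPl iN); exact: (flag_in F).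
Qed.

(** As [J] lies in p^2, the cotangent space of [R] still has dimension N; as [J] is not zero, chains
    of primes in [R] are shorter than N. *)
Lemma singular_isloc : (forall a, J a -> square p a) -> (exists2 a, J a & a <> 0) ->
  ~ regular_local R.
Proof.
move=> J2 [a0 Ja0 a0n] [d [[cd _] [e eE]]].
have [N [f [c G]]] := mpoly_good p; have [F _] := G.
have dN : (d < N)%N.
  have [c' cc] := cd.
  (* A chain of [R], pulled back, starts at a prime containing [J]; the zero ideal can be put
     strictly below it. *)
  pose c2 i := if i is j.+1 then pcomap pi (c' j) else zero_point A.
  apply: (chain_bound (c' := c2) G) => [[_|i id]|a] /=.
  - split=> [a ->|H]; first exact: (ideal0 (pcomap pi (c' 0%N))).
    apply: a0n; apply: H; rewrite /= /comap_set /=.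
    by rewrite ((isloc_ker P a0).2 _); [exact: ideal0|exists 1; rewrite ?mul1r //; exact: point1].
  - by apply/chain_comap/cc.
  exact: isloc_comap_sub P _ _.
have := dN; rewrite ltnNge => /negP; apply.
pose kp := residue_field p.
have J0 a : J a -> to_residue p a = 0 by move=> Ja; apply/to_residue_eq0/(isloc_sub P).
have pu s : ~ p s -> is_unit (to_residue p s).
  by move=> ps; apply: field_unit; apply/eqP => /to_residue_eq0.
have [h hE] := isloc_lift P J0 pu.
have h0 r : ~ is_unit r -> h r = 0.
  move=> nu; have [a [s [ps es]]] := isloc_frac P r.
  have pa : p a.
    by apply: contra_notP nu => /(isloc_unit P); rewrite -es; case/is_unit_mulP.
  apply: (unit_mulI (pu s ps)); rewrite mulr0 -hE -rmorphM es hE.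
  exact/to_residue_eq0.
have free (b : 'I_N -> R) : \sum_l b l * pi (f l) = 0 -> forall l, h (b l) = 0.
  move=> b0 l; have [s [b' [ps sb]]] := isloc_denom P b.
  pose b2 j := if insub j is Some i then b' i else 0 : A.
  have b2E (i : 'I_N) : b2 i = b' i by rewrite /b2 valK.
  have : pi (\sum_(j < N) b2 j * f j) = 0.
    rewrite rmorph_sum; under eq_bigr => i _ do rewrite b2E rmorphM -sb -mulrA.
    by rewrite -mulr_sumr b0 mulr0.
  move/(isloc_ker P) => [t pt Jt].
  have pb := flag_free F pt (J2 _ Jt) (ltn_ord l); rewrite b2E in pb.
  apply: (unit_mulI (pu s ps)); rewrite mulr0 -hE -rmorphM sb hE.
  exact/to_residue_eq0.
have nuf (l : 'I_N) : ~ is_unit (pi (f l)).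
  move/(isloc_unitE P); apply; apply: (flag_subp F (i := l.+1)) => //; exact: (flag_in F).
have /choice[ga gaE] (i : 'I_d) : exists ga : 'I_N -> R, e i = \sum_l ga l * pi (f l).
  have : ~ is_unit (e i).
    apply/eE; exists (fun j => (j == i)%:R).
    rewrite (bigD1 i) //= eqxx mul1r big1 ?addr0 // => j /negPf->; exact: mul0r.
  move=> nu; have [a [s [ps es]]] := isloc_frac P (e i).
  have pa : p a.
    by apply: contra_notP nu => /(isloc_unit P); rewrite -es; case/is_unit_mulP.
  have [t [b [pt eb]]] : exists t (b : nat -> A), ~ p t /\ t * a = \sum_(j < N) b j * f j.
    by apply: (flag_span F) => //; rewrite (flagN F).
  have pst : is_unit (pi (s * t)) by apply: (isloc_unit P) => /pointM[].
  exists (fun i => cinv (pi (s * t)) * pi (b i)).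
  apply: (unit_mulI pst); rewrite mulr_sumr.
  under eq_bigr => j _ do rewrite -!mulrA mulrA (cinvP pst) mul1r -rmorphM.
  by rewrite -rmorph_sum -eb !rmorphM -es; ring.
have /choice[ka kaE] (j : 'I_N) : exists ka : 'I_d -> R, pi (f j) = \sum_i ka i * e i.
  exact/eE/nuf.
(* The [f j] and the [e i] are combinations of each other, and [free] turns this into Km Gm = 1 over
   the residue field, so N is at most d. *)
pose Km : 'M[kp]_(N, d) := \matrix_(j, i) h (ka j i).
pose Gm : 'M[kp]_(d, N) := \matrix_(i, l) h (ga i l).
apply: (@mulmx1_min _ N d Km Gm); apply/matrixP => j l.
have : \sum_l ((j == l)%:R - \sum_i ka j i * ga i l) * pi (f l) = 0.
  under eq_bigr => l' _ do rewrite mulrBl mulr_suml.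
  rewrite sumrB exchange_big /= [X in X - _](bigD1 j) //= eqxx mul1r.
  rewrite [X in _ + X - _]big1 ?addr0 => [|i /negPf]; last first.
    by rewrite eq_sym => ->; rewrite mul0r.
  rewrite kaE -sumrB big1 // => i _; apply/eqP; rewrite subr_eq0; apply/eqP.
  by rewrite {1}gaE mulr_sumr; apply: eq_bigr => l' _; rewrite mulrA.
move/free/(_ l)/eqP; rewrite rmorphB rmorph_nat subr_eq0 => /eqP e1.
rewrite !mxE e1 rmorph_sum; apply: eq_bigr => i _.
by rewrite !mxE rmorphM.
Qed.

End RegularityCriteria.

(** * Continuants *)

Section Continuants.
Variable R : comPzRingType.
Implicit Types (z : nat -> R) (i n : nat).

Definition upd z i (y : R) : nat -> R := fun j => if j == i then y else z j.

(* The partial derivative of the n-th continuant with respect to z i. *)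
Fixpoint dcont z i n : R :=
  match n with
  | 0 => 0
  | 1 => (i == 1%N)%:R
  | (n'.+1 as p).+1 => (i == p.+1)%:R * continuant z p + z p.+1 * dcont z i p - dcont z i n'
  end.

Lemma continuantSS z n : continuant z n.+2 = z n.+2 * continuant z n.+1 - continuant z n.
Proof. by []. Qed.

Lemma dcontSS z i n : dcont z i n.+2 =
  (i == n.+2)%:R * continuant z n.+1 + z n.+2 * dcont z i n.+1 - dcont z i n.
Proof. by []. Qed.

Lemma nat_ind2 (P : nat -> Prop) :
  P 0%N -> P 1%N -> (forall n, P n -> P n.+1 -> P n.+2) -> forall n, P n.
Proof.
move=> P0 P1 PS n; suff : P n /\ P n.+1 by case.
by elim: n => [|n [Pn Pn1]]; split=> //; exact: PS.
Qed.

Lemma eq_continuant z z' n : (forall i, (0 < i <= n)%N -> z i = z' i) ->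
  continuant z n = continuant z' n.
Proof.
elim/nat_ind2: n => [//|zz|n IH1 IH2 zz]; first by rewrite /= zz.
rewrite !continuantSS zz; last by lia.
by rewrite IH2 ?IH1 // => i ile; apply: zz; lia.
Qed.

Lemma dcont_gt z i n : (n < i)%N -> dcont z i n = 0.
Proof.
elim/nat_ind2: n => [//|/=|n IH1 IH2 ni]; first by case: i => [|[]].
by rewrite dcontSS IH1 ?IH2 ?(gtn_eqF ni) ?mulr0n ?mul0r ?mulr0 ?addr0 ?subr0 //; lia.
Qed.

Lemma continuant_upd z i y n : (0 < i)%N ->
  continuant (upd z i y) n = continuant z n + (y - z i) * dcont z i n.
Proof.
move=> i0; elim/nat_ind2: n => [|/=|n IH1 IH2]; first by rewrite /= mulr0 addr0.
  rewrite /upd eq_sym; case: eqP => [->|_]; last by rewrite mulr0 addr0.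
  by rewrite mulr1 addrC subrK.
rewrite !continuantSS IH1 IH2 dcontSS {1}/upd eq_sym; case: eqP => [e|_]; last by rewrite mulr0n; ring.
rewrite !dcont_gt ?e // mulr1n; ring.
Qed.

Lemma eq_dcont z z' i n : (forall j, (0 < j <= n)%N -> j != i -> z j = z' j) ->
  dcont z i n = dcont z' i n.
Proof.
elim/nat_ind2: n => [//|//|n IH1 IH2 zz].
rewrite !dcontSS IH1 ?IH2; last 2 first.
- by move=> j ?; apply: zz; lia.
- by move=> j ?; apply: zz; lia.
have [ei|ni] := eqVneq i n.+2; last by rewrite zz 1?eq_sym ?mul0r //; lia.
rewrite !dcont_gt ?ei // (@eq_continuant z z') ?mulr0 // => j jn; apply: zz; lia.
Qed.

Lemma dcont_last z n : dcont z n.+1 n.+1 = continuant z n.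
Proof. by case: n => [//|n]; rewrite dcontSS eqxx !dcont_gt // mulr0 addr0 subr0 mul1r. Qed.

(* The continuant is affine in z i, with slope [dcont z i n]. *)
Definition solve z i n y :=
  upd z i (cinv (dcont z i n) * (y - continuant (upd z i 0) n)).

Lemma solve_neq z i n y j : j != i -> solve z i n y j = z j.
Proof. by rewrite /solve /upd => /negPf->. Qed.

Lemma continuant_affine z i y n : (0 < i)%N ->
  continuant (upd z i y) n = continuant (upd z i 0) n + y * dcont z i n.
Proof. by move=> i0; rewrite !continuant_upd //; ring. Qed.

Lemma solveP z i n y : (0 < i)%N -> is_unit (dcont z i n) -> continuant (solve z i n y) n = y.
Proof.
move=> i0 u; rewrite /solve continuant_affine // mulrAC [X in X * _]mulrC cinvP //; ring.
Qed.

Lemma solve_id z z' i n y : (0 < i <= n)%N -> is_unit (dcont z' i n) -> continuant z' n = y ->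
  (forall j, (0 < j <= n)%N -> j != i -> z j = z' j) ->
  forall j, (0 < j <= n)%N -> solve z i n y j = z' j.
Proof.
move=> /andP[i0 iln] u e zz j jn; have [->|ji] := eqVneq j i; last by rewrite solve_neq // zz.
rewrite /solve {1}/upd eqxx (eq_dcont zz).
have -> : continuant (upd z i 0) n = continuant (upd z' i 0) n.
  by apply: eq_continuant => l ln; rewrite /upd; case: eqP => // /eqP li; exact: zz.
rewrite -{1}e -[continuant z' n](@eq_continuant (upd z' i (z' i))); last first.
  by move=> l _; rewrite /upd; case: eqP => [->|].
by rewrite [continuant (upd z' i (z' i)) n]continuant_affine // addrC addKr mulrCA (mulrC (cinv _)) cinvP // mulr1.
Qed.

Lemma continuant_zero z n : (forall i, (0 < i <= n)%N -> z i = 0) ->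
  continuant z n = if odd n then 0 else (-1) ^+ n./2.
Proof.
elim/nat_ind2: n => [//|/= zz|n IH1 _ zz]; first exact: zz.
rewrite continuantSS zz ?mul0r ?sub0r ?IH1 /=; last 2 first.
- by move=> i ile; apply: zz; lia.
- by lia.
by rewrite negbK; case: odd; rewrite ?oppr0 // exprS mulN1r.
Qed.

End Continuants.

Lemma rmorph_continuant (R S : comPzRingType) (f : {rmorphism R -> S}) z n :
  f (continuant z n) = continuant (f \o z) n.
Proof.
elim/nat_ind2: n => [|//|n IH1 IH2]; first exact: rmorph1.
by rewrite !continuantSS rmorphB rmorphM IH1 IH2.
Qed.

Lemma rmorph_dcont (R S : comPzRingType) (f : {rmorphism R -> S}) z i n :
  f (dcont z i n) = dcont (f \o z) i n.
Proof.
elim/nat_ind2: n => [|/=|n IH1 IH2]; [exact: rmorph0|exact: rmorph_nat|].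
by rewrite !dcontSS rmorphB rmorphD !rmorphM IH1 IH2 rmorph_continuant rmorph_nat.
Qed.

Lemma rmorph_solve (R S : comPzRingType) (f : {rmorphism R -> S}) z i n y j :
  is_unit (dcont z i n) -> f (solve z i n y j) = solve (f \o z) i n (f y) j.
Proof.
move=> u; rewrite /solve {1 3}/upd; case: eqP => // _.
rewrite rmorphM rmorph_cinv // rmorph_dcont rmorphB rmorph_continuant; congr (_ * (_ - _)).
by apply: eq_continuant => l _ /=; rewrite /upd; case: eqP => // _; rewrite rmorph0.
Qed.

(** Lifting a solution: the slope is a unit in [S], hence in [R], and the coordinate solved for lies
    over [v i] because the equation determines it in [S]. *)
Lemma local_solve (R S : comPzRingType) (h : {rmorphism R -> S}) (z : nat -> R) (v : nat -> S)
    i n (y : R) : local_hom h -> (0 < i <= n)%N ->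
  (forall j, (0 < j <= n)%N -> j != i -> h (z j) = v j) -> is_unit (dcont v i n) ->
  continuant v n = h y ->
  continuant (solve z i n y) n = y /\ forall j, (0 < j <= n)%N -> h (solve z i n y j) = v j.
Proof.
move=> hl iln hz u e; have uz : is_unit (dcont z i n).
  by apply: hl; rewrite rmorph_dcont (@eq_dcont _ _ v) // => j jn ji /=; exact: hz.
split; first by apply: solveP => //; case/andP: iln.
by move=> j jn; rewrite rmorph_solve //; apply: solve_id.
Qed.

Section FieldContinuants.
Variable L : idomainType.
Implicit Types (z : nat -> L).

(** By the recursion, two consecutive zeros would propagate down to P_0 = 1. *)
Lemma continuant_consec z n : continuant z n = 0 -> continuant z n.+1 != 0.
Proof.
elim: n => [/eqP|n IHn e]; first by rewrite oner_eq0.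
rewrite continuantSS e mulr0 sub0r oppr_eq0; apply: contraTneq isT => /IHn.
by rewrite e eqxx.
Qed.

(** The last partial derivative of P_(n+2) is P_(n+1), so P_n is not zero; the one before it is
    z_(n+2) P_n, so z_(n+2) = 0. The others are then those of - P_n, and induction applies. Finally
    z_(n+1) P_n = P_(n-1), which vanishes at the origin because n - 1 is odd. *)
Lemma continuant_crit z n : (forall i, (0 < i <= n)%N -> dcont z i n = 0) ->
  ~~ odd n /\ forall i, (0 < i <= n)%N -> z i = 0.
Proof.
elim/nat_ind2: n => [|/(_ 1%N isT) /eqP|n IH1 _ dz].
- by split=> // i; lia.
- by rewrite /= oner_eq0.
have Pn1 : continuant z n.+1 = 0 by rewrite -dcont_last dz ?leqnn.
have Pn : continuant z n != 0.
  by apply: contra_eq_neq Pn1 => /continuant_consec.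
have zn2 : z n.+2 = 0.
  have := dz n.+1; rewrite dcontSS dcont_last (@dcont_gt _ z n.+1 n) // ltn_eqF //.
  rewrite mul0r add0r subr0 => /(_ _)/eqP; rewrite mulf_eq0 (negPf Pn) orbF => H.
  by apply/eqP/H; lia.
have [en zn] : ~~ odd n /\ (forall i, (0 < i <= n)%N -> z i = 0).
  apply: IH1 => i ile; have := dz i; rewrite dcontSS zn2 ltn_eqF; last by lia.
  rewrite !mul0r addr0 sub0r => /(_ _)/eqP; rewrite oppr_eq0 => H; apply/eqP/H; lia.
split; first by rewrite /= negbK.
have zn1 : z n.+1 = 0.
  case: n Pn1 Pn en zn {IH1 dz zn2} => [//|n]; rewrite continuantSS => Pn1 Pn en zn.
  have Pz : continuant z n = 0.
    rewrite continuant_zero; first by move: en; rewrite /= negbK => ->.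
    by move=> i ile; apply: zn; lia.
  by move/eqP: Pn1; rewrite Pz subr0 mulf_eq0 (negPf Pn) orbF => /eqP.
move=> i ile; have [->//|n2] := eqVneq i n.+2; have [->//|n1] := eqVneq i n.+1.
by apply: zn; lia.
Qed.

End FieldContinuants.

Section LocalContinuants.
Variables (S : comPzRingType) (Sloc : is_local S).

Definition reduce : {rmorphism S -> residue_field (closed_point Sloc)} :=
  to_residue (closed_point Sloc).

Lemma reduce_eq0 a : reduce a = 0 <-> ~ is_unit a.
Proof. exact: to_residue_eq0. Qed.

Lemma reduce_neq0 a : reduce a != 0 -> is_unit a.
Proof. by move=> a0; apply: contrapT => /reduce_eq0 e; rewrite e eqxx in a0. Qed.

Lemma local_consec (z : nat -> S) n : ~ is_unit (continuant z n.+1) -> is_unit (continuant z n).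
Proof.
move=> /reduce_eq0; rewrite rmorph_continuant => e; apply: reduce_neq0; rewrite rmorph_continuant.
by apply: contra_eq_neq e => /continuant_consec.
Qed.

Lemma local_crit (z : nat -> S) n : (forall i, (0 < i <= n)%N -> ~ is_unit (dcont z i n)) ->
  ~~ odd n /\ forall i, (0 < i <= n)%N -> ~ is_unit (z i).
Proof.
move=> dz; have [|en zn] := @continuant_crit _ (reduce \o z) n.
  by move=> i ile; rewrite -rmorph_dcont; apply/reduce_eq0/dz.
by split=> // i ile; apply/reduce_eq0; exact: zn.
Qed.

Lemma local_zero (z : nat -> S) n : (forall i, (0 < i <= n)%N -> ~ is_unit (z i)) ->
  ~ is_unit (continuant z n - (if odd n then 0 else (-1) ^+ n./2)).
Proof.
move=> zn; apply/reduce_eq0; rewrite rmorphB rmorph_continuant continuant_zero => [|i ile].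
  by case: odd; rewrite ?rmorph0 ?rmorphXn ?rmorphN1 subrr.
exact/reduce_eq0/zn.
Qed.

Lemma local_zero_unit (z : nat -> S) n : (forall i, (0 < i <= n)%N -> ~ is_unit (z i)) ->
  ~~ odd n -> is_unit (continuant z n).
Proof.
move=> zn /negPf on; have := local_zero zn; rewrite on => /reduce_eq0 /eqP.
rewrite rmorphB subr_eq0 rmorphXn rmorphN1 => /eqP e; apply: reduce_neq0; rewrite e.
by rewrite expf_neq0 // oppr_eq0 oner_eq0.
Qed.

End LocalContinuants.

Section Rebuild.
Variable R : comPzRingType.
Implicit Types (T W z : nat -> R).

(** The source of all quadratic forms below: by the recursion, consecutive values of (-1)^q P_(2q)
    differ by a single product. *)
Lemma continuant_even z q : (-1) ^+ q * continuant z q.*2 =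
  1 + \sum_(j < q) (-1) ^+ j.+1 * (z j.*2.+2 * continuant z j.*2.+1).
Proof.
elim: q => [|q IHq]; first by rewrite big_ord0 addr0 mulr1.
rewrite big_ord_recr addrA -IHq doubleS continuantSS exprS; ring.
Qed.

(* The values of P (2 j), and the point z, as functions of the T j = z (2 j + 2) and
   the W j = P (2 j + 1). *)
Fixpoint evens T W j : R := if j is j'.+1 then T j' * W j' - evens T W j' else 1.

Definition rebuild T W i : R :=
  if odd i then (W i./2 + (if i./2 is j.+1 then W j else 0)) * cinv (evens T W i./2)
  else T i./2.-1.

Lemma rebuildP T W q : (forall j, (j < q)%N -> is_unit (evens T W j)) ->
  forall j, (j < q)%N -> continuant (rebuild T W) j.*2.+1 = W j /\
    continuant (rebuild T W) j.*2.+2 = evens T W j.+1.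
Proof.
move=> u; elim=> [|j IHj] jq.
  have e : rebuild T W 1 = W 0%N.
    by rewrite /rebuild /= addr0 (cinv_eq (b := 1)) ?mulr1.
  by split; rewrite // continuantSS /= e; congr (_ * _ - _).
have [|IH1 IH2] := IHj _; first by lia.
have e : continuant (rebuild T W) j.+1.*2.+1 = W j.+1.
  rewrite doubleS continuantSS -/(j.*2.+2) IH2 IH1 /rebuild /= negbK odd_double uphalf_double.
  by rewrite -mulrA (mulrC (cinv _)) cinvP ?mulr1; [ring|apply: (u j.+1)].
split=> //; rewrite continuantSS e doubleS IH2.
by rewrite {1}/rebuild /= !negbK odd_double half_double.
Qed.

Lemma rebuild_id z q : (forall j, (j < q)%N -> is_unit (continuant z j.*2)) ->
  let T j := z j.*2.+2 in let W j := continuant z j.*2.+1 in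
  (forall j, (j <= q)%N -> evens T W j = continuant z j.*2) /\
  forall i, (0 < i <= q.*2)%N -> rebuild T W i = z i.
Proof.
move=> u T W; have eE j : evens T W j = continuant z j.*2.
  by elim: j => [//|j IHj]; rewrite /= IHj.
split=> // i iq; rewrite /rebuild; case: ifP => oi; last first.
  by rewrite /T; congr z; have := odd_double_half i; rewrite oi; lia.
have := odd_double_half i; rewrite oi eE; move: i./2 => j ei.
have jq : (j < q)%N by lia.
rewrite -ei /W; case: j jq {ei} => [|j] jq.
  by rewrite addr0 /= (cinv_eq (b := 1)) ?mulr1.
by rewrite doubleS [continuant z j.*2.+3]continuantSS subrK -mulrA cinvP ?mulr1 // -doubleS; exact: u.
Qed.

Lemma eq_rebuild T W T' W' q : (forall j, (j < q)%N -> T j = T' j) ->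
  (forall j, (j < q)%N -> W j = W' j) ->
  (forall j, (j <= q)%N -> evens T W j = evens T' W' j) /\
  forall i, (0 < i <= q.*2)%N -> rebuild T W i = rebuild T' W' i.
Proof.
move=> TT WW; have eE j : (j <= q)%N -> evens T W j = evens T' W' j.
  by elim: j => [//|j IHj] jq /=; rewrite TT ?WW ?IHj //; lia.
split=> // i iq; rewrite /rebuild; have := odd_double_half i; case: odd => /=; last first.
  by move=> ei; apply: TT; lia.
move=> ei; rewrite eE ?WW; try lia; congr ((_ + _) * _).
by case: (i./2) ei => // j ei; apply: WW; lia.
Qed.

End Rebuild.

Lemma rmorph_evens (R S : comPzRingType) (f : {rmorphism R -> S}) T W j :
  f (evens T W j) = evens (f \o T) (f \o W) j.
Proof. by elim: j => [|j IHj] /=; rewrite ?rmorph1 // rmorphB rmorphM IHj. Qed.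

(** The coordinate change to the z_(2j+2) and P_(2j+1) is inverted along [h]: P_(2j+1) = z_(2j+1)
    P_(2j) - P_(2j-1) is solved for z_(2j+1), as P_(2j) is a unit. *)
Lemma local_rebuild (R S : comPzRingType) (h : {rmorphism R -> S}) (T W : nat -> R) (v : nat -> S)
    q : local_hom h -> (forall j, (j < q)%N -> is_unit (continuant v j.*2)) ->
  (forall j, (j < q)%N -> h (T j) = v j.*2.+2) ->
  (forall j, (j < q)%N -> h (W j) = continuant v j.*2.+1) ->
  [/\ forall j, (j < q)%N -> rebuild T W j.*2.+2 = T j,
      forall j, (j < q)%N -> continuant (rebuild T W) j.*2.+1 = W j &
      forall i, (0 < i <= q.*2)%N -> h (rebuild T W i) = v i].
Proof.
move=> hl vu hT hW; have [E1 E2] := eq_rebuild hT hW; have [E3 E4] := rebuild_id vu.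
have u j : (j < q)%N -> is_unit (evens T W j).
  by move=> jq; apply: hl; rewrite rmorph_evens E1 ?E3 ?(ltnW jq) //; exact: vu.
split=> [j jq|j jq|i iq].
- by rewrite /rebuild /= !negbK odd_double half_double.
- by have [] := rebuildP u jq.
rewrite -E4 // -E2 // /rebuild; case: ifP => oi //.
have ie := odd_double_half i; rewrite oi in ie.
rewrite rmorphM rmorph_cinv ?rmorph_evens ?rmorphD; last by apply: u; lia.
by case: (i./2) => //=; rewrite rmorph0.
Qed.

(** A chart without equations: if the kept coordinates determine the others, [S] is a localization
    of the polynomial ring in the kept ones. *)
Lemma regular_chart (k : fieldType) (S : algebra k) (T : finType) (v : T -> S)
    (E : set {mpoly k[#|T|]}) p (P : isloc p (ideal_gen E) (ev S v)) (kept : pred T) :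
  (forall (R : algebra k) (h : {rmorphism R -> S}) (tau : T -> R), alg_hom h -> local_hom h ->
     (forall t, kept t -> h (tau t) = v t) ->
     exists zeta : T -> R, [/\ forall t, kept t -> zeta t = tau t,
       forall t, h (zeta t) = v t & forall q, E q -> ev R zeta q = 0]) ->
  regular_local S.
Proof.
move=> H; pose T' : finType := {t : T | kept t}.
have Q := @chart k S T v E p P T' set0 (fun t => v (val t)).
have Q0 : forall q, (set0 : set {mpoly k[#|T'|]}) q -> ev S (fun t : T' => v (val t)) q = 0 by [].
apply: (regular_isloc (Q Q0 _)) => [R h tau hk hl _ htau|a]; last first.
  by move/(_ (zero_ideal {mpoly k[#|T'|]})); apply.
pose tau' t := if insub t is Some t' then tau t' else 0.
have tauE (t' : T') : tau' (val t') = tau t' by rewrite /tau' valK.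
have htau' t : kept t -> h (tau' t) = v t.
  by move=> kt; rewrite -[t]/(val (exist _ t kt : T')) tauE htau.
have [zeta [zk hz zE]] := H R h tau' hk hl htau'.
exists zeta; split=> // f fk fz t /=.
by rewrite fz zk ?tauE // (valP t).
Qed.

Section FiberPoints.
Variables (K : fieldType) (m : nat) (l : 'I_m -> nat) (eta : spec (Kc K l)).
Local Notation kappa := (residue_field eta).
Local Notation T := (Xvar l).

Definition zvar (a : 'I_m) (i : nat) : T :=
  inl (@Tagged _ a (fun a => 'I_(l a).+1) (inord i.-1)).

Definition mkX (R : Type) (z : 'I_m -> nat -> R) (u w : R) (t : T) : R :=
  match t with
  | inl s => z (tag s) (tagged s).+1
  | inr b => if b then u else w
  end.

Lemma mkX_z (R : Type) (z : 'I_m -> nat -> R) u w a i : (0 < i <= (l a).+1)%N ->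
  mkX z u w (zvar a i) = z a i.
Proof. by case: i => // i ile; rewrite /= inordK. Qed.

Lemma zvar_val (s : {a : 'I_m & 'I_(l a).+1}) : inl s = zvar (tag s) (tagged s).+1 :> T.
Proof. by case: s => a i; rewrite /zvar /= inord_val. Qed.

Lemma XvarP (P : T -> Prop) : (forall a i, (0 < i <= (l a).+1)%N -> P (zvar a i)) ->
  P (inr true) -> P (inr false) -> forall t, P t.
Proof. by move=> Pz Pu Pw [s|[]] //; rewrite zvar_val; apply: Pz; rewrite ltn_ord. Qed.

Definition zof (R : Type) (v : T -> R) a i := v (zvar a i).

Definition fiber_eqs := (range (eqF eta) `|` [set eqG eta]).

Lemma fiber_eqsP (R : algebra kappa) (v : T -> R) :
  (forall q, fiber_eqs q -> ev R v q = 0) <->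
  (forall a, continuant (zof v a) (l a).+1 = alg_in R (lambda eta a) * v (inr true)) /\
  v (inr true) * v (inr false) = \prod_a continuant (zof v a) (l a) + alg_in R (mu eta).
Proof.
have evc a n : ev R v (continuant (Xz eta a) n) = continuant (zof v a) n.
  by rewrite rmorph_continuant; apply: eq_continuant => i _ /=; rewrite ev_pvar.
have evF a : ev R v (eqF eta a) =
    continuant (zof v a) (l a).+1 - alg_in R (lambda eta a) * v (inr true).
  by rewrite rmorphB; congr (_ - _); [exact: evc|rewrite /= evZ ev_pvar].
have evG : ev R v (eqG eta) = v (inr true) * v (inr false)
    - (\prod_a continuant (zof v a) (l a) + alg_in R (mu eta)).
  rewrite !rmorphB rmorphM rmorph_prod /= !ev_pvar evC opprD addrA.
  by congr (_ - _ - _); apply: eq_bigr => a _; exact: evc.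
split=> [H|[HF HG] q [[a _ <-]|->]].
- split=> [a|]; apply/eqP; rewrite -subr_eq0; first by rewrite -evF H //; left; exists a.
  by rewrite -evG H //; right.
- by rewrite evF HF subrr.
by rewrite evG HG subrr.
Qed.

Lemma mkX_eqs (R : algebra kappa) (z : 'I_m -> nat -> R) u w :
  (forall a, continuant (z a) (l a).+1 = alg_in R (lambda eta a) * u) ->
  u * w = \prod_a continuant (z a) (l a) + alg_in R (mu eta) ->
  forall q, fiber_eqs q -> ev R (mkX z u w) q = 0.
Proof.
have e a n : (n <= (l a).+1)%N -> continuant (zof (mkX z u w) a) n = continuant (z a) n.
  by move=> nl; apply: eq_continuant => i ile; rewrite /zof mkX_z //; lia.
move=> HF HG; apply/fiber_eqsP; split=> [a|]; first by rewrite e // HF.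
by rewrite /= HG; congr (_ + _); apply: eq_bigr => a _; rewrite e.
Qed.

Lemma lambda_neq0 a : lambda eta a != 0.
Proof. by rewrite invr_eq0; apply: FiberEmbedding.r_neq0. Qed.

Lemma mu_neq0 : mu eta != 0.
Proof. by rewrite FiberEmbedding.muE invr_eq0 FiberEmbedding.cc_neq0. Qed.

End FiberPoints.

Lemma alg_unit (k : fieldType) (A : algebra k) c : c != 0 -> is_unit (alg_in A c).
Proof. by move=> c0; apply: (is_unit_rmorph (alg_in A) (field_unit c0)). Qed.

Lemma alg_inV (k : fieldType) (A : algebra k) c x : c != 0 ->
  alg_in A c * (alg_in A c^-1 * x) = x.
Proof. by move=> c0; rewrite mulrA -rmorphM mulfV // rmorph1 mul1r. Qed.

Lemma alg_inVK (k : fieldType) (A : algebra k) c x : c != 0 ->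
  alg_in A c^-1 * (alg_in A c * x) = x.
Proof. by move=> c0; rewrite mulrA -rmorphM mulVf // rmorph1 mul1r. Qed.

(** * Charts of the fiber *)

Section RegularCharts.
Variables (K : fieldType) (m : nat) (l : 'I_m -> nat) (eta : spec (Kc K l)).
Local Notation kappa := (residue_field eta).
Local Notation T := (Xvar l).
Variables (S : algebra kappa) (v : T -> S) (p : spec {mpoly kappa[#|T|]}).
Hypothesis P : isloc p (ideal_gen (@fiber_eqs K m l eta)) (ev S v).
Local Notation vz := (zof v).
Local Notation vu := (v (inr true)).
Local Notation vw := (v (inr false)).

Lemma fiber_coords :
  (forall a, continuant (vz a) (l a).+1 = alg_in S (lambda eta a) * vu) /\
  vu * vw = \prod_a continuant (vz a) (l a) + alg_in S (mu eta).
Proof.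
apply/fiber_eqsP => q Eq; apply: (isloc_ker P q).2; exists 1; rewrite ?mul1r //; first exact: point1.
by move=> J; apply.
Qed.

Lemma eq_mkX (R : algebra kappa) (h : {rmorphism R -> S}) z u w :
  (forall a i, (0 < i <= (l a).+1)%N -> h (z a i) = vz a i) -> h u = vu -> h w = vw ->
  forall t, h (mkX z u w t) = v t.
Proof. by move=> hz hu hw; apply: XvarP => // a i ile; rewrite mkX_z // hz. Qed.

Lemma h_prod (R : algebra kappa) (h : {rmorphism R -> S}) (z : 'I_m -> nat -> R) (Q : pred 'I_m) :
  (forall a i, (0 < i <= l a)%N -> h (z a i) = vz a i) ->
  h (\prod_(a | Q a) continuant (z a) (l a)) = \prod_(a | Q a) continuant (vz a) (l a).
Proof.
move=> hz; rewrite rmorph_prod; apply: eq_bigr => a _; rewrite rmorph_continuant.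
by apply: eq_continuant => i il; exact: hz.
Qed.

(** Ray [a0] keeps all its coordinates and F_(a0) defines u; this is how one critical ray is
    tolerated. *)
Lemma regular_u_unit (a0 : 'I_m) : is_unit vu ->
  (forall a, a != a0 -> exists2 i, (0 < i <= (l a).+1)%N & is_unit (dcont (vz a) i (l a).+1)) ->
  regular_local S.
Proof.
move=> uu ia; have [eF eG] := fiber_coords.
have /choice[i iP] : forall a, exists i, a != a0 ->
    (0 < i <= (l a).+1)%N /\ is_unit (dcont (vz a) i (l a).+1).
  by move=> a; have [->|/ia[i]] := eqVneq a a0; [exists 0%N|exists i].
pose kept (t : T) := if t is inl s then (tag s == a0) || ((tagged s).+1 != i (tag s)) else false.
apply: (regular_chart P (kept := kept)) => R h tau hk hl htau.
have htz a j : (0 < j <= (l a).+1)%N -> (a == a0) || (j != i a) -> h (zof tau a j) = vz a j.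
  by case: j => // j jl kj; apply: htau; rewrite /= inordK.
pose u := alg_in R (lambda eta a0)^-1 * continuant (zof tau a0) (l a0).+1.
have l0 := lambda_neq0 eta.
have hu : h u = vu.
  rewrite rmorphM hk rmorph_continuant (@eq_continuant _ _ (vz a0)) => [|j jl]; last first.
    by apply: htz; rewrite ?eqxx.
  by rewrite eF mulrA -rmorphM mulVf // rmorph1 mul1r.
have uR : is_unit u by apply: hl; rewrite hu.
pose z a := if a == a0 then zof tau a else solve (zof tau a) (i a) (l a).+1 (alg_in R (lambda eta a) * u).
have zP a : continuant (z a) (l a).+1 = alg_in R (lambda eta a) * u /\
    forall j, (0 < j <= (l a).+1)%N -> h (z a j) = vz a j.
  rewrite /z; case: eqP => [->|/eqP ne].
    by rewrite alg_inV //; split=> // j jl; apply: htz; rewrite ?eqxx.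
  have [il iu] := iP a ne; apply: local_solve => //; last by rewrite rmorphM hk hu.
  by move=> j jl ji; apply: htz; rewrite // ji orbT.
pose w := (\prod_a continuant (z a) (l a) + alg_in R (mu eta)) * cinv u.
exists (mkX z u w); split.
- elim/XvarP => [a j jl||] //; rewrite mkX_z // /= inordK //; last by case: j jl.
  rewrite prednK; last by case/andP: jl.
  by rewrite /z; case: ifP => //= _ ji; rewrite solve_neq.
- apply: eq_mkX => // [a j|]; first by case: (zP a) => _; apply.
  rewrite rmorphM rmorph_cinv // hu rmorphD hk h_prod => [|a j jl]; last by apply: (zP a).2; lia.
  by rewrite -eG mulrAC cinvP // mul1r.
apply: mkX_eqs => [a|]; first by case: (zP a).
by rewrite mulrC -mulrA (mulrC (cinv u)) cinvP // mulr1.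
Qed.

(* The last z of a ray enters F_a with coefficient P_(l a), a unit here, so it is eliminated. *)
Lemma regular_chart_last (kept : pred T) :
  (forall a, is_unit (continuant (vz a) (l a))) -> (forall a, ~~ kept (zvar l a (l a).+1)) ->
  (forall (R : algebra kappa) (h : {rmorphism R -> S}) (tau : T -> R), alg_hom h -> local_hom h ->
    (forall t, kept t -> h (tau t) = v t) ->
    exists z u w, [/\ forall a i, (0 < i <= l a)%N -> h (z a i) = vz a i /\
        (kept (zvar l a i) -> z a i = zof tau a i),
      h u = vu /\ (kept (inr true) -> u = tau (inr true)),
      h w = vw /\ (kept (inr false) -> w = tau (inr false)) &
      u * w = \prod_a continuant (z a) (l a) + alg_in R (mu eta)]) ->
  regular_local S.
Proof.
move=> Pu klast H; have [eF eG] := fiber_coords.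
apply: (regular_chart P (kept := kept)) => R h tau hk hl htau.
have [z [u [w [hz [hu ku] [hw kw] e]]]] := H R h tau hk hl htau.
pose z' a := solve (z a) (l a).+1 (l a).+1 (alg_in R (lambda eta a) * u).
have z'E a i : (0 < i <= l a)%N -> z' a i = z a i by move=> il; apply: solve_neq; lia.
have z'P a : continuant (z' a) (l a).+1 = alg_in R (lambda eta a) * u /\
    forall j, (0 < j <= (l a).+1)%N -> h (z' a j) = vz a j.
  apply: local_solve => //; [by rewrite leqnn| |by rewrite dcont_last|by rewrite rmorphM hk hu].
  by move=> j jl jn; apply: (hz a j _).1; lia.
exists (mkX z' u w); split.
- elim/XvarP => [a j jl kj||] //; rewrite mkX_z //.
  have [ej|nj] := eqVneq j (l a).+1; first by rewrite ej (negPf (klast a)) in kj.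
  have jl' : (0 < j <= l a)%N by lia.
  by rewrite z'E // (hz a j jl').2.
- by apply: eq_mkX => // a j; apply: (z'P a).2.
apply: mkX_eqs => [a|]; first by case: (z'P a).
rewrite e; congr (_ + _); apply: eq_bigr => a _; apply: eq_continuant => i il.
by rewrite z'E.
Qed.

Lemma regular_w_unit : (forall a, is_unit (continuant (vz a) (l a))) -> is_unit vw ->
  regular_local S.
Proof.
move=> Pu uw; have [eF eG] := fiber_coords.
pose kept (t : T) := match t with inl s => (tagged s < l (tag s))%N | inr b => ~~ b end.
apply: (@regular_chart_last kept) => // [a|R h tau hk hl htau]; first by rewrite /= inordK ?ltnn.
have htz a i : (0 < i <= l a)%N -> h (zof tau a i) = vz a i.
  by case: i => // i il; apply: htau; rewrite /= inordK //; lia.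
have hw : h (tau (inr false)) = vw by apply: htau.
have uR : is_unit (tau (inr false)) by apply: hl; rewrite hw.
pose u := (\prod_a continuant (zof tau a) (l a) + alg_in R (mu eta)) * cinv (tau (inr false)).
exists (zof tau), u, (tau (inr false)); split=> //.
- by move=> a i il; rewrite htz.
- split=> //; rewrite rmorphM rmorph_cinv // hw rmorphD hk h_prod // -eG.
  by rewrite -mulrA cinvP // mulr1.
by rewrite -mulrA (mulrC (cinv _)) cinvP // mulr1.
Qed.

Lemma regular_dcont_unit a0 i0 : (forall a, is_unit (continuant (vz a) (l a))) ->
  (0 < i0 <= l a0)%N -> is_unit (dcont (vz a0) i0 (l a0)) -> regular_local S.
Proof.
move=> Pu il0 du; have [eF eG] := fiber_coords.
pose kept (t : T) := match t with
  | inl s => (tagged s < l (tag s))%N && ((tag s != a0) || ((tagged s).+1 != i0))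
  | inr b => true end.
apply: (@regular_chart_last kept) => // [a|R h tau hk hl htau]; first by rewrite /= inordK ?ltnn.
have htz a i : (0 < i <= l a)%N -> (a != a0) || (i != i0) -> h (zof tau a i) = vz a i.
  case: i => // i il ki; apply: htau; rewrite /= inordK //; last by lia.
  by apply/andP; split=> //; lia.
have hu : h (tau (inr true)) = vu by apply: htau.
have hw : h (tau (inr false)) = vw by apply: htau.
pose Q := \prod_(a | a != a0) continuant (zof tau a) (l a).
have hQ : h Q = \prod_(a | a != a0) continuant (vz a) (l a).
  rewrite rmorph_prod; apply: eq_bigr => a na; rewrite rmorph_continuant.
  by apply: eq_continuant => i il /=; apply: htz; rewrite ?na.
have Qu : is_unit Q by apply: hl; rewrite hQ; apply: is_unit_prod.
(* The value of P_(l a0) forced by G, since the other rays contribute the unit [Q]. *)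
pose y := cinv Q * (tau (inr true) * tau (inr false) - alg_in R (mu eta)).
have hy : continuant (vz a0) (l a0) = h y.
  rewrite rmorphM rmorph_cinv // rmorphB rmorphM hk hu hw eG addrK (bigD1 a0) //= -hQ.
  by rewrite mulrCA (mulrC (cinv _)) cinvP ?mulr1 //; exact: is_unit_rmorph.
have [] := @local_solve _ _ h (zof tau a0) (vz a0) i0 (l a0) y hl il0 _ du hy.
  by move=> j jl ji; apply: htz; rewrite ?ji ?orbT.
set z0 := solve _ _ _ _ => e0 hz0.
pose z a := if a == a0 then z0 else zof tau a.
exists z, (tau (inr true)), (tau (inr false)); split=> //.
- move=> a i il; rewrite /z; case: eqP => [ea|/eqP na]; last first.
    by rewrite htz ?na.
  subst a; split; first exact: hz0.
  case: i il => // i il; rewrite /= inordK ?eqxx; last by lia.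
  by case/andP => _ ii; rewrite /z0 solve_neq.
rewrite (bigD1 a0) //= {1}/z eqxx e0.
rewrite [X in _ = _ * X + _](_ : _ = Q); last by apply: eq_bigr => a /negPf na; rewrite /z na.
by rewrite mulrAC (mulrC (cinv Q)) cinvP // mul1r subrK.
Qed.

End RegularCharts.

(** * Normal forms of a single ray *)

Section Blocks.
Variables (k : fieldType) (S : algebra k).

(* The forms g_a, with t_(2i-1), t_(2i) at the positions 2i + 1, 2i + 2 (i < q). *)
Definition gsum (R : comPzRingType) q (t : nat -> R) := \sum_(i < q) t i.*2.+1 * t i.*2.+2.

Lemma rmorph_gsum (R R' : comPzRingType) (f : {rmorphism R -> R'}) q t :
  f (gsum q t) = gsum q (f \o t).
Proof. by rewrite rmorph_sum; apply: eq_bigr => i _; rewrite rmorphM. Qed.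

Lemma eq_gsum (R : comPzRingType) q (t t' : nat -> R) :
  (forall j, (0 < j <= q.*2)%N -> t j = t' j) -> gsum q t = gsum q t'.
Proof. by move=> tt; apply: eq_bigr => i _; rewrite !tt //; have := ltn_ord i; lia. Qed.

Lemma gsum_upd (R : comPzRingType) q (t : nat -> R) y : (0 < q)%N ->
  gsum q (upd t 2 y) = t 1%N * y + gsum q (upd t 2 0).
Proof.
case: q => // q _; rewrite /gsum !big_ord_recl /= /upd /= mulr0 add0r; congr (_ + _).
Qed.

(* A block with continuant [c * uS], to be compared with a form equal to [uS - u0]. *)
Definition block_chart (q : nat) (c u0 : k) (v : nat -> S) (uS : S) (t : nat -> S) :=
  gsum q t = uS - alg_in S u0 /\
  forall (R : algebra k) (h : {rmorphism R -> S}) (tau : nat -> R) (u : R),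
    alg_hom h -> local_hom h -> (forall j, (0 < j <= q.*2)%N -> h (tau j) = t j) ->
    gsum q tau = u - alg_in R u0 ->
    exists z : nat -> R, [/\ continuant z q.*2 = alg_in R c * u,
      forall j, (0 < j <= q.*2)%N -> h (z j) = v j &
      forall f : {rmorphism S -> R}, alg_hom f -> (forall j, (0 < j <= q.*2)%N -> f (v j) = z j) ->
        f uS = u -> forall j, (0 < j <= q.*2)%N -> f (t j) = tau j].

Lemma alg_in_sign (A : algebra k) j : alg_in A ((-1) ^+ j) = (-1) ^+ j.
Proof. by rewrite rmorphXn rmorphN1. Qed.

(** At a critical ray the pairs are the P_(2j+1), rescaled, and the z_(2j+2). The condition (-1)^q =
    c u0 identifies the constant term of P_(2q) / c with u0. *)
Lemma crit_block (Sloc : is_local S) q (c u0 : k) (v : nat -> S) (uS : S) :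
  c != 0 -> continuant v q.*2 = alg_in S c * uS -> (-1) ^+ q = c * u0 ->
  (forall j, (0 < j <= q.*2)%N -> ~ is_unit (v j)) ->
  exists t, block_chart q c u0 v uS t /\ forall j, (0 < j <= q.*2)%N -> ~ is_unit (t j).
Proof.
move=> c0 ev eu0 nuv.
have vu j : (j < q)%N -> is_unit (continuant v j.*2).
  by move=> jq; apply: (local_zero_unit Sloc) => [i ij|]; [apply: nuv; lia|rewrite odd_double].
(* The coefficient of z_(2j+2) P_(2j+1) in P_(2q) / c, by [continuant_even]. *)
pose d j : k := c^-1 * (-1) ^+ (q + j.+1).
have d0 j : d j != 0 by rewrite mulf_neq0 ?invr_eq0 // signr_eq0.
pose t j := if odd j then alg_in S (d j./2) * continuant v j else v j.
have evq (A : algebra k) (z : nat -> A) u : gsum q (fun j => if odd j then alg_in A (d j./2) * continuant z j else z j)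
      = u - alg_in A u0 <-> continuant z q.*2 = alg_in A c * u.
  have -> : gsum q (fun j => if odd j then alg_in A (d j./2) * continuant z j else z j) =
      alg_in A (c^-1) * continuant z q.*2 - alg_in A u0.
    have -> : u0 = c^-1 * (-1) ^+ q by rewrite eu0 mulKf.
    have -> : continuant z q.*2 = (-1) ^+ q * ((-1) ^+ q * continuant z q.*2).
      by rewrite mulrA -expr2 sqrr_sign mul1r.
    rewrite continuant_even rmorphM alg_in_sign mulrDr mulr1 mulrDr addrAC subrr add0r.
    rewrite /gsum !mulr_sumr; apply: eq_bigr => j _.
    rewrite /= !negbK odd_double /= uphalf_double /d rmorphM alg_in_sign exprD; ring.
  split=> [/addIr <-|->]; first by rewrite alg_inV.
  by rewrite mulrA -rmorphM mulVf // rmorph1 mul1r.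
exists t; split; last first.
  move=> j jq; rewrite /t; case: ifP => oj; last exact: nuv.
  have nz i : (0 < i <= j)%N -> ~ is_unit (v i) by move=> ij; apply: nuv; lia.
  by move=> /is_unit_mulP[_]; have := local_zero Sloc nz; rewrite oj subr0.
split; first exact/evq.
move=> R h tau u hk hl htau etau.
pose T j := tau j.*2.+2; pose W j := alg_in R (d j)^-1 * tau j.*2.+1.
have hT j : (j < q)%N -> h (T j) = v j.*2.+2.
  by move=> jq; rewrite htau ?/t /= ?negbK ?odd_double //; lia.
have hW j : (j < q)%N -> h (W j) = continuant v j.*2.+1.
  move=> jq; rewrite rmorphM hk htau ?/t; last by lia.
  by rewrite [odd _]/= odd_double /= uphalf_double mulrA -rmorphM mulVf // rmorph1 mul1r.
have [zT zW hz] := local_rebuild hl vu hT hW.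
have ztau j : (0 < j <= q.*2)%N ->
    tau j = (if odd j then alg_in R (d j./2) * continuant (rebuild T W) j else rebuild T W j).
  have [i [b ->]] : exists i (b : bool), j = (b + i.*2)%N by exists j./2, (odd j); rewrite odd_double_half.
  rewrite oddD odd_double addbF oddb half_bit_double; case: b => iq.
    by rewrite add1n zW ?alg_inV //; lia.
  by case: i iq => // i iq; rewrite add0n doubleS zT //; lia.
exists (rebuild T W); split=> //.
  by apply/evq; rewrite -etau; apply: eq_gsum => j jq; rewrite -ztau.
move=> f fk fv fu j jq; rewrite ztau // /t; case: ifP => oj; last exact: fv.
rewrite rmorphM fk rmorph_continuant; congr (_ * _); apply: eq_continuant => i ij.
by apply: fv; lia.
Qed.

(* The e-th position in 1, 2, ... other than i. *)
Definition skip i e := (bump i.-1 e).+1.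
Definition unskip i j := unbump i.-1 j.-1.

Lemma skipP i e n : (0 < i <= n.+1)%N -> (e < n)%N ->
  [/\ (0 < skip i e <= n.+1)%N, skip i e != i & unskip i (skip i e) = e].
Proof.
move=> il en; rewrite /skip /unskip /= bumpK; split=> //; rewrite /bump; case: leqP; lia.
Qed.

Lemma unskipP i j n : (0 < i <= n.+1)%N -> (0 < j <= n.+1)%N -> j != i ->
  (unskip i j < n)%N /\ skip i (unskip i j) = j.
Proof.
move=> il jl ji; have e : skip i (unskip i j) = j.
  by rewrite /skip /unskip unbumpKcond; case: eqP; lia.
by split=> //; move: e; rewrite /skip /bump; case: leqP; lia.
Qed.

Lemma free_chart n (v : nat -> S) i c (uS : S) : (0 < i <= n.+1)%N ->
  is_unit (dcont v i n.+1) -> continuant v n.+1 = alg_in S c * uS ->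
  forall (R : algebra k) (h : {rmorphism R -> S}) (tau : nat -> R) (u : R),
    alg_hom h -> local_hom h -> (forall e, (e < n)%N -> h (tau e) = v (skip i e)) -> h u = uS ->
    exists z : nat -> R, [/\ continuant z n.+1 = alg_in R c * u,
      forall j, (0 < j <= n.+1)%N -> h (z j) = v j &
      forall e, (e < n)%N -> z (skip i e) = tau e].
Proof.
move=> il du ev R h tau u hk hl htau hu.
have hz0 j : (0 < j <= n.+1)%N -> j != i -> h ((tau \o unskip i) j) = v j.
  by move=> jl ji; have [un e] := unskipP il jl ji; rewrite /= htau // e.
have hcu : continuant v n.+1 = h (alg_in R c * u) by rewrite rmorphM hk hu.
have [ez hz] := local_solve hl il hz0 du hcu.
exists (solve (tau \o unskip i) i n.+1 (alg_in R c * u)); split=> // e en.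
by have [sl si us] := skipP il en; rewrite solve_neq //= us.
Qed.

(** At a non-critical ray, u and all z but z_i are free coordinates. The latter become the t other
    than t_2, with t_1 made a unit; then u and t_2 determine each other through g(t) = u - u0. *)
Lemma free_block (Sloc : is_local S) q (c u0 : k) (v : nat -> S) (uS : S) i :
  (0 < q)%N -> (0 < i <= q.*2)%N -> is_unit (dcont v i q.*2) ->
  continuant v q.*2 = alg_in S c * uS -> exists t, block_chart q c u0 v uS t.
Proof.
case: q => // q _; set n := (q.*2.+1)%N; rewrite doubleS -/n => il du ev.
(* In a local ring x or x + 1 is a unit, so a shift by 0 or 1 makes t_1 invertible. *)
have [del du1] : exists del : bool, is_unit (v (skip i 0) + del%:R).
  have [u1|nu1] := pselect (is_unit (v (skip i 0))); first by exists false; rewrite addr0.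
  exists true; apply: contrapT => nu; have [_ /(_ (v (skip i 0) + 1) (- v (skip i 0)) nu)] := Sloc.
  rewrite addrC addKr; apply; last exact: is_unit1.
  by move/is_unitN; rewrite opprK.
have i2 : (0 < 2 <= n.+1)%N by rewrite /n; lia.
pose sh (R : comPzRingType) e : R := (e == 0%N)%:R * del%:R.
pose t0 j := v (skip i (unskip 2 j)) + sh S (unskip 2 j).
have t01 : t0 1%N = v (skip i 0) + del%:R by rewrite /t0 /sh /= mul1r.
(* The solution t_2 of g(t) = u - u0, in which t_2 occurs only in t_1 t_2. *)
pose y := cinv (t0 1%N) * (uS - alg_in S u0 - gsum q.+1 (upd t0 2 0)).
have du1' : is_unit (t0 1%N) by rewrite t01.
exists (upd t0 2 y); split.
  by rewrite gsum_upd // /y mulrA cinvP // mul1r subrK.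
move=> R h tau u hk hl htau etau.
have fr e : (e < n)%N -> upd t0 2 y (skip 2 e) = v (skip i e) + sh S e.
  by move=> en; have [_ /negPf s2 us] := skipP i2 en; rewrite /upd s2 /t0 us.
have hsh e : h (sh R e) = sh S e by rewrite rmorphM !rmorph_nat.
have hu : h u = uS.
  have : h (gsum q.+1 tau) = h (u - alg_in R u0) by rewrite etau.
  rewrite rmorphB hk rmorph_gsum (@eq_gsum _ _ _ (upd t0 2 y)) // gsum_upd // /y mulrA cinvP //.
  by rewrite mul1r subrK => /addIr.
have htau' e : (e < n)%N -> h (tau (skip 2 e) - sh R e) = v (skip i e).
  move=> en; have [sl _ _] := skipP i2 en.
  by rewrite rmorphB hsh htau ?doubleS // fr // addrK.
have [z [ez hz zs]] := @free_chart n v i c uS il du ev R h (fun e => tau (skip 2 e) - sh R e) u hk hl htau' hu.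
exists z; split=> // f fk fv fu.
have fsh e : f (sh S e) = sh R e by rewrite rmorphM !rmorph_nat.
have ft0 j : (0 < j <= n.+1)%N -> j != 2 -> f (t0 j) = tau j.
  move=> jl j2; have [ul us] := unskipP i2 jl j2; have [sl _ _] := skipP il ul.
  by rewrite rmorphD fsh fv // zs // us subrK.
have utau : is_unit (tau 1%N) by rewrite -ft0 //; exact: is_unit_rmorph.
move=> j jl; have [->|j2] := eqVneq j 2; last by rewrite /upd (negPf j2) ft0.
rewrite /upd eqxx rmorphM rmorph_cinv // ft0 //.
rewrite !rmorphB fu fk -etau rmorph_gsum.
have -> : gsum q.+1 (f \o upd t0 2 0) = gsum q.+1 (upd tau 2 0).
  apply: eq_gsum => l; rewrite doubleS -/n => ll; rewrite /= /upd.
  by case: eqP => [_|/eqP l2]; [exact: rmorph0|exact: ft0].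
have -> : gsum q.+1 tau = gsum q.+1 (upd tau 2 (tau 2)).
  by apply: eq_gsum => l _; rewrite /upd; case: eqP => [->|].
by rewrite [gsum q.+1 (upd tau 2 (tau 2))]gsum_upd // addrK mulrA (mulrC (cinv _)) cinvP // mul1r.
Qed.

End Blocks.

(** * The chart onto the cylinder *)

Section CylinderChart.
Variables (K : fieldType) (m : nat) (l : 'I_m -> nat) (eta : spec (Kc K l)).
Local Notation kappa := (residue_field eta).
Local Notation T := (Xvar l).

(* The set A of rays through the centre u = u0 with critical value, and the
   cylinder attached to it: rays outside A contribute free coordinates. *)
Variables (A : {set 'I_m}) (u0 : kappa).

Definition ray (j : 'I_#|A|) : 'I_m := enum_val j.
Definition half_len (j : 'I_#|A|) := (l (ray j)).+1./2.
Definition free_var : finType := {s : {a : 'I_m & 'I_(l a)} | tag s \notin A}.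
Local Notation Y := (cyl_var half_len #|free_var|).
Definition cyl_eqs : set {mpoly kappa[#|Y|]} :=
  [set p | exists a b, p = gform kappa half_len #|free_var| a - gform kappa half_len #|free_var| b].

Definition mkY (R : Type) (t : 'I_#|A| -> nat -> R) (s : 'I_m -> nat -> R) (y : Y) : R :=
  match y with
  | inl c => t (tag c) ((tagged c).1.*2 + (tagged c).2).+1
  | inr e => let x := val (enum_val e) in s (tag x) (tagged x)
  end.

Definition tof (R : pzRingType) (tau : Y -> R) (j : 'I_#|A|) (n : nat) : R :=
  if insub n.-1./2 is Some i then tau (tvar #|free_var| (i : 'I_(half_len j)) (odd n.-1)) else 0.

Definition sof (R : pzRingType) (tau : Y -> R) (a : 'I_m) (e : nat) : R :=
  if insub e is Some i then
    if (insub (@Tagged _ a (fun a => 'I_(l a)) i) : option free_var) is Some x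
    then tau (inr (enum_rank x)) else 0
  else 0.

Lemma mkY_id (R : pzRingType) (tau : Y -> R) : mkY (tof tau) (sof tau) =1 tau.
Proof.
case=> [[j [i b]]|e] /=.
  rewrite /tof /= addnC half_bit_double oddD odd_double addbF oddb.
  by case: insubP => [i' _ /val_inj -> //|]; rewrite ltn_ord.
case: (enum_val e) (enum_valK e) => [[a i] /= na] <-; rewrite /sof.
case: insubP => [i' _ /val_inj ->|]; last by rewrite ltn_ord.
by case: insubP => [x _ ex|]; [congr (tau (inr (enum_rank _))); apply: val_inj|rewrite na].
Qed.

Lemma gform_ev (R : algebra kappa) (tau : Y -> R) j :
  ev R tau (gform kappa half_len #|free_var| j) = gsum (half_len j) (tof tau j).
Proof.
rewrite rmorph_sum; apply: eq_bigr => i _; rewrite rmorphM /= !ev_pvar.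
have E (b : bool) : tof tau j (i.*2 + b).+1 = tau (tvar #|free_var| i b).
  by rewrite -[RHS]mkY_id.
by have := E false; rewrite addn0 => ->; have := E true; rewrite addn1 => ->.
Qed.

Variables (S : algebra kappa) (v : T -> S) (p : spec {mpoly kappa[#|T|]}).
Hypothesis P : isloc p (ideal_gen (@fiber_eqs K m l eta)) (ev S v).
Local Notation vz := (zof v).
Local Notation vu := (v (inr true)).
Local Notation vw := (v (inr false)).

Definition crit a := forall i, (0 < i <= (l a).+1)%N -> ~ is_unit (dcont (vz a) i (l a).+1).

Hypothesis u_unit : is_unit vu.
Variable (j0 : 'I_#|A|).
Hypothesis A_odd : forall a, a \in A -> odd (l a).
Hypothesis A_val : forall a, a \in A -> (-1) ^+ ((l a).+1)./2 = lambda eta a * u0.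
Hypothesis A_crit : forall a, crit a -> a \in A.

Lemma half_len_double j : (half_len j).*2 = (l (ray j)).+1.
Proof.
have := A_odd (enum_valP j); rewrite -/(ray j) => ol.
by rewrite -[RHS]odd_double_half /= ol.
Qed.

Lemma noncrit a : ~ crit a ->
  exists i, (0 < i <= (l a).+1)%N /\ is_unit (dcont (vz a) i (l a).+1).
Proof.
move=> nc; apply: contrapT => H; apply: nc => i il u.
by apply: H; exists i.
Qed.

Lemma ray_block j : exists t, block_chart (half_len j) (lambda eta (ray j)) u0 (vz (ray j)) vu t /\
  (crit (ray j) -> forall i, (0 < i <= (half_len j).*2)%N -> ~ is_unit (t i)).
Proof.
have [eF _] := fiber_coords P; have Sloc := isloc_local P.
have e2 := half_len_double j; have q0 : (0 < half_len j)%N by lia.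
have ev : continuant (vz (ray j)) (half_len j).*2 = alg_in S (lambda eta (ray j)) * vu by rewrite e2.
have [c|nc] := pselect (crit (ray j)).
  have [_ nz] := local_crit Sloc c.
  have [||t [tP tn]] := crit_block Sloc (lambda_neq0 eta (ray j)) ev (u0 := u0).
  - by apply: A_val; exact: enum_valP.
  - by move=> i; rewrite e2; exact: nz.
  by exists t.
have [i [il du]] := noncrit nc; rewrite -e2 in il du.
have [t tP] := free_block Sloc u0 q0 il du ev.
by exists t; split=> // c.
Qed.

(** The cylinder depends on [A] alone, not on which of its rays are critical at the point: these use
    [crit_block], the other rays of [A] use [free_block], and each ray outside [A] gives l a free
    coordinates. *)
Lemma cyl_chart : exists v' : Y -> S,
  isloc (pcomap (ev S v') (closed_point (isloc_local P))) (ideal_gen cyl_eqs) (ev S v') /\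
  forall j, crit (ray j) -> forall (i : 'I_(half_len j)) b, ~ is_unit (v' (tvar #|free_var| i b)).
Proof.
have [eF eG] := fiber_coords P.
have /choice[t tP] := ray_block.
have /choice[i iP] : forall a, exists i, a \notin A ->
    (0 < i <= (l a).+1)%N /\ is_unit (dcont (vz a) i (l a).+1).
  move=> a; have [aA|aA] := boolP (a \in A); first by exists 0%N.
  by have [|i iP] := @noncrit a; [move/A_crit; rewrite (negPf aA)|exists i].
pose v' := mkY t (fun a e => vz a (skip (i a) e)).
have v't j n : (0 < n <= (half_len j).*2)%N -> tof v' j n = t j n.
  move=> nl; rewrite /tof; case: insubP => [r _ er|]; last by rewrite -leqNgt; lia.
  rewrite /v' /= er; congr (t j _).
  by rewrite addnC odd_double_half prednK //; case/andP: nl.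
exists v'; split; last first.
  move=> j cj r b; have rb : (0 < (r.*2 + b).+1 <= (half_len j).*2)%N by have := ltn_ord r; case: b; lia.
  exact: (tP j).2 rb.
apply: (chart P) => [_ [a [b ->]]|R h tau hk hl tauE htau].
  rewrite rmorphB /= !gform_ev !(eq_gsum (v't _)).
  by rewrite ((tP a).1.1) ((tP b).1.1) subrr.
(* The cylinder has no coordinate u; its equations g_a = g_b make this value independent of [j0]. *)
pose u := gsum (half_len j0) (tof tau j0) + alg_in R u0.
have gu j : gsum (half_len j) (tof tau j) = u - alg_in R u0.
  rewrite /u addrK -!gform_ev; apply/eqP; rewrite -subr_eq0 -rmorphB; apply/eqP.
  by apply: tauE; exists j, j0.
have htof j n : (0 < n <= (half_len j).*2)%N -> h (tof tau j n) = t j n.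
  move=> nl; rewrite -v't // /tof; case: insubP => [r _ er|]; first exact: htau.
  by rewrite rmorph0.
have hu : h u = vu.
  rewrite rmorphD hk rmorph_gsum (eq_gsum (htof j0)).
  by rewrite ((tP j0).1.1) subrK.
have /choice[zA zAP] j := (tP j).1.2 R h (tof tau j) u hk hl (htof j) (gu j).
have /choice[zB zBP] : forall b, exists z : nat -> R, b \notin A ->
    [/\ continuant z (l b).+1 = alg_in R (lambda eta b) * u,
      forall j, (0 < j <= (l b).+1)%N -> h (z j) = vz b j &
      forall e, (e < l b)%N -> z (skip (i b) e) = sof tau b e].
  move=> b; have [bA|bA] := boolP (b \in A); first by exists (fun=> 0).
  have [il du] := iP b bA.
  have hs e : (e < l b)%N -> h (sof tau b e) = vz b (skip (i b) e).
    move=> el; rewrite /sof; case: insubP => [r _ er|]; last by rewrite el.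
    case: insubP => [x _ ex|]; last by rewrite bA.
    by rewrite htau /v' /= enum_rankK ex /= er.
  have [z zP] := free_chart il du (eF b) hk hl hs hu.
  by exists z.
pose a0 := ray j0; have a0A : a0 \in A := enum_valP j0.
pose z a := if a \in A then zA (enum_rank_in a0A a) else zB a.
have rayE a : a \in A -> ray (enum_rank_in a0A a) = a by exact: enum_rankK_in.
have zP a : continuant (z a) (l a).+1 = alg_in R (lambda eta a) * u /\
    forall j, (0 < j <= (l a).+1)%N -> h (z a j) = vz a j.
  rewrite /z; case: ifPn => aA; last by have [] := zBP a aA.
  have [e1 e2 _] := zAP (enum_rank_in a0A a).
  by rewrite half_len_double rayE // in e1 e2.
pose w := (\prod_a continuant (z a) (l a) + alg_in R (mu eta)) * cinv u.
have uR : is_unit u by apply: hl; rewrite hu.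
exists (mkX z u w); split.
- apply: mkX_eqs => [a|]; first by case: (zP a).
  by rewrite mulrC -mulrA (mulrC (cinv u)) cinvP // mulr1.
- apply: eq_mkX => // [a j|]; first by apply: (zP a).2.
  rewrite rmorphM rmorph_cinv // hu rmorphD hk (@h_prod K m l eta S v) => [|a j jl]; last by apply: (zP a).2; lia.
  by rewrite -eG mulrAC cinvP // mul1r.
move=> f fk fv y; rewrite -[tau y]mkY_id.
have fvz a j : (0 < j <= (l a).+1)%N -> f (vz a j) = z a j by move=> jl; rewrite fv mkX_z.
case: y => [[j [r b]]|e] /=.
  have rb : (0 < (r.*2 + b).+1 <= (half_len j).*2)%N by have := ltn_ord r; case: b; lia.
  have [e1 e2 /(_ f fk)] := zAP j; apply; [|exact: fv|exact: rb].
  move=> n; rewrite half_len_double => nl; rewrite fvz //.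
  by rewrite /z (enum_valP j) /ray (enum_valK_in a0A).
case: (enum_val e) => [[b r] /= bA].
have [il _] := iP b bA; have [sl _ _] := skipP il (ltn_ord r).
have [_ _ zs] := zBP b bA.
by rewrite fvz // /z (negPf bA) zs.
Qed.

End CylinderChart.

(** * The singular points *)

Section SquareIdeal.
Variables (A : comPzRingType) (p : spec A).

Lemma square0 : square p 0.
Proof. by exists 0%N, (fun=> 0), (fun=> 0); rewrite big_ord0; split=> [[]|[]|]. Qed.

Lemma squareD a b : square p a -> square p b -> square p (a + b).
Proof.
move=> [n [u [v [pu pv ->]]]] [n' [u' [v' [pu' pv' ->]]]].
exists (n + n')%N, (fun i => match split i with inl j => u j | inr j => u' j end),
  (fun i => match split i with inl j => v j | inr j => v' j end).
split=> [i|i|]; [by case: split|by case: split|].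
rewrite big_split_ord /=; congr (_ + _); apply: eq_bigr => i _.
  by rewrite (unsplitK (inl i)).
by rewrite (unsplitK (inr i)).
Qed.

Lemma squareM a b : square p b -> square p (a * b).
Proof.
move=> [n [u [v [pu pv ->]]]]; exists n, (fun i => a * u i), v; split=> [i||] //.
  exact: idealM.
by rewrite mulr_sumr; apply: eq_bigr => i _; rewrite mulrA.
Qed.

Definition square_ideal : ideal A := Ideal square0 squareD squareM.

Lemma square_mul a b : p a -> p b -> square_ideal (a * b).
Proof. by move=> pa pb; exists 1%N, (fun=> a), (fun=> b); rewrite big_ord1. Qed.

Lemma ideal_sum (I : ideal A) (X : Type) (r : seq X) (P : pred X) (F : X -> A) :
  (forall i, P i -> I (F i)) -> I (\sum_(i <- r | P i) F i).
Proof. by move=> IF; apply: (big_ind I) => [|a b|]; [exact: ideal0|exact: idealD|]. Qed.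

End SquareIdeal.

Lemma affine_singular (k : fieldType) (S : algebra k) (T : finType) (v : T -> S)
    (E : set {mpoly k[#|T|]}) p (P : isloc p (ideal_gen E) (ev S v)) :
  (forall q, E q -> square_ideal p q) -> (exists2 q, E q & q <> 0) -> ~ regular_local S.
Proof.
move=> E2 [q Eq q0]; apply: (singular_isloc P); last by exists q => // I; apply.
by move=> a /(_ (square_ideal p)); apply; exact: E2.
Qed.

Definition base_algebra (k : fieldType) : algebra k := @Algebra k k idfun.

Lemma gform_diff_neq0 (k : fieldType) n (q : 'I_n -> nat) d (j0 j1 : 'I_n) :
  (0 < q j0)%N -> j1 != j0 -> gform k q d j0 - gform k q d j1 <> 0.
Proof.
move=> q0 j10; pose tau (y : cyl_var q d) : base_algebra k :=
  if y is inl c then ((tag c == j0) && (val (tagged c).1 == 0%N))%:R else 0.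
have E j : ev (base_algebra k) tau (gform k q d j) =
    \sum_(i < q j) ((j == j0) && (val i == 0%N))%:R * ((j == j0) && (val i == 0%N))%:R.
  by rewrite rmorph_sum; apply: eq_bigr => i _; rewrite rmorphM /= !ev_pvar.
move/(f_equal (ev (base_algebra k) tau)); rewrite rmorphB rmorph0 /= !E.
rewrite [X in _ - X]big1 ?subr0 => [|i _]; last by rewrite (negPf j10) mul0r.
rewrite (bigD1 (Ordinal q0)) // big1 ?addr0 => [|i i0]; last first.
  by rewrite (negPf (_ : val i != 0%N)) ?andbF ?mul0r.
rewrite eqxx /= mulr1 addr0 => /eqP.
by rewrite oner_eq0.
Qed.

Section CylinderSingular.
Variables (K : fieldType) (m : nat) (l : 'I_m -> nat) (eta : spec (Kc K l)).
Local Notation kappa := (residue_field eta).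
Local Notation T := (Xvar l).

(** When [A] consists exactly of the critical rays, every t lies in the prime, so the equations of
    the cylinder lie in its square; two rays give one that is not zero. *)
Lemma cyl_singular (A : {set 'I_m}) (u0 : kappa) (S : algebra kappa) (v : T -> S)
    (p : spec {mpoly kappa[#|T|]}) :
  isloc p (ideal_gen (@fiber_eqs K m l eta)) (ev S v) -> is_unit (v (inr true)) ->
  (1 < #|A|)%N -> (forall a, a \in A -> odd (l a)) ->
  (forall a, a \in A -> (-1) ^+ ((l a).+1)./2 = lambda eta a * u0) ->
  (forall a, crit v a <-> a \in A) -> ~ regular_local S.
Proof.
move=> P uu A1 Ao Av Ac.
pose j0 : 'I_#|A| := Ordinal (ltnW A1); pose j1 : 'I_#|A| := Ordinal A1.
have [v' [Q nQ]] := cyl_chart P uu j0 Ao Av (fun a => (Ac a).1).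
set Y := (X in {mpoly kappa[#|X|]}) in Q.
have pt j (i : 'I_(half_len l j)) b :
    pcomap (ev S v') (closed_point (isloc_local P)) (pvar kappa (tvar #|free_var l A| i b)).
  rewrite pcomapE /= ev_pvar; apply: nQ; apply/Ac; exact: enum_valP.
apply: (affine_singular Q).
  move=> _ [a [b ->]]; rewrite -mulN1r; apply: idealD; last apply: idealM;
    by apply: ideal_sum => i _; apply: square_mul; exact: pt.
exists (gform kappa (@half_len m l A) #|free_var l A| j0 - gform kappa (@half_len m l A) #|free_var l A| j1).
  by exists j0, j1.
by apply: gform_diff_neq0 => //; have := half_len_double Ao j0; lia.
Qed.

End CylinderSingular.

(** * Isomorphic local rings have isomorphic completions *)

Section CompletionIso.

Lemma ideal_pow_sub (R R' : comPzRingType) (h : {rmorphism R -> R'}) (I : ideal R) (I' : ideal R') :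
  (forall a, I a -> I' (h a)) -> forall k a, ideal_pow I k a -> ideal_pow I' k (h a).
Proof.
move=> II' k; elim: k => [|k IHk] a /=; first by move=> _ J; apply.
move/(_ (comap h (ideal_pow I' k.+1))); apply=> _ [b [c [Ib Ic ->]]].
rewrite /= /comap_set /= rmorphM => J; apply; exists (h b), (h c).
by split; [exact: II'|exact: IHk|].
Qed.

Definition completion_map_ex (R R' : comPzRingType) (h : {rmorphism R -> R'}) (I : ideal R)
    (I' : ideal R') : (forall a, I a -> I' (h a)) ->
  exists H : {rmorphism completion I -> completion I'},
    forall a k r, compl_val a k = qclass (ideal_pow I k) r ->
      compl_val (H a) k = qclass (ideal_pow I' k) (h r).
Proof.
move=> II'; have sub k := ideal_pow_sub II' (k := k).
have co (a : completion I) : coherent (fun k => qmap (sub k) (compl_val a k)).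
  by move=> k; have [r [e1 e2]] := compl_coherent a k; exists (h r); rewrite e1 e2 !qmapE.
pose H a := Completion (co a).
have HB : zmod_morphism H by move=> a b; apply: compl_eq => k; rewrite /= rmorphB.
have HM : monoid_morphism H.
  split=> [|a b]; apply: compl_eq => k; rewrite /=; last exact: rmorphM.
  by rewrite qmapE rmorph1.
have [f fH] := rmorphP HB HM; exists f => a k r e.
by rewrite fH /= e qmapE.
Qed.

Lemma completion_iso (R R' : comPzRingType) (h : {rmorphism R -> R'}) (I : ideal R)
    (I' : ideal R') : bijective h -> (forall a, I a <-> I' (h a)) ->
  exists H : {rmorphism completion I -> completion I'}, bijective H /\
    forall r, H (to_compl I r) = to_compl I' (h r).
Proof.
move=> [g hK gK] II'.
have gB : zmod_morphism g by move=> a b; rewrite -{1}(gK a) -{1}(gK b) -rmorphB hK.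
have gM : monoid_morphism g.
  by split=> [|a b]; [rewrite -(rmorph1 h) hK|rewrite -{1}(gK a) -{1}(gK b) -rmorphM hK].
have [g' g'E] := rmorphP gB gM.
have [H HE] := completion_map_ex (fun a => (II' a).1).
have [G GE] : exists G : {rmorphism completion I' -> completion I},
    forall a k r, compl_val a k = qclass (ideal_pow I' k) r ->
      compl_val (G a) k = qclass (ideal_pow I k) (g' r).
  by apply: completion_map_ex => a; rewrite g'E => I'a; apply/II'; rewrite gK.
exists H; split; last by move=> r; apply: compl_eq => k; rewrite (HE _ k r).
exists G => a; apply: compl_eq => k; have [r er] := qclassP (compl_val a k).
  by rewrite (GE _ k (h r)) ?g'E ?hK ?er //; exact: HE.
by rewrite (HE _ k (g' r)) ?g'E ?gK ?er // -g'E; exact: GE.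
Qed.

Lemma completed_stalk_iso (k : fieldType) (A B : algebra k) (x : spec A) (y : spec B) :
  alg_iso (stalk x) (stalk y) -> alg_iso (completed_stalk x) (completed_stalk y).
Proof.
move=> [h [hb hk]]; have [g hK gK] := hb.
have mE a : max_ideal x a <-> max_ideal y (h a).
  rewrite !max_setE; split=> nu u; apply: nu; last exact: is_unit_rmorph.
  case: u => b eb; exists (g b); apply: (can_inj hK).
  by rewrite rmorphM gK eb rmorph1.
have [H [Hb HE]] := completion_iso hb mE.
by exists H; split=> // c; rewrite /= HE; congr (to_compl _ _); exact: hk.
Qed.

End CompletionIso.

Lemma big_ltS (R : Type) (idx : R) (op : Monoid.com_law idx) m (a : 'I_m) (F : 'I_m -> R) :
  \big[op/idx]_(b < m | (b < a.+1)%N) F b = op (\big[op/idx]_(b < m | (b < a)%N) F b) (F a).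
Proof.
rewrite (bigD1 a) //= Monoid.mulmC; congr (op _ _); apply: eq_bigl => b.
by rewrite ltnS [RHS]ltn_neqAle andbC.
Qed.

Arguments big_ltS {R idx op m} a F.

Lemma big_lt_all (R : Type) (idx : R) (op : Monoid.law idx) m (F : 'I_m -> R) :
  \big[op/idx]_(b < m | (b < m)%N) F b = \big[op/idx]_(b < m) F b.
Proof. by apply: eq_bigl => b; rewrite ltn_ord. Qed.

Arguments big_lt_all {R idx op m} F.

(** * The hyperquadric at the origin *)

Section QuadricCoordinates.
Variables (k : fieldType) (m : nat) (hl : 'I_m -> nat).

Definition pair_index : finType := {a : 'I_m & 'I_(hl a)}.
(** One pair (u, w) and one pair for each element of [pair_index] make [qdim + 1] variables. Being
    odd, [qdim] selects the form of [quadric] without a square. *)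
Definition qdim := (#|pair_index|.*2).+1.

(** Index [i] belongs to pair [i./2]: pair 0 is (u, w), and pair r + 1 is attached to the r-th
    element of [pair_index]. *)
Definition mkQ (R : pzRingType) (u w : R) (te to : 'I_m -> nat -> R) (i : 'I_qdim.+1) : R :=
  if i./2 is r.+1 then
    if insub r is Some r' then
      let s := enum_val (r' : 'I_#|pair_index|) in
      if odd i then to (tag s) (tagged s) else te (tag s) (tagged s)
    else 0
  else if odd i then w else u.

Definition qpos (a : 'I_m) (i : 'I_(hl a)) (b : bool) : 'I_qdim.+1 :=
  inord ((enum_rank (@Tagged _ a (fun a => 'I_(hl a)) i)).+1.*2 + b).

Definition qcoord (R : pzRingType) (tau : 'I_qdim.+1 -> R) b (a : 'I_m) (j : nat) : R :=
  if insub j is Some i then tau (@qpos a i b) else 0.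

Lemma qpos_val a i b : val (@qpos a i b) =
  ((enum_rank (@Tagged _ a (fun a => 'I_(hl a)) i)).+1.*2 + b)%N.
Proof.
rewrite /= inordK //; have : (enum_rank (Tagged (fun a => 'I_(hl a)) i) < #|pair_index|)%N by exact: ltn_ord.
by move: (nat_of_ord (enum_rank _)); rewrite /qdim; move: #|pair_index| => N r; case: b; lia.
Qed.

Lemma mkQ_id (R : pzRingType) (tau : 'I_qdim.+1 -> R) :
  mkQ (tau (inord 0)) (tau (inord 1)) (qcoord tau false) (qcoord tau true) =1 tau.
Proof.
move=> i; rewrite /mkQ; have ei := odd_double_half i.
case e : i./2 ei => [|r] ei.
  by case: ifP ei => oi /= ei; congr tau; apply: val_inj; rewrite /= inordK // -ei.
have lr : (r < #|pair_index|)%N.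
  by have := ltn_ord i; move: ei; rewrite /qdim; move: #|pair_index| (nat_of_ord i) => N i'; lia.
case: insubP => [r' _ er|]; last by rewrite lr.
have E b : qcoord tau b (tag (enum_val r')) (tagged (enum_val r')) = tau (inord (r.+1.*2 + b)).
  rewrite /qcoord; case: insubP => [s _ /val_inj ->|]; last by rewrite ltn_ord.
  congr tau; apply: val_inj; rewrite qpos_val -[RHS]/(nat_of_ord _) inordK; last first.
    by move: lr; rewrite /qdim; move: #|pair_index| => N; case: b; lia.
  by rewrite -er; case: (enum_val r') (enum_valK r') => a t /= <-.
have lr2 (b : bool) : (r.+1.*2 + b < qdim.+1)%N.
  by move: lr; rewrite /qdim; move: #|pair_index| => N; case: b; lia.
by case: ifP ei => oi ei; rewrite E; congr tau; apply: val_inj;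
  rewrite -[LHS]/(nat_of_ord _) inordK // addnC ei.
Qed.

Lemma qcoord_mkQ (R : pzRingType) (u w : R) te to b a j : (j < hl a)%N ->
  qcoord (mkQ u w te to) b a j = (if b then to a j else te a j).
Proof.
move=> jl; rewrite /qcoord; case: insubP => [i _ <-|]; last by rewrite jl.
rewrite /mkQ qpos_val halfD odd_double add0n doubleK oddD odd_double addFb.
have -> : b./2 = 0%N by case: b.
rewrite addn0 oddb; case: insubP => [r _ er|]; last by rewrite ltn_ord.
by rewrite (val_inj er) enum_rankK; case: b.
Qed.

Lemma mkQ0 (R : pzRingType) (u w : R) te to : mkQ u w te to (inord 0) = u.
Proof. by rewrite /mkQ inordK. Qed.
Lemma mkQ1 (R : pzRingType) (u w : R) te to : mkQ u w te to (inord 1) = w.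
Proof. by rewrite /mkQ inordK. Qed.

Lemma quadric_ev (R : algebra k) (tau : 'I_qdim.+1 -> R) : ev R tau (quadric k qdim) =
  tau (inord 0) * tau (inord 1) + \sum_a \sum_(j < hl a) qcoord tau false a j * qcoord tau true a j.
Proof.
rewrite /quadric /= odd_double /= rmorph_sum doubleK big_ord_recl.
rewrite rmorphM /= !ev_pvar; congr (_ + _).
rewrite (reindex_onto (fun s : pair_index => enum_rank s) (fun r => enum_val r)) /=; last first.
  by move=> r _; rewrite enum_valK.
rewrite sig_big_dep /=; apply: eq_big => [s|[a j] _]; first by rewrite enum_rankK eqxx.
rewrite rmorphM /= !ev_pvar /qcoord; case: insubP => [i _ /val_inj ->|]; last by rewrite ltn_ord.
by rewrite /qpos /= addn0 addn1.
Qed.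

Lemma quadric_neq0 : quadric k qdim <> 0.
Proof.
pose tau : 'I_qdim.+1 -> base_algebra k := mkQ 1 1 (fun _ _ => 0) (fun _ _ => 0).
move/(f_equal (ev (base_algebra k) tau)); rewrite rmorph0 quadric_ev.
rewrite [tau (inord 0)]mkQ0 [tau (inord 1)]mkQ1 mulr1 big1 ?addr0 => [/eqP|a _].
  by rewrite oner_eq0.
by apply: big1 => j _; rewrite qcoord_mkQ // mul0r.
Qed.

End QuadricCoordinates.

Section QuadricChart.
Variables (K : fieldType) (m : nat) (l : 'I_m -> nat) (eta : spec (Kc K l)).
Local Notation kappa := (residue_field eta).
Local Notation T := (Xvar l).
Variables (S : algebra kappa) (v : T -> S) (p : spec {mpoly kappa[#|T|]}).
Hypothesis P : isloc p (ideal_gen (@fiber_eqs K m l eta)) (ev S v).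
Local Notation vz := (zof v).
Local Notation vu := (v (inr true)).
Local Notation vw := (v (inr false)).

Hypothesis l_even : forall a, ~~ odd (l a).
Hypothesis mu_val : \prod_a (-1) ^+ (l a)./2 = - mu eta.
Hypothesis z_nonunit : forall a i, (0 < i <= l a)%N -> ~ is_unit (vz a i).
Hypothesis u_nonunit : ~ is_unit vu.
Hypothesis w_nonunit : ~ is_unit vw.

Let hl a := (l a)./2.
Let sg (a : 'I_m) : kappa := (-1) ^+ hl a.
Let sgs k : kappa := \prod_(b < m | (b < k)%N) sg b.
Let cf (a : 'I_m) j : kappa := mu eta * sgs a * (-1) ^+ j.+1.

Lemma sgs_sqr k : sgs k * sgs k = 1.
Proof. by rewrite -big_split big1 // => b _ /=; rewrite /sg -expr2 sqrr_sign. Qed.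

Lemma sgsS (a : 'I_m) : sgs a.+1 = sgs a * sg a.
Proof. exact: big_ltS. Qed.

Lemma hl_double a : (hl a).*2 = l a.
Proof. by rewrite -[RHS]odd_double_half (negPf (l_even a)). Qed.

Lemma cf_neq0 a j : cf a j != 0.
Proof.
rewrite /cf mulf_neq0 ?signr_eq0 // mulf_neq0 ?mu_neq0 //.
by apply/prodf_neq0 => b _; rewrite /sg signr_eq0.
Qed.

Lemma ray_sum (R : algebra kappa) (z : nat -> R) (c : R) a :
  \sum_(j < hl a) z j.*2.+2 * (alg_in R (cf a j) * (c * continuant z j.*2.+1)) =
  alg_in R (mu eta * sgs a) * (c * (alg_in R (sg a) * continuant z (l a)) - c).
Proof.
rewrite -(hl_double a) /sg alg_in_sign continuant_even (mulrDr c) mulr1 addrAC subrr add0r !mulr_sumr.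
by apply: eq_bigr => j _; rewrite /cf [in LHS]rmorphM alg_in_sign; ring.
Qed.

(** This turns a product over the rays into an exact sum of the ray forms: E and C are the partial
    products of the signs and of the continuants, and mi * g a is the increment of E C at ray a. *)
Lemma telescope (R : comPzRingType) (E C g : nat -> R) (mi : R) (s Q : 'I_m -> R) k :
  E 0%N = 1 -> C 0%N = 1 -> (forall a : 'I_m, E a.+1 = E a * s a) -> (forall a, s a * s a = 1) ->
  (forall a : 'I_m, C a.+1 = C a * Q a) ->
  (forall a : 'I_m, mi * g a = E a * (C a * (s a * Q a) - C a)) ->
  (k <= m)%N -> E k * C k = 1 + mi * \sum_(b < m | (b < k)%N) g b.
Proof.
move=> E0 C0 ES ss CS gE; elim: k => [|k IHk] km.
  by rewrite E0 C0 big_pred0 ?mulr0 ?addr0 ?mulr1.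
have -> : \sum_(b < m | (b < k.+1)%N) g b = \sum_(b < m | (b < k)%N) g b + g k
  := big_ltS (Ordinal km) (fun b => g b).
rewrite mulrDr (gE (Ordinal km)) /= addrA -IHk ?(ltnW km) //.
by rewrite (ES (Ordinal km)) (CS (Ordinal km)) /=; ring.
Qed.

Lemma sgs_all : sgs m = - mu eta.
Proof. by rewrite /sgs big_lt_all. Qed.

(** By [sgs_all], - mu is a product of signs, so its square is 1. *)
Lemma muV : (mu eta)^-1 = mu eta.
Proof.
apply: (mulfI (mu_neq0 eta)); rewrite mulfV ?mu_neq0 //.
by have := sgs_sqr m; rewrite sgs_all mulrNN.
Qed.

Let cpre (R : algebra kappa) (z : 'I_m -> nat -> R) k : R :=
  \prod_(b < m | (b < k)%N) continuant (z b) (l b).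

Lemma cpre_eq (R : algebra kappa) (z : 'I_m -> nat -> R) (g : 'I_m -> R) :
  (forall a, g a = alg_in R (mu eta * sgs a) *
     (cpre z a * (alg_in R (sg a) * continuant (z a) (l a)) - cpre z a)) ->
  forall k, (k <= m)%N -> alg_in R (sgs k) * cpre z k =
    1 + alg_in R (mu eta) * \sum_(b < m | (b < k)%N) g b.
Proof.
move=> gE k km; pose g' j := if insub j is Some a then g a else 0.
have g'E (a : 'I_m) : g' a = g a by rewrite /g' valK.
under eq_bigr => b _ do rewrite -g'E.
apply: (@telescope R (fun k => alg_in R (sgs k)) (cpre z) g' _
  (fun a => alg_in R (sg a)) (fun a => continuant (z a) (l a))) => //.
- by rewrite /sgs big_pred0 // rmorph1.
- by rewrite /cpre big_pred0.
- by move=> a; rewrite sgsS rmorphM.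
- by move=> a; rewrite -rmorphM /sg -expr2 sqrr_sign rmorph1.
- by move=> a; rewrite /cpre big_ltS.
move=> a; rewrite g'E gE mulrA -rmorphM mulrA; congr (alg_in R _ * _).
by rewrite -{1}muV mulVf ?mu_neq0 // mul1r.
Qed.

(** By telescoping, the product of the P_(l a) is - mu minus the sum of all [te * to], so G = 0
    reads u w + sum te * to = 0 exactly. The factor [to] contains the product of the earlier rays,
    so the old coordinates are recovered from the new ones with the help of these partial
    products. *)
Lemma quadric_chart : exists v' : 'I_(qdim hl).+1 -> S,
  isloc (pcomap (ev S v') (closed_point (isloc_local P)))
    (ideal_gen [set quadric kappa (qdim hl)]) (ev S v') /\
  forall i, ~ is_unit (v' i).
Proof.
have [eF eG] := fiber_coords P; have Sloc := isloc_local P.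
have Pu a n : (n.*2 <= l a)%N -> is_unit (continuant (vz a) n.*2).
  move=> nl; apply: (local_zero_unit Sloc); last by rewrite odd_double.
  by move=> i il; apply: z_nonunit; lia.
have Pu' a : is_unit (continuant (vz a) (l a)) by rewrite -hl_double; apply: Pu; rewrite hl_double.
have cu k : is_unit (cpre vz k) by apply: is_unit_prod.
pose te a j := vz a j.*2.+2.
pose to (a : 'I_m) j := alg_in S (cf a j) * (cpre vz a * continuant (vz a) j.*2.+1).
pose v' : 'I_(qdim hl).+1 -> S := mkQ vu vw te to.
pose gS a := \sum_(j < hl a) te a j * to a j.
have gSE a : gS a = alg_in S (mu eta * sgs a) *
     (cpre vz a * (alg_in S (sg a) * continuant (vz a) (l a)) - cpre vz a) by exact: ray_sum.
have cS := cpre_eq gSE.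
exists v'; split; last first.
  move=> i; rewrite /v' /mkQ; case: (i./2) => [|r]; first by case: odd.
  case: insubP => [r' _ _|_]; last by apply: nonunit0.
  case: (enum_val r') => a j /=; have jl : (j.*2.+2 <= l a)%N.
    by have := ltn_ord j; rewrite -(hl_double a); lia.
  case: odd; last by apply: z_nonunit; lia.
  rewrite /to => /is_unit_mulP[_ /is_unit_mulP[_]].
  have nz i' : (0 < i' <= j.*2.+1)%N -> ~ is_unit (vz a i') by move=> il; apply: z_nonunit; lia.
  by have := local_zero Sloc nz; rewrite [odd _]/= odd_double /= subr0.
apply: (chart P) => [_ ->|R h tau hk hl' tauE htau].
  rewrite quadric_ev [v' (inord 0)]mkQ0 [v' (inord 1)]mkQ1.
  have -> : \sum_a \sum_(j < hl a) qcoord v' false a j * qcoord v' true a j = \sum_a gS a.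
    by apply: eq_bigr => a _; apply: eq_bigr => j _; rewrite !qcoord_mkQ.
  have := cS m (leqnn m); rewrite sgs_all big_lt_all /cpre big_lt_all => e.
  have mm : alg_in S (mu eta) * alg_in S (mu eta) = 1.
    by rewrite -rmorphM -{1}muV mulVf ?mu_neq0 // rmorph1.
  have -> : \sum_a gS a = alg_in S (mu eta) * (1 + alg_in S (mu eta) * (\sum_a gS a)) - alg_in S (mu eta).
    by rewrite mulrDr mulr1 mulrA mm mul1r addrC addKr.
  by rewrite -e rmorphN mulNr mulrN mulrA mm mul1r eG; ring.
have tE := quadric_ev tau; rewrite (tauE _ erefl) in tE.
pose u := tau (inord 0); pose w := tau (inord 1).
pose T0 a j := qcoord tau false a j; pose T1 a j := qcoord tau true a j.
pose g a := \sum_(j < hl a) T0 a j * T1 a j.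
have hT b a j : (j < hl a)%N -> h (qcoord tau b a j) = if b then to a j else te a j.
  move=> jl; rewrite -(@qcoord_mkQ m hl S vu vw te to b a j jl) /qcoord.
  by case: insubP => [i _ _|]; [rewrite htau|rewrite rmorph0].
have hu : h u = vu by rewrite /u htau [LHS]mkQ0.
have hw : h w = vw by rewrite /w htau [LHS]mkQ1.
have hg a : h (g a) = gS a.
  by rewrite rmorph_sum; apply: eq_bigr => j _; rewrite rmorphM !hT.
(* The product of the first k continuants, expressed in the new coordinates through [cpre_eq] before
   any z is known; [CE] confirms it afterwards. *)
pose C k := alg_in R (sgs k) * (1 + alg_in R (mu eta) * \sum_(b < m | (b < k)%N) g b).
have hC k : (k <= m)%N -> h (C k) = cpre vz k.
  move=> km; rewrite rmorphM rmorphD rmorph1 rmorphM rmorph_sum !hk.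
  under eq_bigr => b _ do rewrite hg.
  by rewrite -cS // mulrA -rmorphM sgs_sqr rmorph1 mul1r.
have Cu k : (k <= m)%N -> is_unit (C k) by move=> km; apply: hl'; rewrite hC.
pose W (a : 'I_m) j := alg_in R (cf a j)^-1 * (cinv (C a) * T1 a j).
have hW (a : 'I_m) j : (j < hl a)%N -> h (W a j) = continuant (vz a) j.*2.+1.
  move=> jl; have la := ltnW (ltn_ord a); rewrite !rmorphM hk (rmorph_cinv h (Cu a la)) hC //.
  rewrite [h (T1 a j)](hT true) // /to mulrCA alg_inVK ?cf_neq0 //.
  by rewrite mulrA (mulrC (cinv _)) cinvP // mul1r.
have rb (a : 'I_m) : [/\ forall j, (j < hl a)%N -> rebuild (T0 a) (W a) j.*2.+2 = T0 a j,
      forall j, (j < hl a)%N -> continuant (rebuild (T0 a) (W a)) j.*2.+1 = W a j &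
      forall i, (0 < i <= l a)%N -> h (rebuild (T0 a) (W a) i) = vz a i].
  have vq j : (j < hl a)%N -> is_unit (continuant (vz a) j.*2).
    by move=> jl; apply: Pu; rewrite -(hl_double a); lia.
  have [r1 r2 r3] := local_rebuild hl' vq (hT false a) (hW a).
  by split=> // i il; apply: r3; rewrite hl_double.
pose z a := rebuild (T0 a) (W a).
have gE a : g a = alg_in R (mu eta * sgs a) * (C a * (alg_in R (sg a) * continuant (z a) (l a)) - C a).
  rewrite -ray_sum; apply: eq_bigr => j _; have [r1 r2 _] := rb a.
  rewrite /z r1 // r2 // /W; congr (_ * _).
  rewrite [C a * _]mulrCA (mulrA (C a)) (cinvP (Cu a (ltnW (ltn_ord a)))) mul1r.
  by rewrite alg_inV ?cf_neq0.
have mm : alg_in R (mu eta) * alg_in R (mu eta) = 1.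
  by rewrite -rmorphM -{1}muV mulVf ?mu_neq0 // rmorph1.
have ss k : alg_in R (sgs k) * alg_in R (sgs k) = 1 by rewrite -rmorphM sgs_sqr rmorph1.
have s1 a : alg_in R (sg a) * alg_in R (sg a) = 1 by rewrite -rmorphM /sg -expr2 sqrr_sign rmorph1.
have CS (a : 'I_m) : C a.+1 = C a * continuant (z a) (l a).
  transitivity (alg_in R (sg a) * (C a + alg_in R (sgs a) * (alg_in R (mu eta) * g a))).
    by rewrite /C big_ltS sgsS rmorphM /=; ring.
  rewrite gE rmorphM; set c := C a; set X := continuant _ _.
  transitivity (alg_in R (sg a) * (c + (alg_in R (mu eta) * alg_in R (mu eta)) *
     (alg_in R (sgs a) * alg_in R (sgs a)) * (c * (alg_in R (sg a) * X) - c))); first by ring.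
  rewrite mm ss; transitivity ((alg_in R (sg a) * alg_in R (sg a)) * (c * X)); first by ring.
  by rewrite s1 mul1r.
have CE k : (k <= m)%N -> cpre z k = C k.
  elim: k => [|k IHk] km; first by rewrite /C /cpre /sgs !big_pred0 // rmorph1 mulr0 addr0 mulr1.
  rewrite (CS (Ordinal km) : C k.+1 = _) -IHk ?(ltnW km) //; exact: (big_ltS (Ordinal km)).
pose z' a := solve (z a) (l a).+1 (l a).+1 (alg_in R (lambda eta a) * u).
have z'E a i : (0 < i <= l a)%N -> z' a i = z a i by move=> il; apply: solve_neq; lia.
have z'P a : continuant (z' a) (l a).+1 = alg_in R (lambda eta a) * u /\
    forall j, (0 < j <= (l a).+1)%N -> h (z' a j) = vz a j.
  apply: local_solve => //; [by rewrite leqnn| |by rewrite dcont_last|by rewrite rmorphM hk hu].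
  by move=> j jl jn; have [_ _ r3] := rb a; apply: r3; lia.
have z'c a n : (n <= l a)%N -> continuant (z' a) n = continuant (z a) n.
  by move=> nl; apply: eq_continuant => i il; apply: z'E; lia.
exists (mkX z' u w); split.
- apply: mkX_eqs => [a|]; first by case: (z'P a).
  rewrite (eq_bigr (fun a => continuant (z a) (l a))) => [|a _]; last exact: z'c.
  have := CE m (leqnn m); rewrite /cpre big_lt_all => ->.
  rewrite /C sgs_all big_lt_all rmorphN mulNr mulrDr mulr1 mulrA mm mul1r opprD addrAC addNr add0r.
  by apply/eqP; rewrite -subr_eq0 opprK /g; apply/eqP.
- by apply: eq_mkX => // a j; apply: (z'P a).2.
move=> f fk fv i; rewrite -[tau i]mkQ_id.
have fvz a j : (0 < j <= (l a).+1)%N -> f (vz a j) = z' a j by move=> jl; rewrite fv mkX_z.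
have fc a n : (n <= l a)%N -> f (continuant (vz a) n) = continuant (z a) n.
  move=> nl; rewrite rmorph_continuant -z'c //; apply: eq_continuant => j jl /=; apply: fvz; lia.
rewrite /v' /mkQ; case: (i./2) => [|r]; first by case: odd; rewrite fv.
case: insubP => [r' _ _|_]; last by rewrite rmorph0.
case: (enum_val r') => a j /=; have jl : (j.*2.+2 <= l a)%N.
  by have := ltn_ord j; rewrite -(hl_double a); lia.
have [r1 r2 _] := rb a; have jh : (j < hl a)%N by exact: ltn_ord.
case: odd; last by rewrite /te fvz ?z'E /z ?r1 //; lia.
rewrite /to (rmorphM f (alg_in S _)) (rmorphM f (cpre vz a)) fk fc ?(ltnW jl) // /z r2 //.
have -> : f (cpre vz a) = C a.
  rewrite -CE ?(ltnW (ltn_ord a)) // rmorph_prod; apply: eq_bigr => b _; exact: fc.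
by rewrite /W (mulrCA (C a)) alg_inV ?cf_neq0 // mulrA (cinvP (Cu a (ltnW (ltn_ord a)))) mul1r.
Qed.

Lemma quadric_point : exists n (o : spec (hyperquadric kappa n)),
  [/\ forall i, o (affine_coord _ i), alg_iso S (stalk o) & ~ regular_local S].
Proof.
have [v' [Q nv']] := quadric_chart; have [o [oE oI]] := isloc_point Q.
have pv i : pcomap (ev S v') (closed_point (isloc_local P)) (pvar kappa i).
  by rewrite pcomapE /= ev_pvar; exact: nv'.
exists (qdim hl), o; split=> // [i|]; first exact/oE.
apply: (affine_singular Q) => [_ ->|].
  rewrite /quadric [odd _]/= odd_double; apply: (@ideal_sum _ (square_ideal _)) => i _.
  by apply: square_mul; exact: pv.
by exists (quadric kappa (qdim hl)) => //; exact: quadric_neq0.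
Qed.

End QuadricChart.

(** * Connectedness of the singular components *)

Section LocLift.
Variables (R R' : comPzRingType) (M : mulset R) (g : {rmorphism R -> R'}).
Hypothesis gu : forall s, M s -> is_unit (g s).

Lemma loc_lift : exists h : {rmorphism loc M -> R'}, forall a, h (to_loc M a) = g a.
Proof.
pose h (x : loc M) := g (lnum x) * cinv (g (dval (lden x))).
have du (s : denom M) : is_unit (g (dval s)) by apply: gu; exact: denomP.
have hE a s : g (dval s) * h (mkfrac a s) = g a.
  have /frac_eq[r Mr e] := frac_repr (mkfrac a s).
  apply: (unit_mulI (gu Mr)); apply: (unit_mulI (du (lden (mkfrac a s)))).
  move: e => /(f_equal g); rewrite !rmorphM /h; set b := lnum _; set t := lden _ => e.
  transitivity (g (dval t) * cinv (g (dval t)) * (g r * (g b * g (dval s)))); first by ring.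
  by rewrite (cinvP (du t)) mul1r e; ring.
have dM s t : g (dval s) * g (dval t) = g (dval (denM s t)) by rewrite -rmorphM dvalE.
have hB : zmod_morphism h.
  move=> x y; have [a [s ->]] := fracP x; have [b [t ->]] := fracP y.
  apply: (unit_mulI (is_unitM (du s) (du t))); rewrite fracN fracD.
  rewrite [X in X * _]dM hE rmorphD !rmorphM rmorphN.
  by rewrite -(hE a s) -(hE b t) mulrBr; ring.
have hM : monoid_morphism h.
  split=> [|x y].
    by apply: (unit_mulI (du (den1 _))); rewrite hE mulr1.
  have [a [s ->]] := fracP x; have [b [t ->]] := fracP y.
  apply: (unit_mulI (is_unitM (du s) (du t))); rewrite fracM.
  by rewrite [X in X * _]dM hE !rmorphM -(hE a s) -(hE b t); ring.
have [f fh] := rmorphP hB hM; exists f => a.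
by rewrite fh -[RHS](hE a (den1 _)) dvalE rmorph1 mul1r.
Qed.

Lemma loc_unit s : M s -> is_unit (to_loc M s).
Proof.
move=> Ms; exists (mkfrac 1 (mkdenom Ms)).
by rewrite /to_loc fracM; apply: frac_eqW; rewrite !dvalE; ring.
Qed.

End LocLift.

Section LineRing.
Variable L : fieldType.

Fact line_den1 : (1 : {poly L}).[0] != 0 /\ (1 : {poly L}).[1] != 0.
Proof. by rewrite !hornerE oner_eq0. Qed.
Fact line_denM (f g : {poly L}) : f.[0] != 0 /\ f.[1] != 0 -> g.[0] != 0 /\ g.[1] != 0 ->
  (f * g).[0] != 0 /\ (f * g).[1] != 0.
Proof. by move=> [f0 f1] [g0 g1]; rewrite !hornerM !mulf_neq0. Qed.
Definition line_dens : mulset {poly L} :=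
  @Mulset _ (fun f : {poly L} => f.[0] != 0 /\ f.[1] != 0) line_den1 line_denM.

(* Its generic point specializes to both t = 0 and t = 1, which links the two points of the
   fiber obtained by evaluating a curve there. *)
Definition line_ring : comPzRingType := loc line_dens.

Definition line_cst : {rmorphism L -> line_ring} := to_loc line_dens \o polyC.

Lemma line_eval : exists e0 e1 : {rmorphism line_ring -> L},
  forall f, e0 (to_loc line_dens f) = f.[0] /\ e1 (to_loc line_dens f) = f.[1].
Proof.
have [|e0 E0] := @loc_lift _ _ line_dens (horner_eval (0 : L)).
  by move=> s [s0 _]; exact: field_unit.
have [|e1 E1] := @loc_lift _ _ line_dens (horner_eval (1 : L)).
  by move=> s [_ s1]; exact: field_unit.
by exists e0, e1 => f; split; [exact: E0|exact: E1].
Qed.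

Lemma line_frac0 a s : mkfrac a s = 0 :> line_ring <-> a = 0.
Proof.
split=> [|->]; last by apply: frac_eqW; rewrite !mul0r.
move=> /frac_eq[r [r0 _]]; rewrite dvalE mulr1 mul0r mulr0 => /eqP.
rewrite mulf_eq0 => /orP[/eqP er|/eqP//].
by rewrite er horner0 eqxx in r0.
Qed.

Fact line_zeroD (a b : line_ring) : a = 0 -> b = 0 -> a + b = 0.
Proof. by move=> -> ->; rewrite addr0. Qed.
Fact line_zeroM (a b : line_ring) : b = 0 -> a * b = 0.
Proof. by move=> ->; rewrite mulr0. Qed.
Definition line_zero_ideal : ideal line_ring :=
  @Ideal line_ring (fun a => a = 0) erefl line_zeroD line_zeroM.
Fact line_zero1 : ~ line_zero_ideal 1.
Proof. by move/line_frac0/eqP; rewrite oner_eq0. Qed.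
Fact line_zero_prime a b :
  line_zero_ideal (a * b) -> line_zero_ideal a \/ line_zero_ideal b.
Proof.
have [f [s ->]] := fracP a; have [g [t ->]] := fracP b; rewrite /= fracM => /line_frac0/eqP.
by rewrite mulf_eq0 => /orP[] /eqP e; [left|right]; apply/line_frac0.
Qed.
Definition line_generic : spec line_ring := Point line_zero1 line_zero_prime.

(** A point of P_n = g over [line_ring] that specializes to [z] at t = 0 and to [z'] at t = 1. *)
Definition curve n (g : L) (z z' : nat -> L) := exists Z : nat -> line_ring,
  continuant Z n = line_cst g /\
  forall e0 e1 : {rmorphism line_ring -> L},
    (forall f, e0 (to_loc line_dens f) = f.[0] /\ e1 (to_loc line_dens f) = f.[1]) ->
    forall i, (0 < i <= n)%N -> e0 (Z i) = z i /\ e1 (Z i) = z' i.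

Definition line (x y : L) : {poly L} := (y - x) *: 'X + x%:P.

Lemma line0 x y : (line x y).[0] = x.
Proof. by rewrite !hornerE. Qed.
Lemma line1 x y : (line x y).[1] = y.
Proof. by rewrite !hornerE subrK. Qed.

Lemma curve_line n g z i y : (0 < i)%N -> continuant z n = g -> dcont z i n = 0 ->
  curve n g z (upd z i y).
Proof.
move=> i0 zg d0; exists (upd (line_cst \o z) i (to_loc line_dens (line (z i) y))).
split; first by rewrite continuant_upd // -rmorph_continuant -rmorph_dcont d0 rmorph0 mulr0 addr0 zg.
move=> e0 e1 eE j jn; rewrite /upd; case: eqP => [->|_].
  by rewrite (eE _).1 (eE _).2 line0 line1.
by rewrite /= (eE _).1 (eE _).2 !hornerC.
Qed.

(** The first n coordinates move linearly and the last is solved for; the denominator P_n is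
    non-zero at both ends, hence invertible in [line_ring]. *)
Lemma curve_chart n g z z' : continuant z n.+1 = g -> continuant z' n.+1 = g ->
  continuant z n != 0 -> continuant z' n != 0 -> curve n.+1 g z z'.
Proof.
move=> zg zg' z0 z0'; pose F j := line (z j) (z' j).
pose Z0 : nat -> line_ring := to_loc line_dens \o F.
have F0 : (continuant F n).[0] = continuant z n.
  rewrite -[LHS]/(horner_eval 0 _) rmorph_continuant; apply: eq_continuant => i _.
  exact: line0.
have F1 : (continuant F n).[1] = continuant z' n.
  rewrite -[LHS]/(horner_eval 1 _) rmorph_continuant; apply: eq_continuant => i _.
  exact: line1.
have u : is_unit (dcont Z0 n.+1 n.+1).
  rewrite dcont_last -rmorph_continuant; apply: loc_unit.
  by split; rewrite ?F0 ?F1.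
exists (solve Z0 n.+1 n.+1 (line_cst g)); split; first exact: solveP.
move=> e0 e1 eE i il.
have cst0 : e0 (line_cst g) = g by rewrite (eE _).1 hornerC.
have cst1 : e1 (line_cst g) = g by rewrite (eE _).2 hornerC.
rewrite !rmorph_solve // cst0 cst1; split; apply: solve_id => //; rewrite ?leqnn ?dcont_last //;
  try exact: field_unit; by move=> j _ _; rewrite /= ?(eE _).1 ?(eE _).2 ?line0 ?line1.
Qed.

(* Every point of P_n = g is moved in at most two lines into the chart P_(n-1) <> 0. *)
Lemma block_connected n g (Q : (nat -> L) -> Prop) :
  (forall z z', continuant z n.+2 = g -> continuant z' n.+2 = g -> curve n.+2 g z z' ->
     (Q z <-> Q z')) ->
  forall z z', continuant z n.+2 = g -> continuant z' n.+2 = g -> (Q z <-> Q z').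
Proof.
move=> Qc; suff H z : continuant z n.+2 = g ->
    exists z0, [/\ continuant z0 n.+2 = g, continuant z0 n.+1 != 0 & (Q z <-> Q z0)].
  move=> z z' /H[y [yg y0 yQ]] /H[y' [yg' y0' yQ']].
  by rewrite yQ yQ'; apply: Qc => //; exact: curve_chart.
move=> zg; have [z0|z0] := eqVneq (continuant z n.+1) 0; last by exists z.
have zn : continuant z n != 0 by apply: contra_eq_neq z0 => /continuant_consec.
have d1 : dcont z n.+2 n.+2 = 0 by rewrite dcont_last.
(* As P_(n+1) vanishes, the last coordinate can be moved to 0. The partial derivative in z_(n+1) is
   then 0 too, and moving z_(n+1) gives P_(n+1) the value 1, since P_n is not zero. *)
pose y := upd z n.+2 0.
have yg : continuant y n.+2 = g by rewrite continuant_upd // d1 mulr0 addr0.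
have d2 : dcont y n.+1 n.+2 = 0.
  by rewrite dcontSS ltn_eqF // mul0r add0r {1}/y /upd eqxx mul0r sub0r (@dcont_gt _ y n.+1 n) ?oppr0.
have yz m' : (m' <= n.+1)%N -> continuant y m' = continuant z m'.
  by move=> le; apply: eq_continuant => i il; rewrite /y /upd ltn_eqF //; lia.
pose w := solve y n.+1 n.+1 1.
have wg : continuant w n.+2 = g by rewrite continuant_upd // d2 mulr0 addr0.
exists w; split=> //.
  rewrite solveP ?oner_eq0 //; apply: field_unit.
  by rewrite dcont_last yz.
rewrite (Qc _ _ zg yg); last exact: curve_line.
by apply: Qc => //; exact: curve_line.
Qed.

End LineRing.

(** * The centres: closedness and connectedness *)

Section FiberPoints.
Variables (K : fieldType) (m : nat) (l : 'I_m -> nat) (eta : spec (Kc K l)).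
Local Notation kappa := (residue_field eta).
Local Notation T := (Xvar l).
Local Notation J := (ideal_gen (@fiber_eqs K m l eta)).

Definition zcoord (a : 'I_m) (i : nat) : fiber eta := affine_coord (@fiber_eqs K m l eta) (zvar l a i).

Definition zblock (x : spec (fiber eta)) (a : 'I_m) :=
  forall i, (0 < i <= (l a).+1)%N -> x (zcoord a i).

(* When A is a level set of [critical_value], this is the component of the singular locus
   on which u equals that value. *)
Definition centre (A : {set 'I_m}) : set (spec (fiber eta)) :=
  [set x | exists a b, [/\ a \in A, b \in A, a != b & zblock x a /\ zblock x b]].

(** [y] is the image of [q] under the morphism to the fiber with coordinates [V]; [R] may be a field
    or the ring of a curve. *)
Definition is_pt (R : algebra kappa) (q : spec R) (V : T -> R) (y : spec (fiber eta)) :=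
  forall p, y (qclass J p) <-> q (ev R V p).

Lemma is_pt_ex (R : algebra kappa) (q : spec R) (V : T -> R) :
  (forall p, @fiber_eqs K m l eta p -> ev R V p = 0) -> exists y, is_pt q V y.
Proof.
move=> V0; have [h hE] := quot_lift (ideal_gen_ker V0).
by exists (pcomap h q) => p; rewrite pcomapE /= hE.
Qed.

Lemma is_pt_uniq (R R' : algebra kappa) (q : spec R) (q' : spec R') V V' y y' :
  is_pt q V y -> is_pt q' V' y' -> (forall p, q (ev R V p) <-> q' (ev R' V' p)) -> y = y'.
Proof.
move=> yV yV' e; apply: spec_eq => b; have [p ->] := qclassP b.
by rewrite yV yV'.
Qed.

Lemma is_pt_zcoord (R : algebra kappa) (q : spec R) V y a i :
  is_pt q V y -> y (zcoord a i) <-> q (V (zvar l a i)).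
Proof. by move=> yV; rewrite -[zcoord a i]/(qclass J _) yV ev_pvar. Qed.

Lemma zclosed_centre A : zclosed (centre A).
Proof.
pose I := fun f : fiber eta => forall x, centre A x -> x f.
have I0 : I 0 by move=> x _; exact: ideal0.
have ID a b : I a -> I b -> I (a + b) by move=> Ia Ib x cx; apply: idealD; [exact: Ia|exact: Ib].
have IM a b : I b -> I (a * b) by move=> Ib x cx; apply: idealM; exact: Ib.
exists (Ideal I0 ID IM); apply/seteqP; split=> [x cx f /= If|y Iy]; first exact: If.
apply: contrapT => ny.
have /choice[i iP] : forall a, exists i, ~ zblock y a -> (0 < i <= (l a).+1)%N /\ ~ y (zcoord a i).
  move=> a; have [ya|ya] := pselect (zblock y a); first by exists 0%N.
  have [i H] : exists i, ~ ((0 < i <= (l a).+1)%N -> y (zcoord a i)) by apply/existsNP.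
  by exists i => _; have [il yi] := (not_implyP _ _).1 H.
(* One coordinate non-zero at [y] for each ray of [A] not vanishing at [y]. On the centre two rays
   of [A] vanish, at least one of which is among these rays, so [f] vanishes there but not at
   [y]. *)
pose f : fiber eta := \prod_(a | (a \in A) && ~~ `[< zblock y a >]) zcoord a (i a).
have : ~ y f.
  apply: (big_ind (fun f => ~ y f)) => [|g h yg yh /pointM[]//|a /andP[_ /asboolPn ya]].
    exact: point1.
  by case: (iP a ya).
apply; apply: Iy => x [a [b [aA bA ab [xa xb]]]].
have fx c : c \in A -> zblock x c -> ~ zblock y c -> x f.
  move=> cA xc yc; rewrite /f (bigD1 c) /=; last by rewrite cA; apply/asboolPn.
  by rewrite mulrC; apply: idealM; apply: xc; case: (iP c yc).
have [ya|ya] := pselect (zblock y a); last exact: fx xa ya.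
have [yb|yb] := pselect (zblock y b); last exact: fx xb yb.
by case: ny; exists a, b.
Qed.

Variables (A : {set 'I_m}) (u0 : kappa).
Hypothesis A_odd : forall a, a \in A -> odd (l a).
Hypothesis A_val : forall a, a \in A -> (-1) ^+ ((l a).+1)./2 = lambda eta a * u0.

Definition zero_block (R : pzRingType) (z : 'I_m -> nat -> R) (a : 'I_m) :=
  forall i, (0 < i <= (l a).+1)%N -> z a i = 0.

Definition on_fiber (R : algebra kappa) (z : 'I_m -> nat -> R) :=
  forall a, continuant (z a) (l a).+1 = alg_in R (lambda eta a * u0).

(** A vanishing ray of odd length kills the product in G, which forces w = mu / u0. *)
Definition ptV (R : algebra kappa) (z : 'I_m -> nat -> R) : T -> R :=
  mkX z (alg_in R u0) (alg_in R (mu eta / u0)).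

Lemma u0_neq0 a : a \in A -> u0 != 0.
Proof. by move/A_val => e; apply: contra_eq_neq e => ->; rewrite mulr0 signr_eq0. Qed.

Lemma ptV_eqs (R : algebra kappa) (z : 'I_m -> nat -> R) a : a \in A -> on_fiber z ->
  zero_block z a -> forall p, @fiber_eqs K m l eta p -> ev R (ptV z) p = 0.
Proof.
move=> aA zf za; apply: mkX_eqs => [b|]; first by rewrite zf rmorphM.
rewrite (bigD1 a) //= continuant_zero ?(A_odd aA) => [|i il]; last by apply: za; lia.
by rewrite mul0r add0r -rmorphM mulrC divfK // (u0_neq0 aA).
Qed.

Lemma ptV_ext (R : algebra kappa) (z z' : 'I_m -> nat -> R) :
  (forall a i, (0 < i <= (l a).+1)%N -> z a i = z' a i) -> ptV z = ptV z'.
Proof. by move=> zz; apply/funext; apply: XvarP => // a i il; rewrite /ptV !mkX_z // zz. Qed.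

Lemma is_pt_centre (R : algebra kappa) (q : spec R) z y a b : is_pt q (ptV z) y ->
  a \in A -> b \in A -> a != b -> zero_block z a -> zero_block z b -> centre A y.
Proof.
move=> yP aA bA ab za zb.
have yz c : zero_block z c -> zblock y c.
  move=> zc i il; apply/(is_pt_zcoord _ _ yP); rewrite /ptV mkX_z // zc //; exact: ideal0.
by exists a, b; split=> //; split; exact: yz.
Qed.

Lemma base_coords : exists be : 'I_m -> nat -> kappa,
  (forall a, continuant (be a) (l a).+1 = lambda eta a * u0) /\
  forall a, a \in A -> forall i, be a i = 0.
Proof.
have /choice[be beP] : forall a, exists z : nat -> kappa,
    continuant z (l a).+1 = lambda eta a * u0 /\ (a \in A -> forall i, z i = 0).
  move=> a; have [aA|aA] := boolP (a \in A).
    exists (fun=> 0); split=> //; rewrite continuant_zero // /= (A_odd aA) /=.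
    exact: A_val.
  (* The all-ones tuple is not zero, so by [continuant_crit] some partial derivative is non-zero
     there, and that coordinate can be solved for. *)
  have [[i [il di]]|H] := pselect (exists i, (0 < i <= (l a).+1)%N /\
      dcont (fun=> 1 : kappa) i (l a).+1 != 0).
    exists (solve (fun=> 1) i (l a).+1 (lambda eta a * u0)); split=> //.
    by apply: solveP; [case/andP: il|exact: field_unit].
  have [_ /(_ 1%N isT)/eqP] : ~~ odd (l a).+1 /\ forall i, (0 < i <= (l a).+1)%N -> (fun=> 1 : kappa) i = 0.
    apply: continuant_crit => i il; apply/eqP; apply: contra_notT H => di.
    by exists i.
  by rewrite oner_eq0.
by exists be; split=> a; [case: (beP a)|case: (beP a)].
Qed.

Section Separation.
Variables (Z1 Z2 : set (spec (fiber eta))).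
Hypotheses (cl1 : zclosed Z1) (cl2 : zclosed Z2).
Hypothesis cov : centre A `<=` Z1 `|` Z2.
Hypothesis sep : centre A `&` Z1 `&` Z2 = set0.

(** A closed set containing a point contains its specializations, so a separation of the centre
    cannot part the two. *)
Lemma specialize (xi x : spec (fiber eta)) : centre A xi -> centre A x ->
  (forall f, xi f -> x f) -> (Z1 xi <-> Z1 x).
Proof.
move=> cxi cx sub; have up Z : zclosed Z -> Z xi -> Z x.
  by move=> [I ->] /= H f If; apply/sub/H.
split=> [|z1]; first exact: up.
case: (cov cxi) => // /(up _ cl2) z2.
have : (centre A `&` Z1 `&` Z2) x by [].
by rewrite sep.
Qed.

Section OverField.
Variables (L : fieldType) (iota : {rmorphism kappa -> L}).
Let LA : algebra kappa := @Algebra kappa L iota.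
Let DA : algebra kappa := @Algebra kappa (line_ring L) (line_cst L \o iota).
Variables (a b : 'I_m).
Hypotheses (aA : a \in A) (bA : b \in A) (ab : a != b).

Let Q (z : 'I_m -> nat -> L) := forall y, is_pt (R := LA) (zero_point L) (ptV (R := LA) z) y -> Z1 y.
Let good_pt (z : 'I_m -> nat -> L) := [/\ on_fiber (R := LA) z, zero_block z a & zero_block z b].

Let setb (z : 'I_m -> nat -> L) c zt : 'I_m -> nat -> L := fun c' => if c' == c then zt else z c'.

Lemma good_setb z c zt : c != a -> c != b -> good_pt z ->
  continuant zt (l c).+1 = iota (lambda eta c * u0) -> good_pt (setb z c zt).
Proof.
move=> ca cb [zf za zb] e; split.
- by move=> c'; rewrite /setb; case: eqP => [->|_]; [exact: e|exact: zf].
- by move=> i il; rewrite /setb eq_sym (negPf ca) za.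
by move=> i il; rewrite /setb eq_sym (negPf cb) zb.
Qed.

(** The generic point of [line_ring] gives a point of the centre, as rays [a] and [b] stay zero
    along the curve; it specializes to both ends. *)
Lemma Q_curve z c z1 z2 : c != a -> c != b -> good_pt z ->
  continuant z1 (l c).+1 = iota (lambda eta c * u0) ->
  continuant z2 (l c).+1 = iota (lambda eta c * u0) ->
  curve (l c).+1 (iota (lambda eta c * u0)) z1 z2 -> (Q (setb z c z1) <-> Q (setb z c z2)).
Proof.
move=> ca cb gz e1 e2 [Z [eZ hZ]].
have [zf za zb] := gz.
pose zD : 'I_m -> nat -> line_ring L := fun c' => if c' == c then Z else line_cst L \o z c'.
have zDa : zero_block zD a by move=> i il; rewrite /zD eq_sym (negPf ca) /= za // rmorph0.
have zDb : zero_block zD b by move=> i il; rewrite /zD eq_sym (negPf cb) /= zb // rmorph0.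
have zDf : on_fiber (R := DA) zD.
  move=> c'; rewrite /zD; case: eqP => [->|_]; first exact: eZ.
  by rewrite -rmorph_continuant zf.
have [xi xiP] := is_pt_ex (R := DA) (line_generic L) (ptV_eqs (R := DA) aA zDf zDa).
have xiC := is_pt_centre xiP aA bA ab zDa zDb.
have [e0 [e1' eE]] := line_eval L.
have key (e : {rmorphism line_ring L -> L}) zt : (forall f, e (to_loc (line_dens L) f%:P) = f) ->
    (forall i, (0 < i <= (l c).+1)%N -> e (Z i) = zt i) ->
    continuant zt (l c).+1 = iota (lambda eta c * u0) ->
    forall y, is_pt (R := LA) (zero_point L) (ptV (R := LA) (setb z c zt)) y -> (Z1 xi <-> Z1 y).
  move=> eC eZt et y yP; have [gf ga gb] := good_setb ca cb gz et.
  apply: specialize => //; first exact: (is_pt_centre yP aA bA ab ga gb).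
  move=> f; have [p ->] := qclassP f; move/xiP => /= evD; apply/yP => /=.
  have ek : @alg_hom kappa DA LA e by move=> d /=; exact: eC.
  have := @rmorph_ev kappa T DA LA (ptV (R := DA) zD) e ek p; rewrite evD rmorph0 => e3; rewrite [RHS]e3.
  apply: (@ev_eq _ _ LA); apply: XvarP => [c' i il||]; [|exact/esym/eC|exact/esym/eC].
  rewrite -[RHS]/(e (ptV (R := DA) zD (zvar l c' i))) /ptV !mkX_z // /setb /zD; case: eqP il => [->|_] il; first by rewrite eZt.
  exact/esym/eC.
have ex zt : continuant zt (l c).+1 = iota (lambda eta c * u0) ->
    exists y, is_pt (R := LA) (zero_point L) (ptV (R := LA) (setb z c zt)) y.
  move=> et; have [gf ga _] := good_setb ca cb gz et.
  exact: is_pt_ex (ptV_eqs (R := LA) aA gf ga).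
have k1 := key e0 z1 (fun f => etrans (eE _).1 (hornerC _ _)) (fun i il => (hZ e0 e1' eE i il).1) e1.
have k2 := key e1' z2 (fun f => etrans (eE _).2 (hornerC _ _)) (fun i il => (hZ e0 e1' eE i il).2) e2.
have [y1 y1P] := ex _ e1; have [y2 y2P] := ex _ e2.
split=> H y yP.
  by apply/(k2 y yP)/(k1 y1 y1P)/H.
by apply/(k1 y yP)/(k2 y2 y2P)/H.
Qed.

Hypothesis l_ge1 : forall c, (1 <= l c)%N.

Lemma Q_block z c zt : c != a -> c != b -> good_pt z ->
  continuant zt (l c).+1 = iota (lambda eta c * u0) -> (Q z <-> Q (setb z c zt)).
Proof.
move=> ca cb gz et; have -> : Q z <-> Q (setb z c (z c)).
  have -> // : setb z c (z c) = z by apply/funext => c'; rewrite /setb; case: eqP => [->|].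
have [zf _ _] := gz; have := zf c => /= ez.
have := @block_connected L (l c).-1 (iota (lambda eta c * u0)) (fun zt => Q (setb z c zt)).
rewrite (prednK (l_ge1 c)); apply=> // z1 z2 e1 e2 c12.
exact: Q_curve.
Qed.

Lemma Q_all z be : good_pt z -> good_pt be -> (Q z <-> Q be).
Proof.
move=> gz gbe; pose zk k : 'I_m -> nat -> L :=
  fun c => if [&& (c < k)%N, c != a & c != b] then be c else z c.
have gzk k : good_pt (zk k).
  case: gz gbe => zf za zb [bf _ _]; split.
  - by move=> c; rewrite /zk; case: ifP => _; [exact: bf|exact: zf].
  - by move=> i il; rewrite /zk eqxx andbF za.
  by move=> i il; rewrite /zk eqxx !andbF zb.
have step k : (k <= m)%N -> (Q z <-> Q (zk k)).
  elim: k => [|k IHk] km.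
    by have -> : zk 0%N = z by apply/funext => c; rewrite /zk ltn0.
  rewrite IHk ?(ltnW km) //; pose c := Ordinal km.
  have zkE c' : c' != c -> zk k.+1 c' = zk k c'.
    by move=> cc; rewrite /zk ltnS [in LHS]leq_eqVlt (negPf (_ : val c' != k)).
  have [cab|cab] := boolP ((c != a) && (c != b)); last first.
    have -> // : zk k.+1 = zk k.
    apply/funext => c'; have [->|/zkE//] := eqVneq c' c.
    by rewrite /zk (negPf cab) !andbF.
  have -> : zk k.+1 = setb (zk k) c (be c).
    apply/funext => c'; rewrite /setb; case: eqP => [->|/eqP/zkE//].
    by rewrite /zk ltnSn cab.
  case/andP: cab => ca cb; apply: Q_block => //.
  by case: gbe => bf _ _; exact: bf.
rewrite (step m (leqnn m)); suff e : ptV (R := LA) (zk m) = ptV (R := LA) be.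
  by split=> H y yP; apply: H; [rewrite e|rewrite -e].
apply: ptV_ext => c i il; rewrite /zk ltn_ord /=.
case: gz gbe => _ za zb [_ ba bb].
case: eqVneq il => [->|ca] il /=; first by rewrite za // ba.
by case: eqVneq il => [->|cb] il //=; rewrite zb // bb.
Qed.

(** The target [be] is defined over [kappa], so over every field it gives the same point [x0]. *)
Lemma Q_base (be : 'I_m -> nat -> kappa) x0 z x :
  (forall c, continuant (be c) (l c).+1 = lambda eta c * u0) ->
  (forall c, c \in A -> forall i, be c i = 0) ->
  is_pt (R := base_algebra kappa) (zero_point kappa) (ptV (R := base_algebra kappa) be) x0 ->
  good_pt z -> is_pt (R := LA) (zero_point L) (ptV (R := LA) z) x -> Z1 x0 -> Z1 x.
Proof.
move=> bf b0 x0P gz zP z1; pose B := base_algebra kappa.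
pose beL c i := iota (be c i).
have gbe : good_pt beL.
  split=> [c|i il|i il]; first by rewrite -rmorph_continuant bf.
    by rewrite /beL b0 ?rmorph0.
  by rewrite /beL b0 ?rmorph0.
apply: ((Q_all gz gbe).2 _ x zP) => y yP.
have -> // : y = x0.
apply: (is_pt_uniq yP x0P) => p.
have ik : @alg_hom kappa B LA iota by [].
have -> : ev LA (ptV (R := LA) beL) p = iota (ev B (ptV (R := B) be) p).
  rewrite (@rmorph_ev kappa T B LA (ptV (R := B) be) iota ik p).
  apply: (@ev_eq _ _ LA); apply: XvarP => [c i il||]; [|reflexivity|reflexivity].
  by rewrite -[RHS]/(iota (ptV (R := B) be (zvar l c i))) /ptV !mkX_z.
split=> [/= /eqP|/= ->]; last exact: rmorph0.
by rewrite fmorph_eq0 => /eqP.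
Qed.

End OverField.

Lemma centre_uw (L : fieldType) (iota : {rmorphism kappa -> L}) (v : T -> @Algebra kappa L iota) a :
  a \in A -> (forall p, @fiber_eqs K m l eta p -> ev _ v p = 0) -> zero_block (zof v) a ->
  on_fiber (zof v) /\ ptV (zof v) = v.
Proof.
move=> aA /fiber_eqsP[vF vG] za; have u0n : iota u0 != 0 by rewrite fmorph_eq0 (u0_neq0 aA).
have ln : iota (lambda eta a) != 0 by rewrite fmorph_eq0 lambda_neq0.
have vu : v (inr true) = iota u0.
  apply: (mulfI ln); rewrite -rmorphM -A_val // rmorphXn rmorphN1 -[LHS]vF continuant_zero //.
  by rewrite [odd _]/= (A_odd aA).
have vw : v (inr false) = iota (mu eta / u0); last first.
  split; first by move=> c; rewrite vF vu -rmorphM.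
  by apply/funext; apply: XvarP => [c i il||] //; rewrite /ptV mkX_z.
apply: (mulfI u0n); rewrite -rmorphM [u0 * _]mulrC divfK ?(u0_neq0 aA) //.
rewrite -vu [LHS]vG (bigD1 a) //= continuant_zero ?(A_odd aA) ?mul0r ?add0r // => i il.
by apply: za; lia.
Qed.

Lemma centre_point (x : spec (fiber eta)) : centre A x ->
  exists (a b : 'I_m) (z : 'I_m -> nat -> residue_field x),
    let R := Algebra (to_residue x \o alg_in (fiber eta) : {rmorphism kappa -> residue_field x}) in
    [/\ [/\ a \in A, b \in A & a != b], on_fiber (R := R) z, zero_block z a, zero_block z b &
      is_pt (R := R) (zero_point (residue_field x)) (ptV (R := R) z) x].
Proof.
move=> [a [b [aA bA ab [xa xb]]]]; set L := residue_field x.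
pose iota : {rmorphism kappa -> L} := to_residue x \o alg_in (fiber eta).
pose R : algebra kappa := @Algebra kappa L iota.
pose v t : R := to_residue x (affine_coord (@fiber_eqs K m l eta) t).
have vE p : ev R v p = to_residue x (qclass J p).
  apply/esym; apply: (@ev_unique _ _ R v (to_residue x \o qclass J : {rmorphism _ -> _})) => [c|t] //.
have v0 p : @fiber_eqs K m l eta p -> ev R v p = 0.
  move=> Ep; rewrite vE (_ : qclass J p = 0) ?rmorph0 //.
  by rewrite -(rmorph0 (qclass J)); apply/qclass_eq; rewrite subr0 => I; apply.
have [vF vG] := (fiber_eqsP v).1 v0.
have zz c : zblock x c -> zero_block (zof v) c by move=> xc i il; apply/to_residue_eq0; exact: xc.
have za := zz _ xa; have zb := zz _ xb.
have [vf ve] := @centre_uw L iota v a aA v0 za.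
exists a, b, (zof v); split=> //.
by move=> p; rewrite -(to_residue_eq0 x) -vE ve.
Qed.

End Separation.

Hypothesis l_ge1 : forall c, (1 <= l c)%N.
Hypothesis A_gt1 : (1 < #|A|)%N.

Lemma centre_connected : exists x0, [/\ centre A x0, forall a, a \in A -> zblock x0 a &
  zconnected (centre A)].
Proof.
have [be [bf b0]] := base_coords.
have [a [b [aA bA ab]]] := card_gt1P A_gt1.
pose B := base_algebra kappa.
have zb c : c \in A -> zero_block be c by move=> cA i _; exact: b0.
have [x0 x0P] := is_pt_ex (R := B) (zero_point kappa) (ptV_eqs (R := B) aA bf (zb a aA)).
have x0C := is_pt_centre x0P aA bA ab (zb a aA) (zb b bA).
exists x0; split=> // [c cA i il|].
  by apply/(is_pt_zcoord _ _ x0P); rewrite /ptV mkX_z // b0.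
have link Z1 Z2 : zclosed Z1 -> zclosed Z2 -> centre A `<=` Z1 `|` Z2 ->
    centre A `&` Z1 `&` Z2 = set0 -> forall x, centre A x -> Z1 x0 -> Z1 x.
  move=> cl1 cl2 cov sep x xC z1.
  have [a' [b' [z [[aA' bA' ab'] zf za' zb' zP]]]] := centre_point xC.
  exact: (Q_base cl1 cl2 cov sep aA' bA' ab' l_ge1 bf b0 x0P (And3 zf za' zb') zP z1).
move=> Z1 Z2 cl1 cl2 cov sep; case: (cov x0 x0C) => z0; [left|right] => x xC.
  exact: (link Z1 Z2).
(* The separation hypotheses are symmetric in the two closed sets. *)
apply: (link Z2 Z1) => //; first by move=> y /cov []; [right|left].
by rewrite -setIA (setIC Z2) setIA.
Qed.

End FiberPoints.
Lemma dcont_zero (R : comPzRingType) (z : nat -> R) i n :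
  (forall j, (0 < j <= n)%N -> z j = 0) -> ~~ odd n -> dcont z i n = 0.
Proof.
elim/nat_ind2: n => [//|//|n IH1 _ zz on]; rewrite dcontSS IH1; last 2 first.
- by move=> j jl; apply: zz; lia.
- by move: on; rewrite /= negbK.
rewrite zz; last by lia.
rewrite continuant_zero => [|j jl]; last by apply: zz; lia.
by move: on; rewrite /= negbK => /negPf ->; rewrite mulr0 mul0r addr0 subrr.
Qed.

(** * Classification *)

Section Classification.
Variables (K : fieldType) (m : nat) (l : 'I_m -> nat) (eta : spec (Kc K l)).
Local Notation kappa := (residue_field eta).
Local Notation T := (Xvar l).
Local Notation fib := (affine (@fiber_eqs K m l eta)).

Definition stalk_coord (x : spec fib) (t : T) : stalk x :=
  to_loc (point_compl x) (affine_coord (@fiber_eqs K m l eta) t).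

(** For l a odd, the value that F_a forces on u where all the z^(a) vanish. *)
Definition critical_value a : kappa := (-1) ^+ ((l a).+1)./2 / lambda eta a.

Section LocalRing.
Variables (S : algebra kappa) (v : T -> S) (p : spec {mpoly kappa[#|T|]}).
Hypothesis P : isloc p (ideal_gen (@fiber_eqs K m l eta)) (ev S v).
Local Notation vz := (zof v).
Local Notation vu := (v (inr true)).
Local Notation vw := (v (inr false)).

Lemma alg_nonunit (c : kappa) : ~ is_unit (alg_in S c) -> c = 0.
Proof. by move=> nu; apply/eqP; apply: contra_notT nu; exact: alg_unit. Qed.

Lemma critP a : crit v a <->
  (forall i, (0 < i <= (l a).+1)%N -> ~ is_unit (vz a i)) /\ odd (l a).
Proof.
have Sloc := isloc_local P; split=> [c|[za ol] i il].
  have [ol nz] := local_crit Sloc c; split=> //.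
  by move: ol; rewrite /= negbK.
apply/(reduce_eq0 Sloc); rewrite rmorph_dcont dcont_zero //= ?ol // => j jl.
exact: (reduce_eq0 Sloc (vz a j)).2 (za j jl).
Qed.

Lemma crit_value a : crit v a -> ~ is_unit (vu - alg_in S (critical_value a)).
Proof.
move=> /critP[za ol]; have Sloc := isloc_local P; have [vF _] := fiber_coords P.
have := local_zero Sloc za; rewrite vF [odd _]/= ol => nu.
have -> : vu - alg_in S (critical_value a) =
    alg_in S (lambda eta a)^-1 *
      (alg_in S (lambda eta a) * vu - (-1) ^+ ((l a).+1./2)).
  rewrite mulrBr alg_inVK ?lambda_neq0 //; congr (_ - _).
  by rewrite /critical_value rmorphM mulrC alg_in_sign.
by move=> /is_unit_mulP[_]; exact: nu.
Qed.

(** Both constants are congruent to u modulo the maximal ideal, and a non-unit constant is 0. *)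
Lemma crit_value_eq a b : crit v a -> crit v b -> critical_value a = critical_value b.
Proof.
move=> /crit_value ca /crit_value cb; have [_ locD] := isloc_local P.
apply/eqP; rewrite -subr_eq0; apply/eqP/alg_nonunit.
have -> : alg_in S (critical_value a - critical_value b) =
    (vu - alg_in S (critical_value b)) + - (vu - alg_in S (critical_value a)).
  by rewrite rmorphB; ring.
apply: locD => // /is_unitN; rewrite opprK; exact: ca.
Qed.

Lemma crit_u_unit a : crit v a -> is_unit vu.
Proof.
move=> ca; have cv := crit_value ca; have [_ locD] := isloc_local P.
apply: contrapT => nu; have : is_unit (- alg_in S (critical_value a)).
  apply/is_unitN/alg_unit; rewrite mulf_neq0 ?signr_eq0 // invr_eq0; exact: lambda_neq0.
have -> : - alg_in S (critical_value a) =
   (vu - alg_in S (critical_value a)) + - vu by ring.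
by apply: locD => // /is_unitN; rewrite opprK.
Qed.

Lemma critical_valueE a : (-1) ^+ ((l a).+1)./2 = lambda eta a * critical_value a.
Proof. by rewrite mulrC divfK // lambda_neq0. Qed.

Lemma singular_crit a b : a != b -> crit v a -> crit v b -> ~ regular_local S.
Proof.
move=> ab ca cb; pose A := [set c | `[< crit v c >]]%SET.
have AE c : crit v c <-> c \in A by rewrite inE; split=> /asboolP.
apply: (cyl_singular (A := A) (u0 := critical_value a) P) => //.
- exact: crit_u_unit ca.
- by apply/card_gt1P; exists a, b; split=> //; apply/AE.
- by move=> c /AE /critP[].
by move=> c /AE cc; rewrite (crit_value_eq ca cc) critical_valueE.
Qed.

Definition at_origin := [/\ forall a, ~~ odd (l a), \prod_a (-1) ^+ (l a)./2 = - mu eta,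
  forall a i, (0 < i <= l a)%N -> ~ is_unit (vz a i), ~ is_unit vu & ~ is_unit vw].

Lemma not_regularP (m_ge1 : (0 < m)%N) : ~ regular_local S ->
  (exists a b, [/\ a != b, crit v a & crit v b]) \/ at_origin.
Proof.
move=> nr; have Sloc := isloc_local P; have [vF vG] := fiber_coords P.
have [uu|uu] := pselect (is_unit vu).
  left; apply: contrapT => H; apply: nr.
  have [a0 Ha0] : exists a0, forall a, a != a0 -> ~ crit v a.
    have [[a ca]|na] := pselect (exists a, crit v a).
      by exists a => b ba cb; apply: H; exists b, a.
    by exists (Ordinal m_ge1) => a _ ca; apply: na; exists a.
  apply: (regular_u_unit P uu (a0 := a0)) => a /Ha0 nc.
  by have [i [il du]] := noncrit nc; exists i.
right; have Pu a : is_unit (continuant (vz a) (l a)).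
  by apply: (local_consec Sloc); rewrite vF => /is_unit_mulP[].
have dn a i : (0 < i <= l a)%N -> ~ is_unit (dcont (vz a) i (l a)).
  by move=> il du; apply: nr; exact: (regular_dcont_unit P Pu il du).
have cr a := local_crit Sloc (dn a).
have ev a : ~~ odd (l a) by case: (cr a).
have zn a i : (0 < i <= l a)%N -> ~ is_unit (vz a i) by case: (cr a) => _; apply.
split=> //; last by move=> ww; apply: nr; exact: (regular_w_unit P Pu ww).
apply/eqP; rewrite -subr_eq0 opprK; apply/eqP/alg_nonunit.
apply/(reduce_eq0 Sloc); have /(f_equal (reduce Sloc)) := vG.
rewrite !(rmorphD, rmorphM) (reduce_eq0 Sloc _).2 // mul0r => ->; congr (_ + _).
rewrite !rmorph_prod; apply: eq_bigr => a _; rewrite alg_in_sign rmorphXn rmorphN1.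
rewrite rmorph_continuant continuant_zero ?(negPf (ev a)) // => i il.
exact/(reduce_eq0 Sloc)/zn.
Qed.

(** The last z of a ray does not enter G; F_a gives it modulo the maximal ideal, as its coefficient
    P_(l a) is a unit while u and P_(l a - 1) are not. *)
Lemma origin_coords (l_ge1 : forall a, (1 <= l a)%N) : at_origin ->
  forall t, ~ is_unit (v t).
Proof.
move=> [le _ zn un wn]; have Sloc := isloc_local P; have [vF _] := fiber_coords P.
apply: XvarP => [a i il||] //.
have [iE|ni] := eqVneq i (l a).+1; last by apply: (zn a); lia.
rewrite iE; case e : (l a) (l_ge1 a) => [//|n] _.
have /(reduce_eq0 Sloc) : ~ is_unit (continuant (vz a) (l a).+1) by rewrite vF => /is_unit_mulP[].
rewrite e continuantSS rmorphB rmorphM.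
have rz j : (0 < j <= n.+1)%N -> (reduce Sloc \o vz a) j = 0.
  by move=> jl; apply/(reduce_eq0 Sloc)/zn; rewrite e.
have on : odd n by have := le a; rewrite e /= negbK.
rewrite !rmorph_continuant continuant_zero // [continuant _ n]continuant_zero => [|j jl]; last by apply: rz; lia.
rewrite /= on subr0 => /eqP; rewrite mulf_eq0 signr_eq0 orbF => /eqP rz2.
exact/(reduce_eq0 Sloc).
Qed.

End LocalRing.

Lemma coord_unit (x : spec fib) t :
  ~ is_unit (stalk_coord x t) <-> x (affine_coord (@fiber_eqs K m l eta) t).
Proof.
have := isloc_unitE (stalk_isloc x) (pvar kappa t); rewrite pcomapE /= ev_pvar => e.
split=> [nu|xt /e]; last exact.
by apply: contrapT => /e.
Qed.

Lemma crit_zblock (x : spec fib) a : crit (stalk_coord x) a <-> zblock x a /\ odd (l a).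
Proof.
rewrite (critP (stalk_isloc x)); split=> -[za ol]; split=> // i il; exact/coord_unit/za.
Qed.

Lemma ev_zero (L : fieldType) (iota : {rmorphism kappa -> L}) p :
  ev (@Algebra kappa L iota) (fun=> 0) p = 0 <->
  ev (base_algebra kappa) (fun _ : T => 0 : base_algebra kappa) p = 0.
Proof.
pose B := base_algebra kappa; pose LA := @Algebra kappa L iota.
have ik : @alg_hom kappa B LA iota by [].
have e : ev LA (fun _ : T => 0 : LA) p = iota (ev B (fun _ : T => 0 : B) p).
  rewrite (@rmorph_ev kappa T B LA (fun _ : T => 0 : B) iota ik p).
  by apply: (@ev_eq _ _ LA) => t /=; rewrite rmorph0.
rewrite e; split=> [/eqP|->]; last exact: rmorph0.
by rewrite fmorph_eq0 => /eqP.
Qed.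

Lemma is_pt_origin (x : spec fib) : (forall t, x (affine_coord (@fiber_eqs K m l eta) t)) ->
  is_pt (R := base_algebra kappa) (zero_point kappa) (fun=> 0) x.
Proof.
move=> xt p; pose iota : {rmorphism kappa -> residue_field x} := to_residue x \o alg_in fib.
pose R : algebra kappa := @Algebra kappa (residue_field x) iota.
have vE : ev R (fun=> 0) p = to_residue x (qclass (ideal_gen (@fiber_eqs K m l eta)) p).
  apply/esym; apply: (@ev_unique _ _ R (fun=> 0) (to_residue x \o qclass _ : {rmorphism _ -> _})) => [c|t] //.
  exact/to_residue_eq0/xt.
rewrite -(to_residue_eq0 x) -vE; exact: ev_zero.
Qed.

Lemma origin_unique (x y : spec fib) : (forall t, x (affine_coord (@fiber_eqs K m l eta) t)) ->
  (forall t, y (affine_coord (@fiber_eqs K m l eta) t)) -> x = y.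
Proof. by move=> /is_pt_origin xP /is_pt_origin yP; apply: (is_pt_uniq xP yP). Qed.

Lemma origin_singular (l_ge1 : forall a, (1 <= l a)%N) (m_ge1 : (0 < m)%N) :
  (forall a, ~~ odd (l a)) -> \prod_a (-1) ^+ (l a)./2 = - mu eta ->
  exists x : spec fib, sing fib = [set x] /\ A1_singularity x.
Proof.
move=> le lm; pose B := base_algebra kappa.
have [|x0 x0P] := @is_pt_ex K m l eta B (zero_point kappa) (fun=> 0).
  apply/fiber_eqsP; split=> [a|]; first by rewrite mulr0 continuant_zero //= le.
  rewrite mulr0; under eq_bigr => a _ do rewrite continuant_zero // (negPf (le a)).
  by rewrite lm addNr.
have x0t t : x0 (affine_coord (@fiber_eqs K m l eta) t).
  by apply/x0P => /=; rewrite ev_pvar.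
have o0 : at_origin (stalk_coord x0) by split=> // [a i il||]; apply/coord_unit.
have [n [o [ot oI nr]]] : exists n (o : spec (hyperquadric kappa n)),
    [/\ forall i, o (affine_coord _ i), alg_iso (stalk x0) (stalk o) & ~ regular_local (stalk x0)].
  by case: o0 => _ _ zn un wn; exact: (quadric_point (stalk_isloc x0) le lm zn un wn).
have sx : sing fib = [set x0].
  apply/seteqP; split=> [x nx|x -> /regular_atE//].
  apply: origin_unique => //.
  have nr' : ~ regular_local (stalk x) by move=> /regular_atE.
  have [[a [b [_ /crit_zblock[_ oa] _]]]|ox] := not_regularP (stalk_isloc x) m_ge1 nr'.
    by rewrite (negPf (le a)) in oa.
  by move=> t; apply/coord_unit; exact: (origin_coords (stalk_isloc x) l_ge1 ox).
exists x0; split=> //; split.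
  exists setT; split=> //; last by rewrite sx setIT.
  exists (ideal_gen setT); apply/seteqP; split=> [x H|x H]; first by case: H.
  by case: (point1 (s := x)); apply: H => I; apply.
by exists n, o; split=> //; exact: completed_stalk_iso.
Qed.

Definition level (a : 'I_m) : {set 'I_m} :=
  [set b | odd (l b) & critical_value b == critical_value a]%SET.
Definition levels : {set {set 'I_m}} := [set A in [set level a | a : 'I_m] | (1 < #|A|)%N]%SET.

Lemma levelsP A : A \in levels -> exists a, [/\ A = level a, (1 < #|A|)%N,
  forall b, b \in A -> odd (l b) &
  forall b, b \in A -> (-1) ^+ ((l b).+1)./2 = lambda eta b * critical_value a].
Proof.
rewrite inE => /andP[/imsetP[a _ ->] A1]; exists a; split=> // b; rewrite inE => /andP[//].
by move=> _ /eqP <-; exact: critical_valueE.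
Qed.

Lemma centre_crit A x : A \in levels -> centre A x ->
  exists a b, [/\ a \in A, b \in A, a != b, crit (stalk_coord x) a & crit (stalk_coord x) b].
Proof.
move=> /levelsP[c [_ _ Ao _]] [a [b [aA bA ab [xa xb]]]].
by exists a, b; split=> //; apply/crit_zblock; split; rewrite ?Ao.
Qed.

(** All critical rays at a point share one critical value; hence the centres of distinct levels are
    disjoint. *)
Lemma level_crit A x a : A \in levels -> centre A x -> crit (stalk_coord x) a -> A = level a.
Proof.
move=> AL /(centre_crit AL)[b [_ [bA _ _ cb _]]] ca; have [c [AE _ _ _]] := levelsP AL.
have ec : critical_value b = critical_value c.
  by move: bA; rewrite AE inE => /andP[_ /eqP].
have ab := crit_value_eq (stalk_isloc x) ca cb.
by rewrite AE /level ab ec.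
Qed.

(** The charts at all points of the centre use the parameters of [A]. At the base point of
    [centre_connected] every ray of [A] vanishes, so there the chart meets the center of the
    cylinder. *)
Lemma centre_cylinder (l_ge1 : forall a, (1 <= l a)%N) A : A \in levels ->
  locally_A1_cylinder (centre A : set (spec fib)).
Proof.
move=> AL; have [c [AE A1 Ao Av]] := levelsP AL.
have j0 : 'I_#|A| := Ordinal (ltnW A1).
have chartA x : centre A x -> exists y : spec (A1_intersection_cylinder kappa (@half_len m l A) #|free_var l A|),
    locally_iso x y /\ ((forall a, a \in A -> zblock x a) -> central y).
  move=> cx; have [a [_ [_ _ _ ca _]]] := centre_crit AL cx.
  have uu := crit_u_unit (stalk_isloc x) ca.
  have Ac b : crit (stalk_coord x) b -> b \in A.
    move=> cb; rewrite (level_crit AL cx cb) inE eqxx andbT.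
    by case/crit_zblock: cb.
  have [v' [Q nQ]] := cyl_chart (stalk_isloc x) uu j0 Ao Av Ac.
  have [y [yE yI]] := isloc_point Q.
  exists y; split=> // xz j i b; apply/yE; rewrite pcomapE /= ev_pvar.
  apply: nQ; apply/crit_zblock; split; first by apply: xz; exact: enum_valP.
  by apply: Ao; exact: enum_valP.
exists #|A|, (@half_len m l A), #|free_var l A|; split=> //.
- by move=> j; have := half_len_double Ao j; lia.
- by move=> x /chartA[y [yI _]]; exists y.
have [x0 [cx0 z0 _]] := centre_connected Ao Av l_ge1 A1.
exists x0; split=> //; have [y [yI yc]] := chartA x0 cx0.
by exists y; split=> //; exact: yc.
Qed.

Lemma level_centre x a b : a != b -> crit (stalk_coord x) a -> crit (stalk_coord x) b ->
  level a \in levels /\ centre (level a) x.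
Proof.
move=> ab ca cb; have aA : a \in level a by rewrite inE eqxx andbT; case/crit_zblock: ca.
have e := crit_value_eq (stalk_isloc x) cb ca.
have bA : b \in level a by rewrite inE e eqxx andbT; case/crit_zblock: cb.
split; last by exists a, b; split=> //; split; [case/crit_zblock: ca|case/crit_zblock: cb].
by rewrite inE imset_f //=; apply/card_gt1P; exists a, b.
Qed.

End Classification.

Theorem theoremA (K : fieldType) (m : nat) (l : 'I_m -> nat)
    (m_ge1 : (1 <= m)%N) (l_ge1 : forall a, (1 <= l a)%N)
    (eta : spec (Kc K l)) (eta_closed : zclosed [set eta]) :
  let X := fiber eta in
  [\/ exists x : spec X, sing X = [set x] /\ A1_singularity x,
      exists (s : nat) (C : 'I_s -> set (spec X)),
        [/\ (1 <= s)%N, components (sing X) C & forall i, locally_A1_cylinder (C i)]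
    | forall x : spec X, regular_at x].

Proof.
move=> X; have [le|nle] := pselect ((forall a, ~~ odd (l a)) /\
    \prod_a (-1) ^+ (l a)./2 = - mu eta).
  by apply: Or31; case: le => le lm; exact: origin_singular.
have sP x : sing X x -> exists a b, [/\ a != b, crit (stalk_coord x) a & crit (stalk_coord x) b].
  move=> nx; have nr : ~ regular_local (stalk x) by move=> /regular_atE.
  by have [//|[le lm _ _ _]] := not_regularP (stalk_isloc x) m_ge1 nr; case: nle.
have [L0|/set0Pn[A0 A0L]] := eqVneq (levels eta) finset.set0.
  apply: Or33 => x; apply: contrapT => /sP[a [b [ab ca cb]]].
  by have [] := level_centre ab ca cb; rewrite L0 inE.
apply: Or32; exists #|levels eta|, (fun i => centre (enum_val i)); split.
- by apply/card_gt0P; exists A0.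
- split=> [i|i j ij|].
  + have AL := enum_valP i; have [c [AE A1 Ao Av]] := levelsP AL.
    have [x0 [cx0 _ co]] := centre_connected Ao Av l_ge1 A1.
    by split=> //; [exists x0|exact: zclosed_centre].
  + apply/seteqP; split=> // x [xi xj]; have Li := enum_valP i; have Lj := enum_valP j.
    have [a [_ [_ _ _ ca _]]] := centre_crit Li xi.
    by case/eqP: ij; apply: enum_val_inj; rewrite (level_crit Li xi ca) (level_crit Lj xj ca).
  apply/seteqP; split=> [x /sP[a [b [ab ca cb]]]|x [i _ cx]].
    have [aL ax] := level_centre ab ca cb.
    by exists (enum_rank_in aL (level eta a)) => //; rewrite enum_rankK_in.
  have [a [b [_ _ ab ca cb]]] := centre_crit (enum_valP i) cx.
  by move=> /regular_atE; exact: (singular_crit (stalk_isloc x) ab ca cb).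
by move=> i; apply: centre_cylinder => //; exact: enum_valP.
Qed.
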